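(* Let $g:[0,1]\times E\to\mathbb R$ be bounded and measurable and assume: (i) there is $L>0$ such that $\sup_{x\in E}\|\delta_xQ_u-\delta_xQ_v\|_{\mathrm{TV}}\le L|u-v|$ for all $u,v\in[0,1]$; (ii) there are an integer $m\ge 1$ and $r\in(0,1)$ such that $\sup_{u\in[0,1]}\sup_{x,y\in E}\|\delta_xQ_u^m-\delta_yQ_u^m\|_{\mathrm{TV}}\le r$; (iii) there is $K<\infty$ such that $\sup_{u\in[0,1]}\|g(u,\cdot)\|_\infty\le K$; (iv) there is $C_g\ge 0$ such that $|g(u,x)-g(v,x)|\le C_g|u-v|$ for all $u,v\in[0,1]$, $x\in E$; (v) for every $u\in[0,1]$ and every real $t\ne0$, $r(Q_{u,it})<1$. Then for every function $G:\mathbb R\to\mathbb R$ which is either continuous with compact support or the indicator of a bounded interval, $$\lim_{n\to\infty}\sup_{v\in\mathbb R}\left|a\sqrt{2\pi n}\;\mathbb E[G(S_n-v)]-\left(\int_{\mathbb R} G(x)\,dx\right)e^{-\frac{(v-bn)^2}{2na^2}}\right|=0.$$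
   Context: $(E,d)$ is a metric space with Borel $\sigma$-algebra $\mathcal B(E)$ and $\{Q_u:u\in[0,1]\}$ is a family of Markov transition kernels on $(E,\mathcal B(E))$. $\mathfrak B$ is the Banach space of bounded $\mathcal B(E)$-measurable functions $f:E\to\mathbb C$ with the supremum norm $\|\cdot\|_\infty$. For probability measures, $\|\mu-\nu\|_{\mathrm{TV}}=\sup_{\|f\|_\infty\le1}|\int f\,d\mu-\int f\,d\nu|=2\sup_{A\in\mathcal B(E)}|\mu(A)-\nu(A)|$; $\delta_x$ is the Dirac mass at $x$. Under (i)-(ii) each $Q_u$ has a unique invariant probability measure, denoted $\pi_u$. For each $n\ge1$, $X_{n,0},X_{n,1},\dots,X_{n,n}$ is an inhomogeneous Markov chain on $E$ with $X_{n,0}\sim\pi_0$ (the measure $\pi_u$ at $u=0$) and $\mathbb P(X_{n,k}\in A\mid X_{n,k-1}=x)=Q_{k/n}(x,A)$ for $1\le k\le n$. Set $S_n=\sum_{k=1}^n g(k/n,X_{n,k})$. For $z\in\mathbb C$, the twisted operator $Q_{u,z}$ on $\mathfrak B$ is $Q_{u,z}f(x)=\int e^{zg(u,y)}f(y)\,Q_u(x,dy)$; $r(\cdot)$ applied to an operator denotes its spectral radius on $\mathfrak B$. Constants: $b=\int_0^1\int_E g(u,x)\,d\pi_u(x)\,du$; $a\ge 0$ is given by $a^2=\int_0^1a_u^2\,du$, where $a_u^2=\lim_{n\to\infty}\frac1n\operatorname{Var}(\sum_{j=1}^ng(u,Y_{j,u}))$ and $(Y_{j,u})_{j\ge0}$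 is the stationary Markov chain with transition operator $Q_u$ (initial law $\pi_u$). Under (i)-(v) one has $a>0$. *)

(* Defs.v *)
From HB Require Import structures.
From mathcomp Require Import all_boot all_order all_algebra.
From mathcomp Require Import complex.
From mathcomp Require Import all_classical all_reals all_analysis.

Set Implicit Arguments.
Unset Strict Implicit.
Unset Printing Implicit Defensive.

Import Order.TTheory GRing.Theory Num.Theory.
Import numFieldNormedType.Exports.

Local Open Scope classical_set_scope.
Local Open Scope ring_scope.

(* The library only puts a generated sigma-algebra on a pointed type.  Metric
   spaces carrying a probability measure are nonempty, so asking for a point is
   no restriction. *)
#[short(type="pmetricType")]
HB.structure Definition PointedMetric (K : numDomainType) :=
  { M of Metric K M & Pointed M }.

Notation borel E := (g_sigma_algebraType (@open E)).

Section complex_functions.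
Context {R : realType} {d : measure_display} {T : measurableType d}.

Definition cexp (z : R[i]) : R[i] :=
  Complex (expR (complex.Re z) * cos (complex.Im z))
          (expR (complex.Re z) * sin (complex.Im z)).

Definition cintegral (mu : {measure set T -> \bar R}) (f : T -> R[i]) : R[i] :=
  Complex (\int[mu]_x complex.Re (f x)) (\int[mu]_x complex.Im (f x)).

Definition bounded_measurable : set (T -> R[i]) := [set f : T -> R[i] |
  [/\ measurable_fun setT (fun x => complex.Re (f x)),
      measurable_fun setT (fun x => complex.Im (f x)) &
      exists M : R, forall x, Normc.normc (f x) <= M]].

Definition supnorm (f : T -> R[i]) : R :=
  sup (range (fun x => Normc.normc (f x))).

Definition tv_norm (mu nu : {measure set T -> \bar R}) : \bar R :=
  ereal_sup [set (Normc.normc (cintegral mu f - cintegral nu f))%:E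
            | f in [set f | bounded_measurable f /\ supnorm f <= 1]].

(* Operators on the Banach space of bounded measurable functions are maps on
   all functions, of which only the restriction to [bounded_measurable]
   matters. *)
Definition bounded_operator (A : (T -> R[i]) -> (T -> R[i])) : Prop :=
  [/\ forall f, bounded_measurable f -> bounded_measurable (A f),
      forall (c : R[i]) f h, bounded_measurable f -> bounded_measurable h ->
        A (fun x => c * f x + h x) = (fun x => c * A f x + A h x) &
      exists M : R, forall f, bounded_measurable f ->
        supnorm (A f) <= M * supnorm f].

Definition spectrum (A : (T -> R[i]) -> (T -> R[i])) : set R[i] :=
  [set lam | ~ exists B : (T -> R[i]) -> (T -> R[i]), bounded_operator B /\
     forall f, bounded_measurable f ->
       B (fun x => lam * f x - A f x) = f /\
       (fun x => lam * B f x - A (B f) x) = f].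

Definition spectral_radius (A : (T -> R[i]) -> (T -> R[i])) : \bar R :=
  ereal_sup [set (Normc.normc lam)%:E | lam in spectrum A].

Definition twisted (k : R.-pker T ~> T) (h : T -> R) (z : R[i])
    (f : T -> R[i]) (x : T) : R[i] :=
  cintegral (k x) (fun y => cexp (z * (h y)%:C%C) * f y).

End complex_functions.

Section markov.
Context {R : realType} {d : measure_display} {T : measurableType d}.

Fixpoint kernel_iter (k : R.-pker T ~> T) (m : nat) : R.-spker T ~> T :=
  if m is m'.+1 then mkcomp_noparam k (kernel_iter k m')
  else kdirac (@measurable_id _ T setT).

Definition invariant_measure (k : R.-pker T ~> T) (mu : probability T R) : Prop :=
  forall A, measurable A -> (\int[mu]_x k x A = mu A)%E.

Context {d' : measure_display} {Omega : measurableType d'}.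

Definition past (X : nat -> Omega -> T) (k : nat) : set (set Omega) :=
  <<s \bigcup_(j in [set j | (j <= k)%N])
        preimage_set_system setT (X j) measurable >>.

(* [X 0, ..., X N] is a Markov chain with initial law [mu], [K k] being the
   kernel of the step from time [k.-1] to time [k].  The last clause says that
   [K k.+1 (X k) A] is the conditional probability of [X k.+1 \in A] given
   [X 0, ..., X k]. *)
Definition markov_chain (N : nat) (P : probability Omega R)
    (mu : probability T R) (K : nat -> R.-pker T ~> T)
    (X : nat -> Omega -> T) : Prop :=
  [/\ forall k, (k <= N)%N -> measurable_fun setT (X k),
      forall A, measurable A -> P (X 0%N @^-1` A) = mu A &
      forall k, (k < N)%N -> forall H A, past X k H -> measurable A ->
        (P (H `&` X k.+1 @^-1` A) = \int[P]_(w in H) K k.+1 (X k w) A)%E].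

Definition asymptotic_variance (P : probability Omega R) (h : T -> R)
    (Y : nat -> Omega -> T) : R :=
  limn (fun n : nat =>
    n%:R^-1 * fine 'V_P[fun w => \sum_(1 <= j < n.+1) h (Y j w)]).

End markov.

Definition test_function {R : realType} (G : R -> R) : Prop :=
  (continuous G /\ compact (closure [set x : R | G x != 0])) \/
  (exists I : set R, [/\ is_interval I, bounded_set I & G = \1_I]).

(* Main.v *)
(* Write [phi_n] for the characteristic function of [S_n] and [gam_n] for that of the normal law
   with mean [b n] and variance [a^2 n].  The claim follows from
   [sqrt n * int_0^T |phi_n - gam_n| -> 0] for every [T]: a test function is approximated by its
   convolution with a Fejer kernel, whose Fourier transform is supported in [[-T, T]], with an
   error controlled by an integrable weight of the same kind; indicators of intervals are
   squeezed between trapezoids.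

   By the Markov property [phi_n (t)] is the mean of the product of the twisted operators
   [Q_{k/n, it}] applied to 1.  Solving two Poisson equations for each [Q_u], which is possible
   because [Q_u^m] contracts oscillations, gives an approximate eigenfunction of [Q_{u, it}], with
   eigenvalue [exp (i t a_u - t^2 s_u / 2)] up to [O(t^3)] and Lipschitz in [u].  Telescoping shows
   that the product is close to the product of these eigenvalues for [t = O(n^-1/2)] and, used on
   blocks of length of order [t^-2], that it is [O(1 / (n t^2))] near [0].  Away from [0] the
   condition on the spectral radius, made uniform by compactness, gives geometric decay.  Finally
   [s_u] is the asymptotic variance; it is positive, since otherwise the centred sums would
   be bounded in mean square, against that decay. *)

Require Import Defs.
From HB Require Import structures.
From mathcomp Require Import all_boot all_order all_algebra.
From mathcomp Require Import complex.
From mathcomp Require Import all_classical all_reals all_analysis.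
From mathcomp Require Import measurable_realfun ring lra zify.
Set Implicit Arguments.
Unset Strict Implicit.
Unset Printing Implicit Defensive.
Import Order.TTheory GRing.Theory Num.Theory.
Import numFieldNormedType.Exports.
Local Open Scope classical_set_scope.
Local Open Scope ring_scope.

(** * Complex modulus, phases and trigonometric inequalities *)

(** No perturbation theory of isolated eigenvalues is used: the operator estimates telescope
    products of contractions in the supremum norm, so approximate eigenfunctions suffice. Second
    order is the right accuracy: an error [O(t^3)] per step adds up to [n t^3], and [sqrt n] times
    the integral of [t + n t^3] over [t <= rho / sqrt n] is [O(n^-1/2)] for fixed [rho]. From there
    up to a fixed [del], the bound [O(1 / (n t^2))] contributes [O(1 / rho)]; this does not vanish
    with [n], so [rho] is fixed from the target precision before [n]. Beyond [del] even [O(1 / n)]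
    is enough, so geometric rates get weakened to polynomial ones. The spectral radius, a supremum
    over the spectrum, gives at first only bounded inverses on the unit circle; a bound on powers
    has to be extracted from them. It says that some power shrinks by a fixed factor, a form that
    survives small changes of [(u, t)], as compactness and slowly varying products require. Poisson
    equations are solved up to an additive constant, with a normalisation at one point: oscillations
    ignore constants, so invariant measures enter only with the stationary chains. *)

Notation normc := Normc.normc.

Section complex_modulus.
Context {R : realType}.
Implicit Types (z w : R[i]) (x y t : R).

Lemma normc_ge0 z : 0 <= normc z.
Proof. by case: z => a b /=; exact: sqrtr_ge0. Qed.

(* The library states the next two facts on the alias [Rcomplex R]. *)
Lemma ler_normcD z w : normc (z + w) <= normc z + normc w.
Proof. exact: le_normcD. Qed.

Lemma normc_opp z : normc (- z) = normc z.
Proof. exact: normcN. Qed.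

Lemma ler_normcB z w : normc (z - w) <= normc z + normc w.
Proof. by rewrite -[normc w]normc_opp ler_normcD. Qed.

Lemma normcBC z w : normc (z - w) = normc (w - z).
Proof. by rewrite -normc_opp opprB. Qed.

Lemma normc_real x : normc (x%:C)%C = `|x|.
Proof. by rewrite /= expr0n/= addr0 sqrtr_sqr. Qed.

Lemma normc_imag x : normc (Complex 0 x) = `|x|.
Proof. by rewrite /= expr0n/= add0r sqrtr_sqr. Qed.

Lemma complex_split z : z = (complex.Re z)%:C%C + Complex 0 (complex.Im z).
Proof. by case: z => a b; apply/eqP; rewrite eq_complex /= addr0 add0r !eqxx. Qed.

Lemma ler_normc_ReIm z : normc z <= `|complex.Re z| + `|complex.Im z|.
Proof.
by rewrite {1}(complex_split z) (le_trans (ler_normcD _ _))// normc_real normc_imag.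
Qed.

Lemma ler_Re_normc z : `|complex.Re z| <= normc z.
Proof.
case: z => a b /=; rewrite -sqrtr_sqr ler_sqrt ?lerDl ?sqr_ge0//.
by rewrite addr_ge0// sqr_ge0.
Qed.

Lemma ler_Im_normc z : `|complex.Im z| <= normc z.
Proof.
case: z => a b /=; rewrite -sqrtr_sqr ler_sqrt ?lerDr ?sqr_ge0//.
by rewrite addr_ge0// sqr_ge0.
Qed.

Lemma sqr_normcE z : normc z ^+ 2 = complex.Re z ^+ 2 + complex.Im z ^+ 2.
Proof. by case: z => a b /=; rewrite sqr_sqrtr// addr_ge0// sqr_ge0. Qed.

Lemma normcX z n : normc (z ^+ n) = normc z ^+ n.
Proof.
elim: n => [|n IH]; first by rewrite !expr0 Normc.normc1.
by rewrite !exprS Normc.normcM IH.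
Qed.

Lemma ler_normc_sum (I : Type) (s : seq I) (F : I -> R[i]) :
  normc (\sum_(i <- s) F i) <= \sum_(i <- s) normc (F i).
Proof.
elim: s => [|a s IH]; first by rewrite !big_nil Normc.normc0.
by rewrite !big_cons (le_trans (ler_normcD _ _))// lerD2l.
Qed.

Lemma cReD z w : complex.Re (z + w) = complex.Re z + complex.Re w.
Proof. by case: z w => [? ?] [? ?]. Qed.
Lemma cImD z w : complex.Im (z + w) = complex.Im z + complex.Im w.
Proof. by case: z w => [? ?] [? ?]. Qed.
Lemma cReN z : complex.Re (- z) = - complex.Re z.
Proof. by case: z. Qed.
Lemma cImN z : complex.Im (- z) = - complex.Im z.
Proof. by case: z. Qed.
Lemma cReM z w : complex.Re (z * w) =
  complex.Re z * complex.Re w - complex.Im z * complex.Im w.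
Proof. by case: z w => [? ?] [? ?]. Qed.
Lemma cImM z w : complex.Im (z * w) =
  complex.Re z * complex.Im w + complex.Im z * complex.Re w.
Proof. by case: z w => [? ?] [? ?]. Qed.

Lemma complexP z w : complex.Re z = complex.Re w ->
  complex.Im z = complex.Im w -> z = w.
Proof. by case: z w => [? ?] [? ?] /= -> ->. Qed.

Definition eit t : R[i] := Complex (cos t) (sin t).

Lemma eitD x y : eit (x + y) = eit x * eit y.
Proof. by apply: complexP; rewrite ?cReM ?cImM /= ?cosD ?sinD//; ring. Qed.

Lemma eit0 : eit 0 = 1.
Proof. by rewrite /eit cos0 sin0. Qed.

Lemma normc_eit t : normc (eit t) = 1.
Proof. by rewrite /= cos2Dsin2 sqrtr1. Qed.

Lemma cexp_imag t x : cexp (Complex 0 t * x%:C%C) = eit (t * x).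
Proof. by rewrite /cexp cReM cImM /= mul0r mulr0 subr0 mul0r add0r expR0 !mul1r. Qed.

Lemma eitMn x n : eit (n%:R * x) = eit x ^+ n.
Proof.
elim: n => [|n IH]; first by rewrite mul0r eit0 expr0.
by rewrite -natr1 mulrDl mul1r eitD IH exprSr.
Qed.

End complex_modulus.

(** * Taylor bounds for sine, cosine, phases and the exponential *)

Section trigonometric_bounds.
Context {R : realType}.
Implicit Types (x y : R).

(** The inequalities below form ladders: the derivative of each is an earlier one, so each rung
    gains one order from the mean value theorem on [[0, x]]. *)
Lemma derive_ge0_ge0 (f df : R -> R) : f 0 = 0 ->
  (forall x, is_derive x 1 f (df x)) -> (forall x, 0 <= x -> 0 <= df x) ->
  forall x, 0 <= x -> 0 <= f x.
Proof.
move=> f0 fd df0 x x0.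
have [|c] := @MVT_segment R f df 0 x x0 (fun y _ => fd y).
  by apply: derivable_within_continuous => y _; exact: (@ex_derive _ _ _ _ _ _ _ (fd y)).
by rewrite in_itv/= => /andP[c0 _]; rewrite f0 !subr0 => ->; rewrite mulr_ge0 ?df0.
Qed.

Lemma cos_ge_1B x : 0 <= x -> 0 <= x - 1 + cos x.
Proof.
apply: (@derive_ge0_ge0 (fun x => x - 1 + cos x) (fun x => 1 - sin x)).
- by rewrite cos0; ring.
- by move=> y; apply: is_derive_eq; rewrite /= /GRing.scale/=; ring.
- by move=> y _; have := sin_le1 y; lra.
Qed.

Lemma sin_lex x : 0 <= x -> 0 <= x - sin x.
Proof.
apply: (@derive_ge0_ge0 (fun x => x - sin x) (fun x => 1 - cos x)).
- by rewrite sin0; ring.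
- by move=> y _; have := cos_le1 y; lra.
Qed.

Lemma sin_ge_xB x : 0 <= x -> 0 <= x ^+ 2 / 2 - x + sin x.
Proof.
apply: (@derive_ge0_ge0 (fun x => x ^+ 2 / 2 - x + sin x)
  (fun x => x - 1 + cos x)).
- by rewrite sin0; ring.
- move=> y; have -> : (fun x => x ^+ 2 / 2 - x + sin x) =
     (fun x : R => x * x * 2^-1 - x + sin x) by [].
  by apply: is_derive_eq; rewrite /= /GRing.scale/=; field.
- exact: cos_ge_1B.
Qed.

Lemma cos_ge x : 0 <= cos x - 1 + x ^+ 2 / 2.
Proof.
wlog x0 : x / 0 <= x.
  move=> H; have [/H//|/ltW x0] := leP 0 x.
  by rewrite -[cos x]cosN -[x ^+ 2]sqrrN H// oppr_ge0.
apply: (@derive_ge0_ge0 (fun x => cos x - 1 + x ^+ 2 / 2)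
  (fun x => x - sin x)) => //.
- by rewrite cos0; ring.
- move=> y; have -> : (fun x => cos x - 1 + x ^+ 2 / 2) =
     (fun x : R => cos x - 1 + x * x * 2^-1) by [].
  by apply: is_derive_eq; rewrite /= /GRing.scale/=; field.
- exact: sin_lex.
Qed.

Lemma sin_ge_cubic x : 0 <= x -> 0 <= sin x - x + x ^+ 3 / 6.
Proof.
apply: (@derive_ge0_ge0 (fun x => sin x - x + x ^+ 3 / 6)
  (fun x => cos x - 1 + x ^+ 2 / 2)).
- by rewrite sin0; ring.
- move=> y; have -> : (fun x => sin x - x + x ^+ 3 / 6) =
     (fun x : R => sin x - x + x * x * x * 6^-1).
    by apply/funext => z; ring.
  by apply: is_derive_eq; rewrite /= /GRing.scale/=; field.
- by move=> y _; exact: cos_ge.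
Qed.

Lemma cos_le_cubic x : 0 <= x -> 0 <= x ^+ 3 / 6 - (cos x - 1 + x ^+ 2 / 2).
Proof.
apply: (@derive_ge0_ge0 (fun x => x ^+ 3 / 6 - (cos x - 1 + x ^+ 2 / 2))
  (fun x => x ^+ 2 / 2 - x + sin x)).
- by rewrite cos0; ring.
- move=> y; have -> : (fun x => x ^+ 3 / 6 - (cos x - 1 + x ^+ 2 / 2)) =
     (fun x : R => x * x * x * 6^-1 - (cos x - 1 + x * x * 2^-1)).
    by apply/funext => z; ring.
  by apply: is_derive_eq; rewrite /= /GRing.scale/=; field.
- exact: sin_ge_xB.
Qed.

Lemma cos_ge_quartic x : 0 <= 1 - x ^+ 2 / 2 + x ^+ 4 / 24 - cos x.
Proof.
wlog x0 : x / 0 <= x.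
  move=> H; have [/H//|/ltW x0] := leP 0 x.
  have -> : x ^+ 4 = (- x) ^+ 4 by ring.
  by rewrite -[cos x]cosN -[x ^+ 2]sqrrN H// oppr_ge0.
apply: (@derive_ge0_ge0 (fun x => 1 - x ^+ 2 / 2 + x ^+ 4 / 24 - cos x)
  (fun x => sin x - x + x ^+ 3 / 6)) => //.
- by rewrite cos0; ring.
- move=> y; have -> : (fun x => 1 - x ^+ 2 / 2 + x ^+ 4 / 24 - cos x) =
     (fun x : R => 1 - x * x * 2^-1 + x * x * x * x * 24^-1 - cos x).
    by apply/funext => z; ring.
  by apply: is_derive_eq; rewrite /= /GRing.scale/=; field.
- exact: sin_ge_cubic.
Qed.

(** Real and imaginary parts contribute at most [|x|^3 / 6] each; negative [x] follows by
    conjugation. *)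
Lemma eit_taylor3 x :
  normc (eit x - (1 + Complex 0 x - (x ^+ 2 / 2)%:C%C)) <= `|x| ^+ 3.
Proof.
wlog x0 : x / 0 <= x.
  move=> H; have [/H//|/ltW x0] := leP 0 x.
  have := H (- x); rewrite oppr_ge0 normrN sqrrN => /(_ x0); apply: le_trans.
  rewrite le_eqVlt; apply/orP; left; apply/eqP.
  rewrite /eit /= cosN sinN; congr (Num.sqrt (_ + _)).
  by rewrite -sqrrN; congr (_ ^+ 2); ring.
rewrite (le_trans (ler_normc_ReIm _))// !(cReD, cImD, cReN, cImN) /=.
have := sin_lex x0; have := sin_ge_cubic x0; have := cos_ge x.
have := cos_le_cubic x0; rewrite (ger0_norm x0) => h1 h2 h3 h4.
have x3 : 0 <= x ^+ 3 by exact: exprn_ge0.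
have h5 : `|cos x - (1 + 0 - x ^+ 2 / 2)| <= x ^+ 3 / 6.
  by rewrite ler_norml; apply/andP; split; lra.
have h6 : `|sin x - (0 + x - 0)| <= x ^+ 3 / 6.
  by rewrite ler_norml; apply/andP; split; lra.
lra.
Qed.

(** The squared chord is [2 - 2 cos (x - y)], which [cos_ge] bounds by [(x - y)^2]. *)
Lemma eit_lip x y : normc (eit x - eit y) <= `|x - y|.
Proof.
rewrite -(@ler_pXn2r _ 2)// ?nnegrE ?normc_ge0// sqr_normcE real_normK ?num_real//.
rewrite !(cReD, cImD, cReN, cImN) /=.
have h := cos_ge (x - y); rewrite cosB in h.
have hx := cos2Dsin2 x; have hy := cos2Dsin2 y.
suff -> : (cos x - cos y) ^+ 2 + (sin x - sin y) ^+ 2 =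
  (cos x ^+ 2 + sin x ^+ 2) + (cos y ^+ 2 + sin y ^+ 2)
  - 2 * (cos x * cos y + sin x * sin y) by rewrite hx hy; lra.
ring.
Qed.

Lemma normc_eitB1 x : normc (eit x - 1) <= `|x|.
Proof. by rewrite -eit0 -{2}[x]subr0 eit_lip. Qed.

Lemma expR_taylor2 x : 0 <= x -> `|expR (- x) - (1 - x)| <= x ^+ 2.
Proof.
move=> x0; have h1 := expR_ge1Dx (- x).
have h2 : expR (- x) <= (1 + x)^-1.
  by rewrite expRN lef_pV2 ?posrE ?expR_gt0 ?expR_ge1Dx//; lra.
rewrite ger0_norm; last by lra.
have h3 : (1 + x)^-1 <= 1 - x + x ^+ 2.
  rewrite -[X in X <= _]mul1r ler_pdivrMr; last by lra.
  have : 0 <= x ^+ 3 by exact: exprn_ge0.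
  rewrite !exprS expr0; nra.
lra.
Qed.

End trigonometric_bounds.

(** * Bounded measurable functions *)

Section bounded_measurable_functions.
Context {R : realType} {d : measure_display} {T : measurableType d}.
Implicit Types (f g : T -> R) (F G : T -> R[i]).

Definition bmr f := measurable_fun setT f /\ exists M : R, forall x, `|f x| <= M.

Lemma bmr_cst (c : R) : bmr (fun=> c).
Proof. by split; [exact: measurable_cst|exists `|c| => _]. Qed.

Lemma bmrN f : bmr f -> bmr (fun x => - f x).
Proof.
move=> [mf [M hM]]; split; first exact: measurableT_comp.
by exists M => x; rewrite normrN.
Qed.

Lemma bmrD f g : bmr f -> bmr g -> bmr (fun x => f x + g x).
Proof.
move=> [mf [M hM]] [mg [N hN]]; split; first exact: measurable_funD.
by exists (M + N) => x; rewrite (le_trans (ler_normD _ _))// lerD.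
Qed.

Lemma bmrB f g : bmr f -> bmr g -> bmr (fun x => f x - g x).
Proof. by move=> hf hg; apply: (bmrD hf); exact: bmrN. Qed.

Lemma bmrM f g : bmr f -> bmr g -> bmr (fun x => f x * g x).
Proof.
move=> [mf [M hM]] [mg [N hN]]; split; first exact: measurable_funM.
by exists (M * N) => x; rewrite normrM ler_pM.
Qed.

Lemma bmrZ (c : R) f : bmr f -> bmr (fun x => c * f x).
Proof. exact/bmrM/bmr_cst. Qed.

Lemma bmrX f n : bmr f -> bmr (fun x => f x ^+ n).
Proof.
move=> hf; elim: n => [|n IH]; first exact: (bmr_cst 1).
by under [X in bmr X]eq_fun do rewrite exprS; exact: bmrM.
Qed.

Lemma bmr_sum (I : Type) (s : seq I) (f : I -> T -> R) :
  (forall i, bmr (f i)) -> bmr (fun x => \sum_(i <- s) f i x).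
Proof.
move=> hf; elim: s => [|a s IH].
  by under [X in bmr X]eq_fun do rewrite big_nil; exact: bmr_cst.
by under [X in bmr X]eq_fun do rewrite big_cons; exact: bmrD.
Qed.

Lemma bmr_indic (A : set T) : measurable A -> bmr (\1_A).
Proof.
move=> mA; split; first exact: measurable_indic.
by exists 1 => x; rewrite indicE; case: (_ \in _); rewrite ?normr1 ?normr0.
Qed.

Lemma bmCP F : bounded_measurable F <->
  bmr (fun x => complex.Re (F x)) /\ bmr (fun x => complex.Im (F x)).
Proof.
split=> [[mR mI [M hM]]|[[mR [M hM]] [mI [N hN]]]].
  split; split=> //; exists M => x; apply: le_trans (hM x).
    exact: ler_Re_normc.
  exact: ler_Im_normc.
split=> //; exists (M + N) => x.
by rewrite (le_trans (ler_normc_ReIm _))// lerD.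
Qed.

Lemma bmC_cst (c : R[i]) : bounded_measurable (fun _ : T => c).
Proof. by apply/bmCP; split; exact: bmr_cst. Qed.

Lemma bmCD F G : bounded_measurable F -> bounded_measurable G ->
  bounded_measurable (fun x => F x + G x).
Proof.
move=> /bmCP[FR FI] /bmCP[GR GI]; apply/bmCP; split.
  by under [X in bmr X]eq_fun do rewrite cReD; exact: bmrD.
by under [X in bmr X]eq_fun do rewrite cImD; exact: bmrD.
Qed.

Lemma bmCM F G : bounded_measurable F -> bounded_measurable G ->
  bounded_measurable (fun x => F x * G x).
Proof.
move=> /bmCP[FR FI] /bmCP[GR GI]; apply/bmCP; split.
  by under [X in bmr X]eq_fun do rewrite cReM; apply: bmrB; exact: bmrM.
by under [X in bmr X]eq_fun do rewrite cImM; apply: bmrD; exact: bmrM.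
Qed.

Lemma bmCZ (c : R[i]) F : bounded_measurable F ->
  bounded_measurable (fun x => c * F x).
Proof. exact/bmCM/bmC_cst. Qed.

Lemma bmCN F : bounded_measurable F -> bounded_measurable (fun x => - F x).
Proof.
by move=> hF; under [X in bounded_measurable X]eq_fun do rewrite -mulN1r; exact: bmCZ.
Qed.

Lemma bmCB F G : bounded_measurable F -> bounded_measurable G ->
  bounded_measurable (fun x => F x - G x).
Proof. by move=> hf hg; apply: (bmCD hf); exact: bmCN. Qed.

Lemma bmC_sum (I : Type) (s : seq I) (F : I -> T -> R[i]) :
  (forall i, bounded_measurable (F i)) ->
  bounded_measurable (fun x => \sum_(i <- s) F i x).
Proof.
move=> hf; elim: s => [|a s IH].
  by under [X in bounded_measurable X]eq_fun do rewrite big_nil; exact: bmC_cst.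
by under [X in bounded_measurable X]eq_fun do rewrite big_cons; exact: bmCD.
Qed.

Lemma bmC_real f : bmr f -> bounded_measurable (fun x => (f x)%:C%C).
Proof. by move=> hf; apply/bmCP; split=> //; exact: bmr_cst. Qed.

Lemma bmr_cos f : measurable_fun setT f -> bmr (fun x => cos (f x)).
Proof.
move=> mf; split.
  apply: measurableT_comp => //; apply: continuous_measurable_fun.
  exact: continuous_cos.
by exists 1 => x; exact: cos_max.
Qed.

Lemma bmr_sin f : measurable_fun setT f -> bmr (fun x => sin (f x)).
Proof.
move=> mf; split.
  apply: measurableT_comp => //; apply: continuous_measurable_fun.
  exact: continuous_sin.
by exists 1 => x; exact: sin_max.
Qed.

Lemma bmC_eit f : measurable_fun setT f -> bounded_measurable (fun x => eit (f x)).
Proof. by move=> mf; apply/bmCP; split; [exact: bmr_cos|exact: bmr_sin]. Qed.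

End bounded_measurable_functions.

(** * Integrals of bounded functions against a probability measure *)

Section probability_integrals.
Context {R : realType} {d : measure_display} {T : measurableType d}.
Variable mu : {measure set T -> \bar R}.
Hypothesis mu1 : mu setT = 1%E.
Implicit Types (f g : T -> R) (F G : T -> R[i]).

Lemma bmr_integrable f : bmr f -> mu.-integrable setT (EFin \o f).
Proof.
move=> [mf [M hM]]; apply: measurable_bounded_integrable => //.
  by rewrite mu1 ltry.
exists M; split; first exact: num_real.
by move=> y My x _ /=; rewrite (le_trans (hM x))// ltW.
Qed.

Lemma Rint_cst (c : R) : \int[mu]_x c = c.
Proof. by rewrite Rintegral_cst// mu1 mulr1. Qed.

Lemma RintD f g : bmr f -> bmr g ->
  \int[mu]_x (f x + g x) = \int[mu]_x f x + \int[mu]_x g x.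
Proof. by move=> hf hg; rewrite RintegralD//; exact: bmr_integrable. Qed.

Lemma RintB f g : bmr f -> bmr g ->
  \int[mu]_x (f x - g x) = \int[mu]_x f x - \int[mu]_x g x.
Proof. by move=> hf hg; rewrite RintegralB//; exact: bmr_integrable. Qed.

Lemma RintZ (c : R) f : bmr f -> \int[mu]_x (c * f x) = c * \int[mu]_x f x.
Proof. by move=> hf; rewrite RintegralZl//; exact: bmr_integrable. Qed.

Lemma Rint_sum (I : Type) (s : seq I) (f : I -> T -> R) :
  (forall i, bmr (f i)) ->
  \int[mu]_x (\sum_(i <- s) f i x) = \sum_(i <- s) \int[mu]_x f i x.
Proof.
move=> hf; elim: s => [|a s IH].
  by under eq_Rintegral do rewrite big_nil; rewrite big_nil Rint_cst.
under eq_Rintegral do rewrite big_cons.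
by rewrite RintD// ?IH ?big_cons//; exact: bmr_sum.
Qed.

Lemma Rint_le f g : bmr f -> bmr g -> (forall x, f x <= g x) ->
  \int[mu]_x f x <= \int[mu]_x g x.
Proof. by move=> hf hg fg; apply: le_Rintegral => //; exact: bmr_integrable. Qed.

Lemma ler_norm_Rint f (M : R) : bmr f -> (forall x, `|f x| <= M) ->
  `|\int[mu]_x f x| <= M.
Proof.
move=> hf hM; rewrite ler_norml; apply/andP; split.
  rewrite -[X in X <= _]Rint_cst Rint_le//; first exact: bmr_cst.
  by move=> x; have := hM x; rewrite ler_norml => /andP[].
rewrite -[X in _ <= X]Rint_cst Rint_le//; first exact: bmr_cst.
by move=> x; have := hM x; rewrite ler_norml => /andP[].
Qed.

Lemma cintD F G : bounded_measurable F -> bounded_measurable G ->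
  cintegral mu (fun x => F x + G x) = cintegral mu F + cintegral mu G.
Proof.
move=> /bmCP[FR FI] /bmCP[GR GI]; apply: complexP => /=.
  by under eq_Rintegral do rewrite cReD; rewrite RintD.
by under eq_Rintegral do rewrite cImD; rewrite RintD.
Qed.

Lemma cintZ (c : R[i]) F : bounded_measurable F ->
  cintegral mu (fun x => c * F x) = c * cintegral mu F.
Proof.
move=> /bmCP[FR FI]; apply: complexP => /=; rewrite ?cReM ?cImM.
  under eq_Rintegral do rewrite cReM.
  by rewrite RintB ?RintZ//; exact: bmrZ.
under eq_Rintegral do rewrite cImM.
by rewrite RintD ?RintZ//; exact: bmrZ.
Qed.

Lemma cintB F G : bounded_measurable F -> bounded_measurable G ->
  cintegral mu (fun x => F x - G x) = cintegral mu F - cintegral mu G.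
Proof.
move=> hF hG; under [X in cintegral mu X]eq_fun do rewrite -mulN1r.
by rewrite cintD ?cintZ ?mulN1r//; exact: bmCZ.
Qed.

Lemma cint_cst (c : R[i]) : cintegral mu (fun=> c) = c.
Proof. by case: c => a b; apply: complexP => /=; rewrite Rint_cst. Qed.

Lemma cint_real f : cintegral mu (fun x => (f x)%:C%C) = (\int[mu]_x f x)%:C%C.
Proof. by apply: complexP => //=; rewrite Rint_cst. Qed.

Lemma ler_normc_cint_fun F f : bounded_measurable F -> bmr f ->
  (forall x, normc (F x) <= f x) -> normc (cintegral mu F) <= \int[mu]_x f x.
Proof.
move=> hF hf hFf; set I := cintegral mu F.
have f0 : 0 <= \int[mu]_x f x.
  by apply: Rintegral_ge0 => x _; apply: le_trans (hFf x); exact: normc_ge0.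
have [I0|I0] := eqVneq (normc I) 0; first by rewrite I0.
have Ip : 0 < normc I by rewrite lt_neqAle eq_sym I0 normc_ge0.
(* rotate the integral to the positive real axis *)
pose J : R[i] := Complex (complex.Re I) (- complex.Im I).
have nJ : normc J = normc I by rewrite /= sqrrN; case: (I).
have hJF : bounded_measurable (fun x => J * F x) by exact: bmCZ.
rewrite -(ler_pM2l Ip) -expr2.
have -> : normc I ^+ 2 = complex.Re (J * I).
  by rewrite sqr_normcE cReM /=; ring.
rewrite /I -cintZ// /= -RintZ//; apply: Rint_le => //.
- by case/bmCP: hJF.
- exact: bmrZ.
move=> x; rewrite (le_trans (ler_norm _))// (le_trans (ler_Re_normc _))//.
by rewrite Normc.normcM nJ ler_pM2l.
Qed.

Lemma ler_normc_cint F (M : R) : bounded_measurable F -> (forall x, normc (F x) <= M) ->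
  normc (cintegral mu F) <= M.
Proof.
move=> hF hM; rewrite -[M]Rint_cst; apply: ler_normc_cint_fun => //.
exact: bmr_cst.
Qed.

End probability_integrals.

(** * Operators of a kernel *)

Section bounded_measurable_induction.
Context {R : realType} {d : measure_display} {T : measurableType d}.

(** The sum counts the levels [e, 2e, ..., N e] that do not exceed [y], so it rounds [y] down to a
    multiple of [e] as long as [y <= N e]. The saturated branch serves to carry the induction. *)
Lemma staircase_bound (e y : R) N : 0 < e -> 0 <= y ->
  let s := \sum_(j < N) e * ((j.+1%:R * e <= y)%R : nat)%:R in
  if y <= N%:R * e then (s <= y <= s + e : Prop) else s = N%:R * e.
Proof.
move=> e0 y0; elim: N => [|N] /=.
  rewrite big_ord0 mul0r; case: ifPn => // h; lra.
rewrite big_ord_recr /=; set s := \sum_(_ < _) _; rewrite -natr1 mulrDl mul1r.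
case: ifPn => h1.
  move=> /andP[h2 h3]; have -> : (N%:R * e + e <= y) = false by apply/negbTE; lra.
  by rewrite mulr0 addr0; case: ifPn => h; lra.
move=> ->; rewrite -ltNge in h1; case: ifPn => h2.
  by have [h3|h3] := leP (N%:R * e + e) y; rewrite /= ?mulr1 ?mulr0 ?addr0; apply/andP; split; lra.
rewrite -ltNge in h2; have -> : N%:R * e + e <= y by lra.
by rewrite /= mulr1.
Qed.

(* Every bounded measurable function is a uniform limit of linear combinations of
   indicators [f >= c]. *)
Lemma bmr_ind (P : (T -> R) -> Prop) :
  (forall A, measurable A -> P (\1_A)) ->
  (forall (a : R) f g, bmr f -> bmr g -> P f -> P g -> P (fun x => a * f x + g x)) ->
  (forall f, bmr f -> (forall e : R, 0 < e ->
     exists g, [/\ bmr g, P g & forall x, `|f x - g x| <= e]) -> P f) ->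
  forall f, bmr f -> P f.
Proof.
move=> Pi Pl Pu f hf; apply: Pu => // e e0.
have [mf [M hM]] := hf.
have M0 : 0 <= M by apply: le_trans (hM point).
(* [f + M] takes values in [[0, 2 M]], so [N] steps of height [e] reach its supremum. *)
pose N := Num.bound (2 * M / e).
pose A (j : nat) := [set x | j.+1%:R * e <= f x + M].
have mA j : measurable (A j).
  have -> : A j = setT `&` (fun x => f x + M) @^-1` `[j.+1%:R * e, +oo[.
    by rewrite setTI; apply/seteqP; split => x; rewrite /A/= in_itv/= andbT.
  by apply: (measurable_funD mf (measurable_cst M)) => //; exact: measurable_itv.
pose g := fun x => \sum_(j < N) e * \1_(A j) x - M.
have Pc c : P (fun=> c).
  have h0 : P (fun=> 0).
    have := Pl (-1) _ _ (bmr_indic measurableT) (bmr_indic measurableT)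
      (Pi _ measurableT) (Pi _ measurableT).
    by under [X in P X -> _]eq_fun do rewrite mulN1r addNr.
  have := Pl c _ _ (bmr_indic measurableT) (bmr_cst 0) (Pi _ measurableT) h0.
  by under [X in P X -> _]eq_fun do rewrite indicE in_setT mulr1 addr0.
have hs n : bmr (fun x => \sum_(j < n) e * \1_(A j) x).
  by apply: bmr_sum => i; apply: bmrZ; exact: bmr_indic.
exists g; split; first by apply: bmrB => //; exact: bmr_cst.
  rewrite /g; under [X in P X]eq_fun do rewrite -[X in X - _]mul1r.
  apply: (Pl) => //; first exact: bmr_cst.
  rewrite -/N; elim: (N) => [|n IH]; first by under [X in P X]eq_fun do rewrite big_ord0; exact: Pc.
  under [X in P X]eq_fun do rewrite big_ord_recr /= addrC.
  exact: (Pl e _ _ (bmr_indic (mA n)) (hs n) (Pi _ (mA n)) IH).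
move=> x; have := hM x; rewrite ler_norml => /andP[h1 h2].
have y0 : 0 <= f x + M by lra.
have := staircase_bound N e0 y0.
have -> : \sum_(j < N) e * ((j.+1%:R * e <= f x + M)%R : nat)%:R = g x + M.
  rewrite /g subrK; apply: eq_bigr => j _; congr (_ * _).
  by rewrite indicE mem_setE.
have -> : f x + M <= N%:R * e.
  rewrite -ler_pdivrMr//; apply: (@le_trans _ _ (2 * M / e)).
    by rewrite ler_pM2r ?invr_gt0//; lra.
  rewrite ltW// /N; apply: le_lt_trans (archi_boundP _); first exact: lexx.
  by apply: divr_ge0; [exact: mulr_ge0|exact: ltW].
by rewrite ler_norml => /andP[h3 h4]; apply/andP; split; lra.
Qed.

End bounded_measurable_induction.

Section markov_operators.
Context {R : realType} {d : measure_display} {T : measurableType d}.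
Implicit Types (k : R.-pker T ~> T) (f g : T -> R) (F G : T -> R[i]).

Definition op k f : T -> R := fun x => \int[k x]_y f y.
Definition cop k F : T -> R[i] := fun x => cintegral (k x) F.

Lemma bmr_op k f : bmr f -> bmr (op k f).
Proof.
move=> hf; have [mf [M hM]] := hf; split; last first.
  by exists M => x; apply: ler_norm_Rint => //; exact: prob_kernel.
(* [measurable_fun_integral_kernel] concerns nonnegative functions, hence the shift by the bound
   [M]. *)
have -> : op k f = fun x => fine (\int[k x]_y (f y + M)%:E) - M.
  apply/funext => x; rewrite /op.
  have -> : fine (\int[k x]_y (f y + M)%:E) = \int[k x]_y (f y + M) by [].
  by rewrite RintD ?Rint_cst ?addrK//; [exact: prob_kernel|exact: prob_kernel|exact: bmr_cst].
apply: measurable_funB => //; apply: measurableT_comp => //.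
apply: measurable_fun_integral_kernel.
- exact: measurable_kernel.
- by move=> z; rewrite lee_fin; have := hM z; rewrite ler_norml => /andP[]; lra.
- by apply/measurable_EFinP; exact: measurable_funD.
Qed.

Lemma copE k F x : cop k F x =
  Complex (op k (fun y => complex.Re (F y)) x) (op k (fun y => complex.Im (F y)) x).
Proof. by []. Qed.

Lemma bmC_cop k F : bounded_measurable F -> bounded_measurable (cop k F).
Proof. by move=> /bmCP[hR hI]; apply/bmCP; split; exact: bmr_op. Qed.

Lemma ler_norm_op k f (M : R) : bmr f -> (forall x, `|f x| <= M) ->
  forall x, `|op k f x| <= M.
Proof. by move=> hf hM x; apply: ler_norm_Rint => //; exact: prob_kernel. Qed.

Lemma opD k f g : bmr f -> bmr g ->
  op k (fun x => f x + g x) = fun x => op k f x + op k g x.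
Proof. by move=> hf hg; apply/funext => x; rewrite /op RintD//; exact: prob_kernel. Qed.

Lemma opB k f g : bmr f -> bmr g ->
  op k (fun x => f x - g x) = fun x => op k f x - op k g x.
Proof. by move=> hf hg; apply/funext => x; rewrite /op RintB//; exact: prob_kernel. Qed.

Lemma opZ k (c : R) f : bmr f -> op k (fun x => c * f x) = fun x => c * op k f x.
Proof. by move=> hf; apply/funext => x; rewrite /op RintZ//; exact: prob_kernel. Qed.

Lemma op_cst k (c : R) : op k (fun=> c) = fun=> c.
Proof. by apply/funext => x; rewrite /op Rint_cst//; exact: prob_kernel. Qed.

Lemma bmr_iter_op k n f : bmr f -> bmr (iter n (op k) f).
Proof. by move=> hf; elim: n => // n IH; exact: bmr_op. Qed.

Lemma Rint_indic (mu : {measure set T -> \bar R}) (A : set T) : measurable A ->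
  \int[mu]_y \1_A y = fine (mu A).
Proof. by move=> mA; rewrite /Rintegral integral_indic// setIT. Qed.

Lemma kernel_iter_setT k m x : kernel_iter k m x setT = 1%E.
Proof.
elim: m x => [|m IH] x /=; first by rewrite /kdirac /= diracT.
rewrite /mkcomp_noparam /= /kcomp_noparam.
under eq_integral do rewrite IH.
by rewrite integral_cst// mul1e; exact: prob_kernel.
Qed.

(** Translates the iterated kernel of the contraction hypothesis into the iterated operator used
    from here on. By [bmr_ind] only indicators matter, and for them it is the definition of kernel
    composition. *)
Lemma Rint_kernel_iter k m f : bmr f ->
  forall x, \int[kernel_iter k m x]_y f y = iter m (op k) f x.
Proof.
elim: m f => [|m IH] f hf x /=.
  rewrite /Rintegral /kdirac/= integral_dirac//; first by rewrite diracT mul1e.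
  by apply/measurable_EFinP; case: hf.
have k1 y : k y setT = 1%E by exact: prob_kernel.
have k2 := kernel_iter_setT k m.
have k3 := kernel_iter_setT k m.+1 x.
have -> : iter m (op k) f = fun y => \int[kernel_iter k m y]_z f z.
  by apply/funext => y; rewrite IH.
suff : bmr (fun y => \int[kernel_iter k m y]_z f z) /\
    \int[kernel_iter k m.+1 x]_y f y = op k (fun y => \int[kernel_iter k m y]_z f z) x.
  by case.
have hb h : bmr h -> bmr (fun y => \int[kernel_iter k m y]_z h z).
  move=> hh; have -> : (fun y => \int[kernel_iter k m y]_z h z) = iter m (op k) h.
    by apply/funext => y; rewrite IH.
  exact: bmr_iter_op.
split; first exact: hb.
move: f hf; apply: bmr_ind.
- move=> A mA; rewrite Rint_indic// /op /= /mkcomp_noparam/= /kcomp_noparam.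
  rewrite /Rintegral; congr fine; apply: eq_integral => y _.
  rewrite integral_indic// setIT fineK//.
  rewrite ge0_fin_numE//; apply: (@le_lt_trans _ _ (kernel_iter k m y setT)).
    by apply: le_measure => //; rewrite ?inE.
  by rewrite k2 ltry.
- move=> a f g hf hg ef eg.
  have haf : bmr (fun x => a * f x) by exact: bmrZ.
  rewrite (RintD k3 haf hg) (RintZ k3 _ hf) ef eg.
  have -> : (fun y => \int[kernel_iter k m y]_z (a * f z + g z)) =
     fun y => a * \int[kernel_iter k m y]_z f z + \int[kernel_iter k m y]_z g z.
    by apply/funext => y; rewrite RintD ?RintZ//; exact: bmrZ.
  by rewrite opD ?opZ//; try exact: hb; apply: bmrZ; exact: hb.
- move=> f hf H; apply/eqP; rewrite -subr_eq0 -normr_le0; apply/ler_addgt0Pl => e e0.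
  have [|g [hg eg he]] := H (e / 2); first by rewrite divr_gt0.
  have h1 : `|\int[kernel_iter k m.+1 x]_y f y - \int[kernel_iter k m.+1 x]_y g y| <= e / 2.
    by rewrite -RintB//; apply: ler_norm_Rint => //; exact: bmrB.
  have h2 : `|op k (fun y => \int[kernel_iter k m y]_z f z) x -
      op k (fun y => \int[kernel_iter k m y]_z g z) x| <= e / 2.
    rewrite -RintB//; try exact: hb.
    apply: ler_norm_Rint => //; first by apply: bmrB; exact: hb.
    by move=> y; rewrite -RintB//; apply: ler_norm_Rint => //; exact: bmrB.
  rewrite eg in h1; rewrite addr0.
  apply: (le_trans (ler_distD (op k (fun y => \int[kernel_iter k m y]_z g z) x) _ _)).
  by rewrite [X in _ + X]distrC; lra.
Qed.

(** [F / M] is admissible in the supremum defining [tv_norm]; the case [M = 0], where [F] vanishes,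
    is split off. *)
Lemma tv_norm_cint (mu nu : {measure set T -> \bar R}) (c M : R) F :
  mu setT = 1%E -> nu setT = 1%E -> (tv_norm mu nu <= c%:E)%E ->
  bounded_measurable F -> (forall x, normc (F x) <= M) ->
  normc (cintegral mu F - cintegral nu F) <= c * M.
Proof.
move=> mu1 nu1 tv hF hM.
have M0 : 0 <= M by apply: le_trans (hM point); exact: normc_ge0.
have [M00|M1] := eqVneq M 0.
  have -> : F = fun=> 0.
    apply/funext => x; apply: Normc.eq0_normc; apply/eqP.
    by rewrite eq_le normc_ge0 andbT -M00.
  by rewrite !cint_cst// subrr Normc.normc0 M00 mulr0.
have Mp : 0 < M by rewrite lt_neqAle eq_sym M1.
pose G := fun x => (M^-1)%:C%C * F x.
have hG : bounded_measurable G by exact: bmCZ.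
have nG x : normc (G x) <= 1.
  rewrite /G Normc.normcM normc_real ger0_norm ?invr_ge0//.
  by rewrite mulrC ler_pdivrMr// mul1r.
have sG : supnorm G <= 1.
  apply: ge_sup; first by exists (normc (G point)), point.
  by move=> _ [x _ <-].
have : ((normc (cintegral mu G - cintegral nu G))%:E <= c%:E)%E.
  by apply: le_trans tv; apply: ereal_sup_ubound; exists G.
rewrite lee_fin /G !cintZ// -mulrBr Normc.normcM normc_real ger0_norm ?invr_ge0//.
by rewrite mulrC ler_pdivrMr.
Qed.

Lemma tv_norm_Rint (mu nu : {measure set T -> \bar R}) (c M : R) f :
  mu setT = 1%E -> nu setT = 1%E -> (tv_norm mu nu <= c%:E)%E ->
  bmr f -> (forall x, `|f x| <= M) ->
  `|\int[mu]_x f x - \int[nu]_x f x| <= c * M.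
Proof.
move=> mu1 nu1 tv hf hM.
have := @tv_norm_cint mu nu c M (fun x => (f x)%:C%C) mu1 nu1 tv (bmC_real hf).
rewrite !cint_real// -rmorphB normc_real; apply => x; by rewrite normc_real.
Qed.

Definition tw k (h : T -> R) (t : R) F : T -> R[i] :=
  cop k (fun y => eit (t * h y) * F y).

Lemma twistedE k h t F : twisted k h (Complex 0 t) F = tw k h t F.
Proof.
apply/funext => x; rewrite /twisted /tw /cop; congr cintegral.
by apply/funext => y; rewrite cexp_imag.
Qed.

Lemma bmC_phase (h : T -> R) t F : bmr h -> bounded_measurable F ->
  bounded_measurable (fun y => eit (t * h y) * F y).
Proof.
move=> [mh _] hF; apply: bmCM => //; apply: bmC_eit.
exact: measurable_funM.
Qed.

Lemma bmC_tw k h t F : bmr h -> bounded_measurable F -> bounded_measurable (tw k h t F).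
Proof. by move=> hh hF; apply: bmC_cop; exact: bmC_phase. Qed.

Lemma tw_lin k h t (c : R[i]) F G : bmr h -> bounded_measurable F -> bounded_measurable G ->
  tw k h t (fun x => c * F x + G x) = fun x => c * tw k h t F x + tw k h t G x.
Proof.
move=> hh hF hG; apply/funext => x; have k1 : k x setT = 1%E by exact: prob_kernel.
rewrite /tw /cop.
under [X in cintegral _ X]eq_fun do rewrite mulrDr mulrCA.
by rewrite cintD ?cintZ//; try exact: bmC_phase; apply: bmCZ; exact: bmC_phase.
Qed.

Lemma twZ k h t (c : R[i]) F : bmr h -> bounded_measurable F ->
  tw k h t (fun x => c * F x) = fun x => c * tw k h t F x.
Proof.
move=> hh hF; apply/funext => x; have k1 : k x setT = 1%E by exact: prob_kernel.
rewrite /tw /cop.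
under [X in cintegral _ X]eq_fun do rewrite mulrCA.
by rewrite cintZ//; exact: bmC_phase.
Qed.

Lemma twB k h t F G : bmr h -> bounded_measurable F -> bounded_measurable G ->
  tw k h t (fun x => F x - G x) = fun x => tw k h t F x - tw k h t G x.
Proof.
move=> hh hF hG; apply/funext => x; have k1 : k x setT = 1%E by exact: prob_kernel.
rewrite /tw /cop.
under [X in cintegral _ X]eq_fun do rewrite mulrBr.
by rewrite cintB//; exact: bmC_phase.
Qed.

Lemma ler_normc_tw k h t F (M : R) : bmr h -> bounded_measurable F ->
  (forall x, normc (F x) <= M) -> forall x, normc (tw k h t F x) <= M.
Proof.
move=> hh hF hM x; apply: ler_normc_cint; [exact: prob_kernel|exact: bmC_phase|].
by move=> y; rewrite Normc.normcM normc_eit mul1r.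
Qed.

End markov_operators.

(** * Decay of the iterates when the spectral radius is below one *)

Section spectral_radius_decay.
Context {R : realType} {d : measure_display} {T : measurableType d}.
Implicit Types (F G : T -> R[i]).

Lemma normc_le_supnorm F x : bounded_measurable F -> normc (F x) <= supnorm F.
Proof.
move=> [_ _ [M hM]]; apply: ub_le_sup; last by exists x.
by exists M => _ [y _ <-].
Qed.

Lemma supnorm_le F (M : R) : (forall x, normc (F x) <= M) -> supnorm F <= M.
Proof.
move=> hM; apply: ge_sup; first by exists (normc (F point)), point.
by move=> _ [x _ <-].
Qed.

(** Orthogonality of the [2N]-th roots of unity: the only multiple of [2N] strictly between [N] and
    [3N] is [2N] itself. *)
Lemma sum_unity_powers N e : (N < e < 3 * N)%N ->
  \sum_(k < 2 * N) eit (k%:R * (pi / N%:R)) ^+ e =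
  (if e == (2 * N)%N then (2 * N)%:R else 0) :> R[i].
Proof.
move=> /andP[e0 eN]; have N0 : (0 < N)%N by case: N e0 eN => //; rewrite muln0.
have NR : (N%:R : R) != 0 by rewrite pnatr_eq0 -lt0n.
pose q := eit (e%:R * (pi / N%:R)) : R[i].
have -> : \sum_(k < 2 * N) eit (k%:R * (pi / N%:R)) ^+ e = \sum_(k < 2 * N) q ^+ k.
  apply: eq_bigr => k _; rewrite -!eitMn; congr eit; ring.
have e2 (n : nat) : eit (n%:R * (pi *+ 2)) = 1 :> R[i].
  by rewrite eitMn /eit cos2pi sin2pi expr1n.
case: ifPn => [/eqP ee|ne].
  have -> : q = 1.
    rewrite /q ee -(e2 1%N); congr eit; by rewrite natrM -mulr_natr; field.
  by under eq_bigr do rewrite expr1n; rewrite sumr_const card_ord.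
(* Subtracting [2 pi] brings the angle into []-pi, pi[], where the sine vanishes only at 0; this is
   where the range of [e] enters. *)
have q1 : q != 1.
  apply/eqP => q1; have : eit (e%:R * (pi / N%:R) - pi *+ 2) = 1 :> R[i].
    have := eitD (e%:R * (pi / N%:R) - pi *+ 2) (pi *+ 2 : R).
    by rewrite subrK -/q q1 -{2}[pi *+ 2]mul1r (e2 1%N) mulr1 => <-.
  set y := e%:R * _ - _; have yE : y = (e%:R - 2 * N%:R) * (pi / N%:R).
    by rewrite /y -mulr_natr; field.
  have pN : 0 < (pi : R) / N%:R by rewrite divr_gt0 ?pi_gt0// ltr0n.
  have ypi : - pi < y < pi.
    have e3 : pi = N%:R * (pi / N%:R) :> R by field.
    rewrite yE [X in - X < _]e3 [X in _ < _ < X]e3 -mulNr !ltr_pM2r//.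
    have h1 : N%:R < e%:R :> R by rewrite ltr_nat.
    have h2 : e%:R < 3 * N%:R :> R by rewrite -natrM ltr_nat.
    by apply/andP; split; lra.
  move=> [_ sy]; have [y0|y0|y0] := ltgtP y 0.
  - have : 0 < sin (- y) by apply: sin_gt0_pi; move: ypi => /andP[? ?]; lra.
    by rewrite sinN sy oppr0 ltxx.
  - have : 0 < sin y by apply: sin_gt0_pi; rewrite y0; case/andP: ypi.
    by rewrite sy ltxx.
  - move/eqP: y0; rewrite yE mulf_eq0 (gt_eqF pN) orbF subr_eq0 -natrM eqr_nat.
    by rewrite (negbTE ne).
apply/eqP; have /eqP : (q - 1) * \sum_(k < 2 * N) q ^+ k = 0.
  rewrite -subrX1 /q -eitMn.
  have -> : (2 * N)%:R * (e%:R * (pi / N%:R)) = e%:R * (pi *+ 2) :> R.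
    by rewrite natrM -mulr_natr; field.
  by rewrite e2 subrr.
by rewrite mulf_eq0 subr_eq0 (negbTE q1).
Qed.

Variable A : (T -> R[i]) -> T -> R[i].
Hypothesis Abm : forall F, bounded_measurable F -> bounded_measurable (A F).
Hypothesis Alin : forall (c : R[i]) F G, bounded_measurable F ->
  bounded_measurable G -> A (fun x => c * F x + G x) = fun x => c * A F x + A G x.
Hypothesis Acontr : forall F (M : R), bounded_measurable F ->
  (forall x, normc (F x) <= M) -> forall x, normc (A F x) <= M.

Lemma bm_iter n F : bounded_measurable F -> bounded_measurable (iter n A F).
Proof. by move=> hF; elim: n => //= n IH; exact: Abm. Qed.

Lemma iter_contr n F (M : R) : bounded_measurable F ->
  (forall x, normc (F x) <= M) -> forall x, normc (iter n A F x) <= M.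
Proof.
move=> hF hM; elim: n => //= n IH; apply: Acontr => //; exact: bm_iter.
Qed.

Lemma op_zero : A (fun=> 0) = fun=> 0.
Proof.
have := Alin (-1) (bmC_cst 0) (bmC_cst 0).
under [X in A X = _ -> _]eq_fun do rewrite mulr0 addr0.
by move=> ->; apply/funext => x; rewrite mulN1r addNr.
Qed.

Lemma op_lin_sum n (c : 'I_n -> R[i]) (F : 'I_n -> T -> R[i]) :
  (forall i, bounded_measurable (F i)) ->
  A (fun x => \sum_(i < n) c i * F i x) = fun x => \sum_(i < n) c i * A (F i) x.
Proof.
elim: n c F => [|n IH] c F hF.
  under [X in A X]eq_fun do rewrite big_ord0.
  by rewrite op_zero; apply/funext => x; rewrite big_ord0.
under [X in A X]eq_fun do rewrite big_ord_recl.
rewrite Alin// ?IH//.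
  by apply/funext => x; rewrite big_ord_recl.
by apply: bmC_sum => i; exact: bmCZ.
Qed.

Lemma iter_lin_sum j n (c : 'I_n -> R[i]) (F : 'I_n -> T -> R[i]) :
  (forall i, bounded_measurable (F i)) ->
  iter j A (fun x => \sum_(i < n) c i * F i x) =
  fun x => \sum_(i < n) c i * iter j A (F i) x.
Proof.
move=> hF; elim: j => //= j ->.
by rewrite op_lin_sum// => i; exact: bm_iter.
Qed.

(** The polynomial [(w^N - A^N) / (w - A)] in [A], applied to [F]; [geom_resolvent] is this
    factorisation. *)
Definition geom (w : R[i]) N F := fun x => \sum_(j < N) w ^+ (N.-1 - j) * iter j A F x.

Lemma bm_geom w N F : bounded_measurable F -> bounded_measurable (geom w N F).
Proof. by move=> hF; apply: bmC_sum => i; apply: bmCZ; exact: bm_iter. Qed.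

Lemma geomS w N F x : geom w N.+1 F x = w * geom w N F x + iter N A F x.
Proof.
rewrite /geom big_ord_recr /= subnn expr0 mul1r mulr_sumr; congr (_ + _).
apply: eq_bigr => j _; rewrite mulrA -exprS; congr (_ ^+ _ * _).
by case: N j => [[]|N] j //=; rewrite subSn// -ltnS.
Qed.

Lemma geom_resolvent w N F x : bounded_measurable F ->
  w * geom w N F x - A (geom w N F) x = w ^+ N * F x - iter N A F x.
Proof.
move=> hF; elim: N => [|N IH].
  have -> : geom w 0 F = fun=> 0 by apply/funext => y; rewrite /geom big_ord0.
  by rewrite op_zero expr0 mul1r mulr0 !subrr.
have -> : geom w N.+1 F = fun x => w * geom w N F x + iter N A F x.
  by apply/funext => y; exact: geomS.
rewrite Alin//; [|exact: bm_geom|exact: bm_iter].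
have -> : w * (w * geom w N F x + iter N A F x) -
  (w * A (geom w N F) x + A (iter N A F) x) =
  w * (w * geom w N F x - A (geom w N F) x) + w * iter N A F x - A (iter N A F) x by ring.
by rewrite IH exprS /=; ring.
Qed.

Hypothesis rA : (spectral_radius A < 1)%E.

(** A point of the unit circle is outside the spectrum, and the norm of the inverse of [w - A]
    becomes a lower bound for [w - A]. In this form the inverse disappears and perturbing [w] is
    easy; the constant is an integer so that it can index the compactness argument below. *)
Lemma resolvent_bound (w : R[i]) : normc w = 1 ->
  exists n : nat, forall F (M : R), bounded_measurable F ->
    (forall x, normc (w * F x - A F x) <= M) -> forall x, normc (F x) <= n%:R * M.
Proof.
move=> w1; have : ~ spectrum A w.
  move=> sw; have : (1%:E <= spectral_radius A)%E.
    by rewrite -w1; apply: ereal_sup_ubound; exists w.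
  by rewrite leNgt rA.
move=> /contrapT[B [[Bbm Blin [MB hMB]] hB]].
exists (Num.bound `|MB|) => F M hF hM x.
have [BF _] := hB F hF.
have hG : bounded_measurable (fun x => w * F x - A F x).
  by apply: bmCB; [exact: bmCZ|exact: Abm].
have M0 : 0 <= M by apply: le_trans (hM point); exact: normc_ge0.
apply: (le_trans (normc_le_supnorm x hF)); rewrite -{1}BF.
apply: (le_trans (hMB _ hG)).
have s0 : 0 <= supnorm (fun x => w * F x - A F x).
  by apply: le_trans (normc_le_supnorm point hG); exact: normc_ge0.
apply: (@le_trans _ _ (`|MB| * M)).
  apply: (@le_trans _ _ (`|MB| * supnorm (fun x => w * F x - A F x))).
    by rewrite ler_wpM2r// ler_norm.
  by rewrite ler_wpM2l// supnorm_le.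
rewrite ler_wpM2r// ltW//.
by apply: le_lt_trans (archi_boundP _) => //.
Qed.

(** Near an angle [th0] with constant [n0], changing the angle by less than [1 / (2 (n0 + 1))] costs
    at most half the supremum of [F]; absorbing it on the left doubles the constant. Compactness of
    the circle then leaves finitely many constants. *)
Lemma resolvent_bound_uniform : exists n : nat, forall th : R, 0 <= th <= pi *+ 2 ->
  forall F (M : R), bounded_measurable F ->
    (forall x, normc (eit th * F x - A F x) <= M) -> forall x, normc (F x) <= n%:R * M.
Proof.
pose P (n : nat) (th : R) := forall F (M : R), bounded_measurable F ->
    (forall x, normc (eit th * F x - A F x) <= M) -> forall x, normc (F x) <= n%:R * M.
have /compact_near_coveringP/(_ nat \oo P) : compact `[(0:R), pi *+ 2].
  exact: segment_compact.
case.
- move=> th0 _; have [n0 hn0] := resolvent_bound (normc_eit th0).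
  exists ([set th | `|th0 - th| < (2 * (n0%:R + 1))^-1], [set n | (2 * n0 <= n)%N]).
    split => /=; last by exists (2 * n0)%N.
    apply/nbhs_ballP; exists (2 * (n0%:R + 1))^-1 => /=.
      by rewrite invr_gt0 mulr_gt0// ltr_wpDl.
    by move=> y; rewrite /ball/=.
  move=> [th n] [/= hth hn] F M hF hM x.
  have M0 : 0 <= M by apply: le_trans (hM point); exact: normc_ge0.
  have S0 : 0 <= supnorm F by apply: le_trans (normc_le_supnorm x hF); exact: normc_ge0.
  have n1 : 0 < n0%:R + 1 :> R by rewrite ltr_wpDl.
  have h1 y : normc (eit th0 * F y - A F y) <= M + (2 * (n0%:R + 1))^-1 * supnorm F.
    have -> : eit th0 * F y - A F y =
      (eit th * F y - A F y) + (eit th0 - eit th) * F y by ring.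
    rewrite (le_trans (ler_normcD _ _))// lerD// Normc.normcM ler_pM ?normc_ge0//.
      by rewrite (le_trans (eit_lip _ _))// ltW.
    exact: normc_le_supnorm.
  have h2 := supnorm_le (hn0 F _ hF h1).
  have h3 : n0%:R * ((2 * (n0%:R + 1))^-1 * supnorm F) <= supnorm F / 2.
    rewrite mulrA [leRHS]mulrC ler_wpM2r//.
    rewrite ler_pdivrMr; last by rewrite mulr_gt0.
    lra.
  apply: (le_trans (normc_le_supnorm x hF)).
  apply: (@le_trans _ _ ((2 * n0)%:R * M)).
    rewrite natrM; rewrite mulrDr in h2; lra.
  by rewrite ler_wpM2r// ler_nat.
- move=> n _ hn; exists n => th hth F M; apply: (hn n) => //=.
Qed.

(* Averaging [w ^+ N.+1 * geom w N (geom w N F)] over the [2N]-th roots of unity [w]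
   isolates the [N] terms [A ^ (N - 1) F]; the resolvent bound, applied twice, controls
   every summand by a constant independent of [N]. *)
Lemma power_decay : exists N : nat, forall F (M : R), bounded_measurable F ->
  (forall x, normc (F x) <= M) -> forall x, normc (iter N A F x) <= M / 4.
Proof.
have [n hn] := resolvent_bound_uniform.
(* The averaging below yields [(N + 1) |A^N F| <= 4 n^2 M], which this [N] turns into the factor
   [1 / 4]. *)
have [N NE] : exists N, N = (16 * n ^ 2)%N by eexists.
exists N => F M hF hM x.
have M0 : 0 <= M by apply: le_trans (hM point); exact: normc_ge0.
pose w (k : nat) := eit (k%:R * (pi / N.+1%:R)) : R[i].
have hw k G (B : R) : (k < 2 * N.+1)%N -> bounded_measurable G ->
    (forall y, normc (G y) <= B) ->
    forall y, normc (geom (w k) N.+1 G y) <= n%:R * (2 * B).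
  move=> kN hG hB; apply: (hn (k%:R * (pi / N.+1%:R))).
  - have p0 : 0 <= pi / N.+1%:R :> R by rewrite divr_ge0 ?pi_ge0.
    rewrite mulr_ge0//=.
    have -> : pi *+ 2 = (2 * N.+1)%:R * (pi / N.+1%:R) :> R.
      by rewrite natrM -mulrA [N.+1%:R * _]mulrC divfK ?pnatr_eq0// mulr_natl.
    by rewrite ler_wpM2r// ler_nat ltnW.
  - exact: bm_geom.
  - move=> y; rewrite geom_resolvent//.
    rewrite (le_trans (ler_normcB _ _))// Normc.normcM normcX normc_eit expr1n mul1r.
    have := hB y; have := iter_contr N.+1 hG hB y; lra.
have hw2 k : (k < 2 * N.+1)%N ->
    normc (geom (w k) N.+1 (geom (w k) N.+1 F) x) <= n%:R * (2 * (n%:R * (2 * M))).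
  by move=> kN; apply: (hw) => //; [exact: bm_geom|move=> y; exact: hw].
pose S := \sum_(k < 2 * N.+1) w k ^+ N.+2 * geom (w k) N.+1 (geom (w k) N.+1 F) x.
have SB : normc S <= (2 * N.+1)%:R * (n%:R * (2 * (n%:R * (2 * M)))).
  apply: (le_trans (ler_normc_sum _ _)).
  apply: (@le_trans _ _ (\sum_(k < 2 * N.+1) n%:R * (2 * (n%:R * (2 * M))))).
    apply: ler_sum => k _; rewrite Normc.normcM normcX normc_eit expr1n mul1r.
    exact: hw2.
  by rewrite sumr_const card_ord -[X in X <= _]mulr_natl lexx.
(* After expansion the exponent of [w k] lies strictly between [N + 1] and [3 (N + 1)], and equals
   [2 (N + 1)] exactly when [i + j = N]. *)
have SE : S = (2 * N.+1)%:R * (N.+1)%:R * iter N A F x.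
  transitivity (\sum_(j < N.+1) \sum_(i < N.+1)
    (\sum_(k < 2 * N.+1) w k ^+ (N.+2 + (N - j) + (N - i))) * iter (j + i) A F x).
    rewrite exchange_big /=.
    under eq_bigr => j _ do under eq_bigr => i _ do rewrite mulr_suml.
    under eq_bigr => j _ do rewrite exchange_big /=.
    rewrite exchange_big /=; apply: eq_bigr => k _.
    rewrite {1}/geom mulr_sumr; apply: eq_bigr => j _.
    rewrite [geom (w k) N.+1 F]/geom /= iter_lin_sum; last by move=> i; exact: bm_iter.
    rewrite !mulr_sumr; apply: eq_bigr => i _.
    by rewrite !mulrA -!exprD addnAC (addnC i j) iterD.
  transitivity (\sum_(j < N.+1) \sum_(i < N.+1)
      (if i == rev_ord j then (2 * N.+1)%:R * iter N A F x else 0)).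
    apply: eq_bigr => j _; apply: eq_bigr => i _.
    have jN := ltn_ord j; have iN := ltn_ord i.
    rewrite sum_unity_powers; last by apply/andP; split; lia.
    have -> : (i == rev_ord j) = (N.+2 + (N - j) + (N - i) == 2 * N.+1)%N.
      by rewrite -val_eqE /=; apply/eqP/eqP; lia.
    case: eqP => [e|_]; last by rewrite mul0r.
    by congr (_ * iter _ A F x); lia.
  under eq_bigr do rewrite -big_mkcond big_pred1_eq.
  by rewrite sumr_const card_ord -[X in X = _]mulr_natl mulrA [X in X * _]mulrC.
have h : (N.+1)%:R * normc (iter N A F x) <= 4 * n%:R ^+ 2 * M.
  have N2 : 0 < (2 * N.+1)%:R :> R by rewrite ltr0n.
  rewrite -(ler_pM2l N2); apply: le_trans (_ : normc S <= _).
    rewrite SE !Normc.normcM mulrA.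
    have nn (k : nat) : normc (k%:R : R[i]) = k%:R.
      by rewrite -(rmorph_nat (real_complex R)) normc_real normr_nat.
    by rewrite !nn.
  by apply: (le_trans SB); rewrite le_eqVlt; apply/orP; left; apply/eqP; ring.
have h2 : N.+1%:R = 16 * n%:R ^+ 2 + 1 :> R by rewrite -natr1 NE natrM natrX.
have n2 : 0 <= n%:R ^+ 2 :> R by exact: sqr_ge0.
rewrite -(ler_pM2l (_ : 0 < N.+1%:R :> R)) ?ltr0n//.
apply: (le_trans h); rewrite h2; nra.
Qed.

End spectral_radius_decay.

(** * Oscillation contraction and the Poisson equation *)

Section geometric_limits.
Context {R : realType}.

(** With [q J] the tail of the geometric series, the intervals [[s J - q J, s J + q J]] are nested;
    the limit is the supremum of their left ends, which gives the rate for every [J] at once. *)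
Lemma geometric_cauchy (s : nat -> R) (C r : R) : 0 <= r < 1 ->
  (forall J, `|s J.+1 - s J| <= C * r ^+ J) ->
  exists l, forall J, `|l - s J| <= C * r ^+ J / (1 - r).
Proof.
move=> /andP[r0 r1] hs.
have r1' : 0 < 1 - r by rewrite subr_gt0.
pose q J := C * r ^+ J / (1 - r).
have C0 : 0 <= C by have := hs 0%N; rewrite expr0 mulr1; apply: le_trans.
have q0 J : 0 <= q J by rewrite /q divr_ge0 ?mulr_ge0 ?exprn_ge0// ltW.
have qS J : q J = q J.+1 + C * r ^+ J.
  by rewrite /q exprS; field; rewrite subr_eq0 eq_sym lt_eqF.
have hv i j : (i <= j)%N -> s i - q i <= s j - q j.
  move=> /subnK <-; elim: (j - i)%N => // k; rewrite addSn => /le_trans; apply.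
  have := hs (k + i)%N; rewrite ler_norml => /andP[h1 h2].
  by have := qS (k + i)%N; lra.
have hu i j : (i <= j)%N -> s j + q j <= s i + q i.
  move=> /subnK <-; elim: (j - i)%N => // k; rewrite addSn; apply: le_trans.
  have := hs (k + i)%N; rewrite ler_norml => /andP[h1 h2].
  by have := qS (k + i)%N; lra.
have hvu i j : s i - q i <= s j + q j.
  have := hv _ _ (leq_maxl i j); have := hu _ _ (leq_maxr i j).
  by have := q0 (maxn i j); lra.
exists (sup (range (fun i => s i - q i))) => J.
have h1 : s J - q J <= sup (range (fun i => s i - q i)).
  apply: ub_le_sup; last by exists J.
  by exists (s 0%N + q 0%N) => _ [i _ <-].
have h2 : sup (range (fun i => s i - q i)) <= s J + q J.
  apply: ge_sup; first by exists (s 0%N - q 0%N), 0%N.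
  by move=> _ [i _ <-].
by rewrite ler_norml -/(q J); apply/andP; split; lra.
Qed.

Lemma geometric_small (C r e : R) : 0 <= r < 1 -> 0 < e ->
  exists J : nat, C * r ^+ J <= e.
Proof.
move=> /andP[r0 r1] e0; have rn : `|r| < 1 by rewrite ger0_norm.
have := cvg_geometric C rn => /cvgr0_norm_le /(_ _ e0)[J _ hJ].
by exists J; apply: (le_trans (ler_norm _)); apply: hJ => /=.
Qed.

Lemma geometric_cvg0 (C r : R) : 0 <= r < 1 -> C * r ^+ J @[J --> \oo] --> 0.
Proof.
move=> /andP[r0 r1]; have rn : `|r| < 1 by rewrite ger0_norm.
exact: (cvg_geometric C rn).
Qed.

End geometric_limits.

Section oscillation.
Context {R : realType} {d : measure_display} {T : measurableType d}.
Implicit Types (k : R.-pker T ~> T) (f g : T -> R).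

Lemma osc_op k f (D : R) : bmr f -> (forall x y, `|f x - f y| <= D) ->
  forall x y, `|op k f x - op k f y| <= D.
Proof.
move=> hf hD x y; have kx : k x setT = 1%E by exact: prob_kernel.
have ky : k y setT = 1%E by exact: prob_kernel.
have -> : op k f x - op k f y = \int[k x]_z (f z - op k f y).
  by rewrite RintB ?Rint_cst//; exact: bmr_cst.
apply: ler_norm_Rint => //; first by apply: bmrB => //; exact: bmr_cst.
move=> z; have -> : f z - op k f y = \int[k y]_w (f z - f w).
  by rewrite RintB ?Rint_cst//; exact: bmr_cst.
by apply: ler_norm_Rint => //; apply: bmrB => //; exact: bmr_cst.
Qed.

Lemma osc_iter_op k n f (D : R) : bmr f -> (forall x y, `|f x - f y| <= D) ->
  forall x y, `|iter n (op k) f x - iter n (op k) f y| <= D.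
Proof.
by move=> hf hD; elim: n => //= n IH; apply: osc_op => //; exact: bmr_iter_op.
Qed.

(** Dobrushin contraction. Oscillations ignore additive constants, which the operator preserves, so
    the contraction can be expressed without the invariant measure. *)
Definition osc_contraction k (m : nat) (r : R) := forall f (D : R), bmr f ->
  (forall x y, `|f x - f y| <= D) ->
  forall x y, `|iter m (op k) f x - iter m (op k) f y| <= r * D.

Lemma osc_contraction_pow k m r : osc_contraction k m r -> forall J f (D : R), bmr f ->
  (forall x y, `|f x - f y| <= D) ->
  forall x y, `|iter (J * m) (op k) f x - iter (J * m) (op k) f y| <= D * r ^+ J.
Proof.
move=> hk; elim=> [|J IH] f D hf hD x y; first by rewrite mul0n expr0 mulr1 /=.
rewrite mulSn iterD exprS mulrCA; apply: hk; first exact: bmr_iter_op.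
exact: IH.
Qed.

(** Iterating the equation [m] times gives [osc f <= r osc f + m eps], and the first term is
    absorbed because [f] is bounded; the constant [c] drops out. Serves both to bound solutions of
    Poisson equations and to compare them at two parameters. *)
Lemma osc_apriori k m (r : R) f e (c eps : R) : 0 <= r < 1 -> osc_contraction k m r ->
  bmr f -> bmr e -> (forall x, f x = op k f x + e x + c) ->
  (forall x y, `|e x - e y| <= eps) ->
  forall x y, `|f x - f y| <= m%:R * eps / (1 - r).
Proof.
move=> /andP[r0 r1] hk hf he fE heps.
have hi n : forall x, f x =
    iter n (op k) f x + \sum_(i < n) iter i (op k) e x + n%:R * c.
  elim: n => [|n IH] x; first by rewrite big_ord0 /=; ring.
  rewrite fE; have -> : op k f x =
      op k (iter n (op k) f) x + \sum_(i < n) op k (iter i (op k) e) x + n%:R * c.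
    have kx : k x setT = 1%E by exact: prob_kernel.
    have h1 : bmr (iter n (op k) f) by exact: bmr_iter_op.
    have h2 i : bmr (iter i (op k) e) by exact: bmr_iter_op.
    have h3 : bmr (fun x => \sum_(i < n) iter i (op k) e x) by exact: bmr_sum.
    transitivity (\int[k x]_y (iter n (op k) f y + \sum_(i < n) iter i (op k) e y + n%:R * c)).
      by apply: eq_Rintegral => y _; exact: IH.
    rewrite RintD//; [|exact: bmrD|exact: bmr_cst].
    by rewrite RintD// Rint_cst// Rint_sum.
  rewrite big_ord_recl /= -natr1.
  have -> : \sum_(i < n) iter (bump 0 i) (op k) e x = \sum_(i < n) op k (iter i (op k) e) x.
    by apply: eq_bigr => i _.
  ring.
have [_ [M hM]] := hf.
pose S := [set `|f p.1 - f p.2| | p in [set: T * T]].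
have hS : has_sup S.
  split; first by exists `|f point - f point|, (point, point).
  exists (M + M) => _ [[x y] _ <-] /=.
  by rewrite (le_trans (ler_normB _ _))// lerD.
have fS x y : `|f x - f y| <= sup S.
  by apply: ub_le_sup; [exact: hS.2|exists (x, y)].
have hstep x y : `|f x - f y| <= r * sup S + m%:R * eps.
  rewrite (hi m x) (hi m y).
  have -> : iter m (op k) f x + \sum_(i < m) iter i (op k) e x + m%:R * c -
    (iter m (op k) f y + \sum_(i < m) iter i (op k) e y + m%:R * c) =
    (iter m (op k) f x - iter m (op k) f y) +
    \sum_(i < m) (iter i (op k) e x - iter i (op k) e y) by rewrite sumrB; ring.
  rewrite (le_trans (ler_normD _ _))// lerD//; first exact: hk.
  apply: (le_trans (ler_norm_sum _ _ _)).
  have -> : m%:R * eps = \sum_(i < m) eps by rewrite sumr_const card_ord mulr_natl.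
  by apply: ler_sum => i _; exact: osc_iter_op.
have h : sup S <= r * sup S + m%:R * eps.
  by apply: ge_sup; [exact: hS.1|move=> _ [[x y] _ <-]; exact: hstep].
move=> x y; apply: (le_trans (fS x y)).
by rewrite ler_pdivlMr ?subr_gt0// mulrBr mulr1; lra.
Qed.

(** The solution is the series of the [Q^i f] with [i >= 1], each term diminished by its value at
    [point]. This subtraction plays the part of centring [f]: along multiples of [m] the partial
    sums then converge geometrically. *)
Lemma poisson_exists k m (r : R) f : 0 <= r < 1 -> osc_contraction k m r -> bmr f ->
  exists h (c : R), [/\ bmr h, h point = 0 &
    forall x, op k (fun y => f y + h y) x = h x + c].
Proof.
move=> hr hk hf; have /andP[r0 r1] := hr; have [_ [M hM]] := hf.
have M0 : 0 <= M by apply: le_trans (hM point).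
pose D := M + M.
have hD x y : `|f x - f y| <= D by rewrite (le_trans (ler_normB _ _))// lerD.
pose S (n : nat) x := \sum_(i < n) iter i.+1 (op k) f x.
have bS n : bmr (S n) by apply: bmr_sum => i; exact: (bmr_iter_op k i.+1).
pose s J x := S (J * m)%N x - S (J * m)%N point.
have bs J : bmr (s J) by apply: bmrB => //; exact: bmr_cst.
pose C := m%:R * D.
have sS x J : `|s J.+1 x - s J x| <= C * r ^+ J.
  have -> : s J.+1 x - s J x = \sum_(i < m)
     (iter (J * m) (op k) (iter i.+1 (op k) f) x - iter (J * m) (op k) (iter i.+1 (op k) f) point).
    rewrite sumrB /s /S mulSn addnC big_split_ord /= big_split_ord /=.
    have e y : \sum_(i < m) iter (J * m + i).+1 (op k) f y =
        \sum_(i < m) iter (J * m) (op k) (iter i.+1 (op k) f) y.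
      by apply: eq_bigr => i _; rewrite -iterD addnS.
    have := e x; have := e point => /= -> ->; ring.
  apply: (le_trans (ler_norm_sum _ _ _)).
  have -> : C * r ^+ J = \sum_(i < m) (D * r ^+ J).
    by rewrite sumr_const card_ord /C -mulrA mulr_natl.
  apply: ler_sum => i _; apply: osc_contraction_pow => //; first exact: (bmr_iter_op k i.+1).
  exact: (@osc_iter_op k i.+1).
have /choice[h hh] : forall x, exists l, forall J, `|l - s J x| <= C * r ^+ J / (1 - r).
  by move=> x; apply: (geometric_cauchy hr) => J; exact: sS.
pose C' := C / (1 - r).
have hC' J x : `|h x - s J x| <= C' * r ^+ J.
  by rewrite (le_trans (hh x J))// /C' mulrAC.
have hpt : h point = 0.
  apply/eqP; rewrite -normr_le0; apply/ler_addgt0Pl => e e0; rewrite addr0.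
  have [J hJ] := geometric_small C' hr e0.
  by have := hC' J point; rewrite /s subrr subr0 => /le_trans; apply.
have bh : bmr h.
  split.
    apply: (@measurable_fun_cvg _ _ _ _ s) => [J|x _]; first by case: (bs J).
    apply/cvgrPdist_le => e e0.
    have /cvgrPdist_le/(_ e e0)[N _ HN] := geometric_cvg0 C' hr.
    exists N => // J NJ; apply: (le_trans (hC' J x)).
    by have := HN J NJ; rewrite /= sub0r normrN; apply: le_trans; exact: ler_norm.
  exists C' => x; have := hC' 0%N x; rewrite expr0 mulr1 /s mul0n /S !big_ord0.
  by rewrite subr0 subr0.
exists h, (op k (fun y => f y + h y) point); split=> // x.
(* Up to [2 C' r^J], the function [op k (f + h) - h] is [Q^(J m + 1) f], whose oscillation is at
   most [D r^J]; letting [J] grow shows that it is constant. *)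
have key x' J : `|op k (fun y => f y + h y) x' - h x' - iter (J * m).+1 (op k) f x'| <=
    2 * (C' * r ^+ J).
  have -> : op k (fun y => f y + h y) x' - h x' - iter (J * m).+1 (op k) f x' =
     op k (fun y => h y - s J y) x' - (h x' - s J x').
    rewrite opB// opD//.
    suff -> : op k (s J) x' = s J x' + iter (J * m).+1 (op k) f x' - op k f x' by ring.
    have kx : k x' setT = 1%E by exact: prob_kernel.
    rewrite /s {1}/op RintB//; last exact: bmr_cst.
    rewrite Rint_cst// /S Rint_sum; [|exact: kx|by move=> i; exact: (bmr_iter_op k i.+1)].
    have -> : \sum_(i < J * m) \int[k x']_x0 iter i.+1 (op k) f x0 =
       \sum_(i < J * m) iter i.+2 (op k) f x' by apply: eq_bigr.
    have e n : \sum_(i < n) iter i.+2 (op k) f x' =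
      \sum_(i < n) iter i.+1 (op k) f x' + iter n.+1 (op k) f x' - op k f x'.
      elim: n => [|n IH]; first by rewrite !big_ord0 /=; ring.
      by rewrite big_ord_recr IH big_ord_recr /=; ring.
    by rewrite e; ring.
  rewrite (le_trans (ler_normB _ _))// mulr_natl mulr2n lerD//.
  by apply: ler_norm_op => //; exact: bmrB.
apply/eqP; rewrite -subr_eq0 -normr_le0; apply/ler_addgt0Pl => e e0; rewrite addr0.
have [J hJ] := geometric_small (4 * C' + D) hr e0; apply: le_trans hJ.
have h1 := key x J; have h2 := key point J; rewrite hpt subr0 in h2.
have h3 : `|iter (J * m).+1 (op k) f x - iter (J * m).+1 (op k) f point| <= D * r ^+ J.
  by rewrite !iterS; apply: osc_op; [exact: bmr_iter_op|exact: osc_contraction_pow].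
move: h1 h2 h3; rewrite !ler_norml => /andP[? ?] /andP[? ?] /andP[? ?].
by apply/andP; split; lra.
Qed.

End oscillation.

(** * Parametrised families *)

Section lipschitz_families.
Context {R : realType} {d : measure_display} {T : measurableType d}.
Implicit Types (f g h : R -> T -> R).

(** One constant serves as bound and as Lipschitz constant, uniformly in [x]. Functions of the
    parameter alone are encoded as families constant in [x], so that the same closure rules apply to
    them. *)
Definition lipf f := exists B : R, [/\ 0 <= B, forall u, bmr (f u),
  forall u x, `|f u x| <= B & forall u v x, `|f u x - f v x| <= B * `|u - v|].

Lemma lipf_cst (c : R) : lipf (fun _ _ => c).
Proof.
exists `|c|; split=> // [u|u v x]; first exact: bmr_cst.
by rewrite subrr normr0 mulr_ge0.
Qed.

Lemma lipfD f g : lipf f -> lipf g -> lipf (fun u x => f u x + g u x).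
Proof.
move=> [A [A0 mf fA fL]] [B [B0 mg gB gL]]; exists (A + B).
split=> [|u|u x|u v x]; [exact: addr_ge0|exact: bmrD| |].
  by rewrite (le_trans (ler_normD _ _))// lerD.
have -> : f u x + g u x - (f v x + g v x) = (f u x - f v x) + (g u x - g v x) by ring.
by rewrite (le_trans (ler_normD _ _))// mulrDl lerD.
Qed.

Lemma lipfM f g : lipf f -> lipf g -> lipf (fun u x => f u x * g u x).
Proof.
move=> [A [A0 mf fA fL]] [B [B0 mg gB gL]]; exists (A * B + A * B).
have AB : 0 <= A * B by exact: mulr_ge0.
split=> [|u|u x|u v x]; [by rewrite addr_ge0|exact: bmrM| |].
  by rewrite normrM; apply: (@le_trans _ _ (A * B)); [exact: ler_pM|rewrite lerDl].
have -> : f u x * g u x - f v x * g v x =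
   (f u x - f v x) * g u x + f v x * (g u x - g v x) by ring.
rewrite (le_trans (ler_normD _ _))// !normrM mulrDl lerD//.
  by rewrite [A * B * _]mulrAC ler_pM.
by rewrite -mulrA ler_pM.
Qed.

Lemma lipfZ (c : R) f : lipf f -> lipf (fun u x => c * f u x).
Proof. exact/lipfM/lipf_cst. Qed.

Lemma lipfB f g : lipf f -> lipf g -> lipf (fun u x => f u x - g u x).
Proof.
move=> hf hg; have := lipfD hf (lipfZ (-1) hg).
by under [X in lipf X -> _]eq_fun do under eq_fun do rewrite mulN1r.
Qed.

Lemma lipfX f n : lipf f -> lipf (fun u x => f u x ^+ n).
Proof.
move=> hf; elim: n => [|n IH]; first exact: (lipf_cst 1).
by under [X in lipf X]eq_fun do under eq_fun do rewrite exprS; exact: lipfM.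
Qed.

Variables (Q : R -> R.-pker T ~> T) (m : nat) (r L : R).
Hypothesis hr : 0 <= r < 1.
Hypothesis L0 : 0 <= L.
Hypothesis Qosc : forall u, osc_contraction (Q u) m r.
Hypothesis Qlip : forall u v (f : T -> R) (M : R) x, bmr f -> (forall x, `|f x| <= M) ->
  `|op (Q u) f x - op (Q v) f x| <= L * `|u - v| * M.

Lemma lipf_op f : lipf f -> lipf (fun u => op (Q u) (f u)).
Proof.
move=> [B [B0 mf fB fL]]; exists (B + L * B).
have LB : 0 <= L * B by exact: mulr_ge0.
split=> [|u|u x|u v x]; [exact: addr_ge0|exact: bmr_op| |].
  by apply: (@le_trans _ _ B); [exact: ler_norm_op|rewrite lerDl].
have -> : op (Q u) (f u) x - op (Q v) (f v) x =
   op (Q u) (fun y => f u y - f v y) x + (op (Q u) (f v) x - op (Q v) (f v) x).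
  by rewrite opB//; ring.
rewrite (le_trans (ler_normD _ _))// mulrDl lerD//.
  by apply: ler_norm_op => //; exact: bmrB.
by rewrite [L * B * _]mulrAC Qlip.
Qed.

(** The difference of the solutions at [u] and [v] solves a Poisson equation for [Q u] whose source
    is [O(|u - v|)], so [osc_apriori] makes it Lipschitz. The normalisation at [point] turns bounds
    on oscillations into bounds on values. *)
Lemma poisson_family f : lipf f -> exists h (c : R -> R),
  [/\ lipf h, lipf (fun u (_ : T) => c u) &
  forall u x, op (Q u) (fun y => f u y + h u y) x = h u x + c u].
Proof.
move=> hf; have [M [M0 mf fM fL]] := hf; have /andP[r0 r1] := hr.
have r1' : 0 < 1 - r by rewrite subr_gt0.
have /choice[h /choice[c hc]] : forall u, exists (h : T -> R) (c : R), [/\ bmr h, h point = 0 &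
    forall x, op (Q u) (fun y => f u y + h y) x = h x + c].
  by move=> u; exact: (poisson_exists hr (Qosc u) (mf u)).
have mh u : bmr (h u) by have [] := hc u.
have h0 u : h u point = 0 by have [] := hc u.
have hE u x : op (Q u) (fun y => f u y + h u y) x = h u x + c u by have [] := hc u.
pose H := m%:R * (M + M) / (1 - r).
have H0 : 0 <= H by rewrite /H divr_ge0 ?(ltW r1')// mulr_ge0// addr_ge0.
have hH u x : `|h u x| <= H.
  rewrite -[h u x]subr0 -(h0 u).
  apply: (@osc_apriori _ _ _ (Q u) m r (h u) (op (Q u) (f u)) (- c u) (M + M)) => //.
  - exact: bmr_op.
  - by move=> y; have := hE u y; rewrite opD//; lra.
  - move=> y z; rewrite (le_trans (ler_normB _ _))// lerD//; exact: ler_norm_op.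
pose K := 2 * (M + L * (M + H)).
have K0 : 0 <= K by rewrite /K mulr_ge0// addr_ge0// mulr_ge0// addr_ge0.
pose L' := m%:R * K / (1 - r).
have L'0 : 0 <= L' by rewrite /L' divr_ge0 ?(ltW r1')// mulr_ge0.
have hL u v x : `|h u x - h v x| <= L' * `|u - v|.
  have -> : h u x - h v x = (h u x - h v x) - (h u point - h v point).
    by rewrite !h0; ring.
  pose e y := op (Q u) (fun y => f u y - f v y) y +
    (op (Q u) (fun y => f v y + h v y) y - op (Q v) (fun y => f v y + h v y) y).
  have me : bmr e.
    apply: bmrD; first by apply: bmr_op; exact: bmrB.
    by apply: bmrB; apply: bmr_op; exact: bmrD.
  have e_le y : `|e y| <= (M + L * (M + H)) * `|u - v|.
    rewrite (le_trans (ler_normD _ _))// mulrDl lerD//.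
      by apply: ler_norm_op => //; exact: bmrB.
    rewrite [L * _ * _]mulrAC; apply: Qlip; first exact: bmrD.
    by move=> z; rewrite (le_trans (ler_normD _ _))// lerD.
  have -> : L' * `|u - v| = m%:R * (K * `|u - v|) / (1 - r) by rewrite /L'; ring.
  apply: (@osc_apriori _ _ _ (Q u) m r (fun x => h u x - h v x) e (c v - c u) (K * `|u - v|)) => //.
  - exact: bmrB.
  - move=> y; have := hE u y; have := hE v y; rewrite /e.
    rewrite (opB (Q u) (mh u) (mh v)) (opB (Q u) (mf u) (mf v)).
    by rewrite (opD (Q u) (mf u) (mh u)) (opD (Q u) (mf v) (mh v)) => -> E; lra.
  - move=> y z; rewrite (le_trans (ler_normB _ _))//.
    have := e_le y; have := e_le z; rewrite /K; lra.
have lh : lipf h.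
  exists (H + L'); split=> // [|u x|u v x]; first exact: addr_ge0.
    by rewrite (le_trans (hH u x))// lerDl.
  by rewrite (le_trans (hL u v x))// ler_wpM2r// lerDr.
exists h, c; split=> //.
have [B [B0 mB fB lB]] := lipf_op (lipfD hf lh).
have cE u : c u = op (Q u) (fun y => f u y + h u y) point by rewrite hE h0 add0r.
exists B; split=> // [u|u x|u v x]; first exact: bmr_cst.
  by rewrite cE.
by rewrite !cE.
Qed.

(** Expand [Q (e^(i t (g - a)) (1 + i t h - t^2 w))] in [t]: matching the terms of order [t] gives
    the first equation, those of order [t^2] the second, and [s / 2] is the constant left over in
    the latter. *)
Lemma corrector_family g : lipf g -> exists (a s : R -> R) h w,
  [/\ lipf (fun u (_ : T) => a u), lipf (fun u (_ : T) => s u), lipf h, lipf w &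
   (forall u x, op (Q u) (fun y => (g u y - a u) + h u y) x = h u x) /\
   (forall u x, op (Q u) (fun y => (g u y - a u) ^+ 2 / 2 + (g u y - a u) * h u y + w u y) x
      = w u x + s u / 2)].
Proof.
move=> hg; have [h [a [lh la hE]]] := poisson_family hg.
have lgb : lipf (fun u x => g u x - a u) by exact: lipfB.
have lf : lipf (fun u x => (g u x - a u) ^+ 2 / 2 + (g u x - a u) * h u x).
  apply: lipfD; last exact: lipfM.
  by apply: (@lipfM (fun u x => (g u x - a u) ^+ 2)); [exact: lipfX|exact: lipf_cst].
have [w [c [lw lc wE]]] := poisson_family lf.
exists a, (fun u => 2 * c u), h, w; split=> //; first exact: (lipfZ 2 lc).
have [_ [_ mg _ _]] := hg; have [_ [_ mh _ _]] := lh.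
split=> u x.
  have := hE u x => e.
  rewrite (_ : (fun y => _) = fun y => (g u y + h u y) - a u); last by apply/funext => y; ring.
  rewrite opB ?op_cst ?e; [ring|exact: bmrD|exact: bmr_cst].
by rewrite wE; field.
Qed.

End lipschitz_families.

(** * Second-order approximate eigenfunctions *)

Section eigenvector_expansion.
Context {R : realType} {d : measure_display} {T : measurableType d}.

(* With [h], [w] the solutions of the two Poisson equations, [psi] is the second-order
   expansion in [t] of the leading eigenfunction [1 + i t h - t^2 w] of the twisted operator. *)
Definition psi (h w : T -> R) (t : R) (x : T) : R[i] :=
  Complex (1 - t ^+ 2 * w x) (t * h x).

Lemma bmC_psi (h w : T -> R) t : bmr h -> bmr w -> bounded_measurable (psi h w t).
Proof.
move=> hh hw; apply/bmCP; split; last exact: bmrZ.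
by apply: bmrB; [exact: bmr_cst|exact: bmrZ].
Qed.

Lemma normc_psi_sub1 (h w : T -> R) t (B : R) x : `|t| <= 1 -> 0 <= B ->
  `|h x| <= B -> `|w x| <= B -> normc (psi h w t x - 1) <= 2 * B * `|t|.
Proof.
move=> t1 B0 hB wB; apply: (le_trans (ler_normc_ReIm _)).
rewrite !(cReD, cImD, cReN, cImN) /=.
rewrite (_ : _ - _ - _ = - (t ^+ 2 * w x)); last by ring.
rewrite normrN oppr0 addr0 (normrM _ (w x)) normrX (normrM t (h x)).
have t0 := normr_ge0 t; have : `|t| ^+ 2 * `|w x| <= `|t| * B.
  by rewrite ler_pM ?exprn_ge0// expr2 ler_piMr.
have : `|t| * `|h x| <= `|t| * B by rewrite ler_wpM2l.
lra.
Qed.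

(* [psi] is an approximate eigenvector: the two Poisson equations cancel the terms of
   order [t] and [t ^ 2]. *)
Lemma eigenvector_expansion (B : R) : 1 <= B -> exists C : R, 0 <= C /\
  forall (k : R.-pker T ~> T) (g h w : T -> R) (s t : R), bmr g -> bmr h -> bmr w ->
  (forall x, `|g x| <= B) -> (forall x, `|h x| <= B) -> (forall x, `|w x| <= B) ->
  0 <= s <= B -> `|t| <= 1 ->
  (forall x, op k (fun y => g y + h y) x = h x) ->
  (forall x, op k (fun y => g y ^+ 2 / 2 + g y * h y + w y) x = w x + s / 2) ->
  forall x, normc (tw k g t (psi h w t) x -
      (expR (- (t ^+ 2 * s / 2)))%:C%C * psi h w t x) <= C * `|t| ^+ 3.
Proof.
move=> B1; have B0 : 0 <= B by lra.
pose C1 := B ^+ 3 * (1 + 2 * B) + (B ^+ 2 + B ^+ 3).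
pose C2 := B ^+ 2 * (1 + 2 * B) + B ^+ 2.
have C10 : 0 <= C1 by rewrite /C1 !addr_ge0// ?mulr_ge0 ?exprn_ge0// addr_ge0// mulr_ge0.
have C20 : 0 <= C2 by rewrite /C2 !addr_ge0// ?mulr_ge0 ?exprn_ge0// addr_ge0// mulr_ge0.
exists (C1 + C2); split; first exact: addr_ge0.
move=> k g h w s t mg mh mw gB hB wB /andP[s0 sB] t1 E1 E2 x.
have t0 := normr_ge0 t.
have t2 : t ^+ 2 = `|t| ^+ 2 by rewrite real_normK// num_real.
have psiB y : normc (psi h w t y) <= 1 + 2 * B.
  have -> : psi h w t y = 1 + (psi h w t y - 1) by ring.
  rewrite (le_trans (ler_normcD _ _))// Normc.normc1 lerD2l.
  rewrite (le_trans (normc_psi_sub1 t1 B0 (hB y) (wB y)))//.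
  by rewrite ler_piMr// mulr_ge0.
(* [P] is the product of the second-order expansion of the phase with [psi], cut after [t^2]; the
   Poisson equations evaluate its image exactly. *)
pose P y := Complex (1 - t ^+ 2 * (g y ^+ 2 / 2 + g y * h y + w y)) (t * (g y + h y)).
have mF1 : bmr (fun y => g y + h y) by exact: bmrD.
have mF2 : bmr (fun y => g y ^+ 2 / 2 + g y * h y + w y).
  apply: bmrD => //; apply: bmrD; last exact: bmrM.
  by apply: (@bmrM _ _ _ (fun y => g y ^+ 2)); [exact: bmrX|exact: bmr_cst].
have mP : bounded_measurable P.
  apply/bmCP; split; last exact: bmrZ.
  by apply: bmrB; [exact: bmr_cst|exact: bmrZ].
have PE : cop k P x = Complex (1 - t ^+ 2 * (w x + s / 2)) (t * h x).
  rewrite copE /P /=; congr Complex; last by rewrite opZ// E1.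
  by rewrite opB ?op_cst ?opZ ?E2//; [exact: bmr_cst|exact: bmrZ].
have mpsi := bmC_psi t mh mw.
have h1 : normc (tw k g t (psi h w t) x - cop k P x) <= C1 * `|t| ^+ 3.
  rewrite /tw /cop -cintB//; [|exact: prob_kernel|exact: bmC_phase].
  apply: ler_normc_cint; [exact: prob_kernel|apply: bmCB => //; exact: bmC_phase|].
  move=> y; pose T2 : R[i] := 1 + Complex 0 (t * g y) - (((t * g y) ^+ 2) / 2)%:C%C.
  have -> : eit (t * g y) * psi h w t y - P y =
    (eit (t * g y) - T2) * psi h w t y +
    Complex (t ^+ 4 * (g y ^+ 2 / 2 * w y)) (- (t ^+ 3 * (g y * w y + g y ^+ 2 / 2 * h y))).
    by apply: complexP; rewrite /T2 /P /psi !(cReD, cImD, cReN, cImN, cReM, cImM) /=; field.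
  have -> : C1 * `|t| ^+ 3 = B ^+ 3 * (1 + 2 * B) * `|t| ^+ 3 + (B ^+ 2 + B ^+ 3) * `|t| ^+ 3.
    by rewrite /C1; ring.
  rewrite (le_trans (ler_normcD _ _))// lerD//.
    rewrite Normc.normcM mulrAC ler_pM ?normc_ge0// (le_trans (eit_taylor3 _))//.
    by rewrite normrM exprMn mulrC ler_wpM2r ?exprn_ge0// lerXn2r ?nnegrE.
  rewrite (le_trans (ler_normc_ReIm _))//= normrN (normrM (t ^+ 4)) (normrM (t ^+ 3)) (normrM _ (w y)) !normrX.
  have g2 : `|g y ^+ 2 / 2| <= B ^+ 2 / 2.
    by rewrite normrM normrX (ger0_norm (_ : 0 <= 2^-1))// ler_wpM2r// lerXn2r ?nnegrE.
  have B2 : 0 <= B ^+ 2 by exact: exprn_ge0.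
  have a1 : `|t| ^+ 4 * (`|g y ^+ 2 / 2| * `|w y|) <= `|t| ^+ 3 * (B ^+ 3 / 2).
    apply: ler_pM; rewrite ?mulr_ge0 ?exprn_ge0//.
      by rewrite exprSr ler_piMr// exprn_ge0.
    have -> : B ^+ 3 / 2 = B ^+ 2 / 2 * B by field.
    exact: ler_pM.
  have a2 : `|t| ^+ 3 * `|g y * w y + g y ^+ 2 / 2 * h y| <= `|t| ^+ 3 * (B ^+ 2 + B ^+ 3 / 2).
    rewrite ler_wpM2l ?exprn_ge0// (le_trans (ler_normD _ _))// lerD// normrM.
      by rewrite expr2 ler_pM.
    have -> : B ^+ 3 / 2 = B ^+ 2 / 2 * B by field.
    by rewrite ler_pM.
  by apply: (le_trans (lerD a1 a2)); rewrite le_eqVlt; apply/orP; left; apply/eqP; field.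
have h2 : normc (cop k P x - (expR (- (t ^+ 2 * s / 2)))%:C%C * psi h w t x) <= C2 * `|t| ^+ 3.
  rewrite PE.
  have -> : Complex (1 - t ^+ 2 * (w x + s / 2)) (t * h x) -
     (expR (- (t ^+ 2 * s / 2)))%:C%C * psi h w t x =
     - ((expR (- (t ^+ 2 * s / 2)) - (1 - t ^+ 2 * s / 2))%:C%C * psi h w t x) +
     ((t ^+ 2 * s / 2)%:C%C * (psi h w t x - 1)).
    by apply: complexP; rewrite /psi !(cReD, cImD, cReN, cImN, cReM, cImM) /=; field.
  have -> : C2 * `|t| ^+ 3 = B ^+ 2 * (1 + 2 * B) * `|t| ^+ 3 + B ^+ 2 * `|t| ^+ 3.
    by rewrite /C2; ring.
  rewrite (le_trans (ler_normcD _ _))// normc_opp lerD//.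
    rewrite Normc.normcM normc_real (_ : _ * `|t| ^+ 3 = (B ^+ 2 * `|t| ^+ 3) * (1 + 2 * B)); last by ring.
    rewrite ler_pM ?normc_ge0//.
    have z0 : 0 <= t ^+ 2 * s / 2 by rewrite divr_ge0// mulr_ge0// sqr_ge0.
    rewrite (le_trans (expR_taylor2 z0))// t2.
    have -> : (`|t| ^+ 2 * s / 2) ^+ 2 = s ^+ 2 / 4 * `|t| ^+ 4 by field.
    apply: ler_pM; rewrite ?divr_ge0 ?exprn_ge0 ?sqr_ge0//.
      have : s ^+ 2 <= B ^+ 2 by rewrite lerXn2r ?nnegrE.
      by have := sqr_ge0 s; lra.
    by rewrite exprSr ler_piMr// exprn_ge0.
  rewrite Normc.normcM normc_real ger0_norm; last first.
    by rewrite divr_ge0// mulr_ge0// sqr_ge0.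
  have := normc_psi_sub1 t1 B0 (hB x) (wB x) => h3.
  have -> : B ^+ 2 * `|t| ^+ 3 = (`|t| ^+ 2 * B / 2) * (2 * B * `|t|) by field.
  apply: ler_pM => //; [by rewrite divr_ge0// mulr_ge0// sqr_ge0|exact: normc_ge0|].
  by rewrite t2 ler_wpM2r// ler_wpM2l// exprn_ge0.
have -> : tw k g t (psi h w t) x - (expR (- (t ^+ 2 * s / 2)))%:C%C * psi h w t x =
  (tw k g t (psi h w t) x - cop k P x) +
  (cop k P x - (expR (- (t ^+ 2 * s / 2)))%:C%C * psi h w t x) by ring.
by rewrite (le_trans (ler_normcD _ _))// mulrDl lerD.
Qed.

End eigenvector_expansion.

(** * Products of twisted operators *)

Arguments Normc.normc : simpl never.

Section twisted_products.
Context {R : realType} {d : measure_display} {T : measurableType d}.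
Variables (Q : R -> R.-pker T ~> T) (g : R -> T -> R) (m : nat) (r L : R).
Hypothesis hr : 0 <= r < 1.
Hypothesis L0 : 0 <= L.
Hypothesis Qosc : forall u, osc_contraction (Q u) m r.
Hypothesis Qlip : forall u v (f : T -> R) (M : R) x, bmr f -> (forall x, `|f x| <= M) ->
  `|op (Q u) f x - op (Q v) f x| <= L * `|u - v| * M.
Hypothesis Qclip : forall u v (F : T -> R[i]) (M : R) x, bounded_measurable F ->
  (forall x, normc (F x) <= M) ->
  normc (cop (Q u) F x - cop (Q v) F x) <= L * `|u - v| * M.
Hypothesis hg : lipf g.
Implicit Types (F G : T -> R[i]) (us : nat -> R).

Let mg u : bmr (g u).
Proof. by have [B [_ + _ _]] := hg; exact. Qed.

(** The operators have indices [j + 1, ..., j + l], the first one outermost: for the chain it is the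
    conditional mean, given the state at time [j], of the phases of the next [l] steps times [F]. *)
Fixpoint prodtw us (t : R) (j l : nat) F : T -> R[i] :=
  if l is l'.+1 then tw (Q (us j.+1)) (g (us j.+1)) t (prodtw us t j.+1 l' F) else F.

Lemma bm_prodtw us t j l F : bounded_measurable F -> bounded_measurable (prodtw us t j l F).
Proof. by elim: l j => //= l IH j hF; apply: bmC_tw => //; exact: IH. Qed.

Lemma ler_normc_prodtw us t j l F (M : R) : bounded_measurable F ->
  (forall x, normc (F x) <= M) -> forall x, normc (prodtw us t j l F x) <= M.
Proof.
elim: l j => //= l IH j hF hM; apply: ler_normc_tw => //; first exact: bm_prodtw.
exact: IH.
Qed.

Lemma prodtwB us t j l F G : bounded_measurable F -> bounded_measurable G ->
  prodtw us t j l (fun x => F x - G x) = fun x => prodtw us t j l F x - prodtw us t j l G x.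
Proof.
by elim: l j => //= l IH j hF hG; rewrite IH// twB//; exact: bm_prodtw.
Qed.

Lemma prodtwZ us t j l (c : R[i]) F : bounded_measurable F ->
  prodtw us t j l (fun x => c * F x) = fun x => c * prodtw us t j l F x.
Proof.
by elim: l j => //= l IH j hF; rewrite IH// twZ//; exact: bm_prodtw.
Qed.

Lemma prodtw_cat us t j l1 l2 F :
  prodtw us t j (l1 + l2) F = prodtw us t j l1 (prodtw us t (j + l1) l2 F).
Proof.
by elim: l1 j => [|l1 IH] j /=; rewrite ?addn0// IH addSnnS.
Qed.

Lemma prodtw_const (u : R) t j l F :
  prodtw (fun=> u) t j l F = iter l (tw (Q u) (g u) t) F.
Proof. by elim: l j => //= l IH j; rewrite IH. Qed.

(** The [n %% l] leftover operators are innermost, where they merely contract; the [n %/ l] complete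
    blocks then act one after the other. *)
Lemma prodtw_blocks us t l n (rho : R) : 0 <= rho -> (forall j F (M : R), (j + l <= n)%N ->
    bounded_measurable F -> (forall x, normc (F x) <= M) ->
    forall x, normc (prodtw us t j l F x) <= rho * M) ->
  forall F (M : R), bounded_measurable F -> (forall x, normc (F x) <= M) ->
  forall x, normc (prodtw us t 0 n F x) <= rho ^+ (n %/ l) * M.
Proof.
move=> rho0 H F M hF hM.
rewrite {1}(divn_eq n l) prodtw_cat add0n.
set G := prodtw us t _ (n %% l) F.
have hG : bounded_measurable G by exact: bm_prodtw.
have GM x : normc (G x) <= M by exact: ler_normc_prodtw.
suff hq q j : (j + q * l <= n)%N ->
    forall x, normc (prodtw us t j (q * l) G x) <= rho ^+ q * M.
  by apply: hq; rewrite add0n leq_divM.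
elim: q j => [|q IH] j; first by rewrite mul0n expr0 mul1r.
rewrite mulSn => jn x; rewrite prodtw_cat exprS -mulrA.
apply: H; [by move: jn; clear; lia|exact: bm_prodtw|].
by move=> y; apply: IH; move: jn; clear; lia.
Qed.

Lemma tw_lip : exists B : R, 0 <= B /\ forall u v t t' F (M : R) x, bounded_measurable F ->
  (forall x, normc (F x) <= M) ->
  normc (tw (Q u) (g u) t F x - tw (Q v) (g v) t' F x) <=
    B * (`|u - v| + `|t - t'| + `|t'| * `|u - v|) * M.
Proof.
have [B [B0 _ gB gL]] := hg; exists (L + B); split; first exact: addr_ge0.
move=> u v t t' F M x hF hM.
have M0 : 0 <= M by apply: le_trans (hM point); exact: normc_ge0.
rewrite /tw.
have -> : cop (Q u) (fun y => eit (t * g u y) * F y) x -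
    cop (Q v) (fun y => eit (t' * g v y) * F y) x =
  (cop (Q u) (fun y => eit (t * g u y) * F y - eit (t' * g v y) * F y) x) +
  (cop (Q u) (fun y => eit (t' * g v y) * F y) x - cop (Q v) (fun y => eit (t' * g v y) * F y) x).
  by rewrite /cop cintB; [ring|exact: prob_kernel|exact: bmC_phase|exact: bmC_phase].
have h1 : normc (cop (Q u) (fun y => eit (t * g u y) * F y - eit (t' * g v y) * F y) x) <=
   B * (`|t - t'| + `|t'| * `|u - v|) * M.
  apply: ler_normc_cint; [exact: prob_kernel|by apply: bmCB; exact: bmC_phase|].
  move=> y; rewrite -mulrBl Normc.normcM ler_pM ?normc_ge0//.
  rewrite (le_trans (eit_lip _ _))//.
  have -> : t * g u y - t' * g v y = (t - t') * g u y + t' * (g u y - g v y) by ring.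
  rewrite (le_trans (ler_normD _ _))// !normrM mulrDr lerD//.
    by rewrite mulrC ler_wpM2r.
  by rewrite mulrCA ler_wpM2l.
have h2 : normc (cop (Q u) (fun y => eit (t' * g v y) * F y) x -
    cop (Q v) (fun y => eit (t' * g v y) * F y) x) <= L * `|u - v| * M.
  apply: Qclip; first exact: bmC_phase.
  by move=> y; rewrite Normc.normcM normc_eit mul1r.
rewrite (le_trans (ler_normcD _ _))//; apply: (le_trans (lerD h1 h2)).
rewrite -mulrDl ler_wpM2r// !mulrDr !mulrDl.
have a1 := normr_ge0 (t - t'); have a2 : 0 <= `|t'| * `|u - v| by exact: mulr_ge0.
have a3 := normr_ge0 (u - v).
have b1 : 0 <= L * `|t - t'| by exact: mulr_ge0.
have b2 : 0 <= L * (`|t'| * `|u - v|) by exact: mulr_ge0.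
have b3 : 0 <= B * `|u - v| by exact: mulr_ge0.
lra.
Qed.

(** Replace the operators one at a time: all the others contract, so each replacement costs no more
    than [tw_lip] allows. *)
Lemma prodtw_freeze : exists B : R, 0 <= B /\ forall us t v t' (zeta : R) j p F (M : R) x,
  0 <= zeta -> bounded_measurable F -> (forall x, normc (F x) <= M) ->
  (forall i, (j < i <= j + p)%N -> `|us i - v| <= zeta) ->
  normc (prodtw us t j p F x - iter p (tw (Q v) (g v) t') F x) <=
    p%:R * (B * (zeta + `|t - t'| + `|t'| * zeta) * M).
Proof.
have [B [B0 HB]] := tw_lip; exists B; split=> // us t v t' zeta j p F M x z0 hF hM.
have M0 : 0 <= M by apply: le_trans (hM point); exact: normc_ge0.
elim: p j x => [|p IH] j x hz; first by rewrite /= subrr Normc.normc0 mul0r.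
rewrite iterS [prodtw _ _ _ _ _]/=.
set A := tw (Q (us j.+1)) _ t; set A' := tw (Q v) (g v) t'.
have bA : bounded_measurable (iter p A' F).
  by apply: (@bm_iter _ _ _ A' _ p F) => // G hG; exact: bmC_tw.
have cA y : normc (iter p A' F y) <= M.
  apply: (@iter_contr _ _ _ A' _ _ p F M) => // G; first by move=> hG; exact: bmC_tw.
  by move=> N hG hN; exact: ler_normc_tw.
have -> : A (prodtw us t j.+1 p F) x - A' (iter p A' F) x =
  A (fun y => prodtw us t j.+1 p F y - iter p A' F y) x +
  (A (iter p A' F) x - A' (iter p A' F) x).
  by rewrite /A twB//; [ring|exact: bm_prodtw].
rewrite (le_trans (ler_normcD _ _))// -natr1 mulrDl mul1r lerD//.
  apply: ler_normc_tw => //; first by apply: bmCB => //; exact: bm_prodtw.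
  by move=> y; apply: IH => i hi; apply: hz; move: hi; clear; lia.
apply: (le_trans (HB _ _ _ _ _ M _ bA cA)).
have hz1 : `|us j.+1 - v| <= zeta by apply: hz; rewrite ltnSn addnS ltnS leq_addr.
rewrite ler_wpM2r// ler_wpM2l// lerD//; first by rewrite lerD.
by rewrite ler_wpM2l.
Qed.

Section decay_away_from_zero.
Hypothesis rho_lt1 : forall u t, 0 <= u <= 1 -> t != 0 ->
  (spectral_radius (tw (Q u) (g u) t) < 1)%E.

(** The factor [1 / 4] of [power_decay] at [(u0, t0)] leaves room for a perturbation: on a
    neighbourhood of size [e], the [N0] replaced factors cost at most another [1 / 4]. Contraction
    extends the bound to all larger powers, so compactness yields a single exponent. *)
Lemma uniform_power_decay (del T0 : R) : 0 < del -> exists N : nat,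
  forall u t, 0 <= u <= 1 -> del <= t <= T0 -> forall F (M : R), bounded_measurable F ->
  (forall x, normc (F x) <= M) ->
  forall x, normc (iter N (tw (Q u) (g u) t) F x) <= M / 2.
Proof.
move=> del0; have [B [B0 HB]] := prodtw_freeze.
pose P (N : nat) (p : R * R) := forall F (M : R), bounded_measurable F ->
  (forall x, normc (F x) <= M) ->
  forall x, normc (iter N (tw (Q p.1) (g p.1) p.2) F x) <= M / 2.
have cK : compact (`[0, 1] `*` `[del, T0] : set (R * R)).
  by apply: compact_setX; exact: segment_compact.
have /compact_near_coveringP/(_ nat \oo P) := cK; case; last first.
  move=> N _ HN; exists N => u t hu ht.
  by apply: (HN N (leqnn N) (u, t)); split; rewrite /= in_itv.
move=> [u0 t0] [/=]; rewrite !in_itv/= => hu0 /andP[t0d t0T].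
have t00 : t0 != 0 by rewrite gt_eqF// (lt_le_trans del0).
have [||||N0 HN0] := @power_decay _ _ _ (tw (Q u0) (g u0) t0).
- by move=> F hF; exact: bmC_tw.
- by move=> c F G hF hG; exact: tw_lin.
- by move=> F M hF hM; exact: ler_normc_tw.
- exact: rho_lt1.
pose e : R := (4 * (N0%:R + 1) * (B + 1) * (2 + `|t0|))^-1.
have n1 : 0 < N0%:R + 1 :> R by rewrite ltr_wpDl.
have B1 : 0 < B + 1 by rewrite ltr_wpDl.
have t1 : 0 < 2 + `|t0| by rewrite ltr_wpDr.
have e0 : 0 < e by rewrite invr_gt0 !mulr_gt0.
exists ([set p | `|u0 - p.1| < e /\ `|t0 - p.2| < e], [set n | (N0 <= n)%N]).
  split => /=; last by exists N0.
  exists ([set u | `|u0 - u| < e], [set t | `|t0 - t| < e]) => /=; last by move=> [u t] [].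
  by split; apply/nbhs_ballP; exists e.
move=> [[u t] N] [/= [hu ht] hN] F M hF hM x.
have M0 : 0 <= M by apply: le_trans (hM point); exact: normc_ge0.
have bA l : bounded_measurable (iter l (tw (Q u) (g u) t) F).
  by rewrite -(prodtw_const _ _ 0); exact: bm_prodtw.
rewrite /= -(subnK hN) iterD.
have bA0 : bounded_measurable (iter N0 (tw (Q u) (g u) t) F) by exact: bA.
rewrite -(prodtw_const _ _ 0); apply: ler_normc_prodtw => // y.
have := HB (fun=> u) t u0 t0 e 0%N N0 F M y (ltW e0) hF hM.
have -> : (forall i, (0 < i <= 0 + N0)%N -> `|u - u0| <= e) = True.
  by apply/propext; split=> // _ i _; rewrite distrC ltW.
move=> /(_ Logic.I); rewrite prodtw_const => h1.
have h2 := HN0 F M hF hM y.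
have h3 : N0%:R * (B * (e + `|t - t0| + `|t0| * e) * M) <= M / 4.
  have -> : M / 4 = (N0%:R + 1) * ((B + 1) * ((2 + `|t0|) * e) * M).
    by rewrite /e; field; rewrite !gt_eqF.
  rewrite ler_pM// ?mulr_ge0 ?addr_ge0 ?mulr_ge0// ?(ltW e0)//; first by rewrite lerDl.
  rewrite ler_wpM2r// ler_pM ?addr_ge0 ?mulr_ge0 ?(ltW e0)//; first by rewrite lerDl.
  by rewrite distrC in ht; lra.
have -> : iter N0 (tw (Q u) (g u) t) F y =
  (iter N0 (tw (Q u) (g u) t) F y - iter N0 (tw (Q u0) (g u0) t0) F y) +
  iter N0 (tw (Q u0) (g u0) t0) F y by ring.
rewrite (le_trans (ler_normcD _ _))//; lra.
Qed.

(** Along a block of fixed length the parameter [k / n] moves by [O(1 / n)], so for large [n] the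
    block is a small perturbation of a frozen power. *)
Lemma decay_away_from_zero (del T0 : R) : 0 < del -> exists l n0 : nat, (0 < l)%N /\
  forall n t, (n0 <= n)%N -> del <= t <= T0 -> forall F (M : R), bounded_measurable F ->
  (forall x, normc (F x) <= M) ->
  forall x, normc (prodtw (fun k => k%:R / n%:R) t 0 n F x) <= (3 / 4) ^+ (n %/ l) * M.
Proof.
move=> del0; have [N HN] := uniform_power_decay T0 del0.
have [B [B0 HB]] := prodtw_freeze.
pose c : R := N.+1%:R * (B * (N.+1%:R + `|T0| * N.+1%:R)).
have c0 : 0 <= c by rewrite /c !mulr_ge0// addr_ge0// mulr_ge0.
(* [N.+1] keeps the block length positive; [n >= 4 c] bounds the cost of freezing by [M / 4], and
   [1 / 2 + 1 / 4 = 3 / 4]. *)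
exists N.+1, (Num.bound (4 * c)).+1; split=> // n t n0 ht.
have nb : 4 * c <= n%:R.
  apply: (@le_trans _ _ (Num.bound (4 * c))%:R); last by rewrite ler_nat ltnW.
  by rewrite ltW//; apply: le_lt_trans (archi_boundP _) => //; rewrite mulr_ge0.
have np : (0 < n)%N by exact: leq_ltn_trans n0.
have nR : 0 < n%:R :> R by rewrite ltr0n.
apply: prodtw_blocks => // j F M jn hF hM x.
have M0 : 0 <= M by apply: le_trans (hM point); exact: normc_ge0.
have /andP[td tT] := ht; have tp : 0 < t by exact: lt_le_trans td.
have ju : 0 <= (j%:R / n%:R : R) <= 1.
  by rewrite divr_ge0//= ler_pdivrMr// mul1r ler_nat; move: jn; clear; lia.
have h1 := HN _ _ ju ht F M hF hM.
have h1' y : normc (iter N.+1 (tw (Q (j%:R / n%:R)) (g (j%:R / n%:R)) t) F y) <= M / 2.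
  rewrite iterS; apply: ler_normc_tw => //.
  by rewrite -(prodtw_const _ _ 0); exact: bm_prodtw.
have z0 : 0 <= N.+1%:R / n%:R :> R by rewrite divr_ge0.
have := HB (fun k => k%:R / n%:R) t (j%:R / n%:R) t (N.+1%:R / n%:R) j N.+1 F M x z0 hF hM.
have -> : (forall i, (j < i <= j + N.+1)%N -> `|(i%:R / n%:R : R) - j%:R / n%:R| <= N.+1%:R / n%:R) = True.
  apply/propext; split=> // _ i /andP[i1 i2].
  rewrite -mulrBl -natrB ?(ltnW i1)// ger0_norm ?divr_ge0//.
  by rewrite ler_pM2r ?invr_gt0// ler_nat; move: i1 i2; clear; lia.
move=> /(_ Logic.I); rewrite subrr normr0 addr0 => h2.
have h3 : N.+1%:R * (B * (N.+1%:R / n%:R + `|t| * (N.+1%:R / n%:R)) * M) <= M / 4.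
  apply: (@le_trans _ _ (c / n%:R * M)).
    have -> : c / n%:R * M = N.+1%:R * (B * (N.+1%:R / n%:R + `|T0| * (N.+1%:R / n%:R)) * M).
      by rewrite /c; field; rewrite gt_eqF.
    rewrite ler_wpM2l// ler_wpM2r// ler_wpM2l// lerD2l ler_wpM2r//.
    by rewrite !ger0_norm// ?(ltW tp)// (le_trans _ tT)// ltW.
  rewrite mulrC ler_wpM2l// ler_pdivrMr//; lra.
have -> : prodtw (fun k => k%:R / n%:R) t j N.+1 F x =
  (prodtw (fun k => k%:R / n%:R) t j N.+1 F x -
   iter N.+1 (tw (Q (j%:R / n%:R)) (g (j%:R / n%:R)) t) F x) +
  iter N.+1 (tw (Q (j%:R / n%:R)) (g (j%:R / n%:R)) t) F x by ring.
rewrite (le_trans (ler_normcD _ _))//; have := h1' x; lra.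
Qed.

End decay_away_from_zero.
End twisted_products.

(** * Products of twisted operators near the origin *)

Section near_zero.
Context {R : realType} {d : measure_display} {T : measurableType d}.
Variables (Q : R -> R.-pker T ~> T) (g : R -> T -> R) (m : nat) (r L : R).
Hypothesis hr : 0 <= r < 1.
Hypothesis L0 : 0 <= L.
Hypothesis Qosc : forall u, osc_contraction (Q u) m r.
Hypothesis Qclip : forall u v (F : T -> R[i]) (M : R) x, bounded_measurable F ->
  (forall x, normc (F x) <= M) ->
  normc (cop (Q u) F x - cop (Q v) F x) <= L * `|u - v| * M.
Hypothesis hg : lipf g.
Variables (a s : R -> R) (h w : R -> T -> R) (c0 : R).
Hypothesis c00 : 0 < c0.
Hypothesis s_ge : forall u, c0 <= s u.
Hypothesis la : lipf (fun u (_ : T) => a u).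
Hypothesis ls : lipf (fun u (_ : T) => s u).
Hypothesis lh : lipf h.
Hypothesis lw : lipf w.
Hypothesis E1 : forall u x, op (Q u) (fun y => (g u y - a u) + h u y) x = h u x.
Hypothesis E2 : forall u x, op (Q u)
  (fun y => (g u y - a u) ^+ 2 / 2 + (g u y - a u) * h u y + w u y) x = w u x + s u / 2.
Implicit Types (F G : T -> R[i]) (us : nat -> R).

Let mg u : bmr (g u).
Proof. by have [B [_ + _ _]] := hg; exact. Qed.
Let mh u : bmr (h u).
Proof. by have [B [_ + _ _]] := lh; exact. Qed.
Let mw u : bmr (w u).
Proof. by have [B [_ + _ _]] := lw; exact. Qed.

(** The characteristic function of the normal law with mean [a u] and variance [s u]; thus [Lam] is
    that of a sum of independent normal variables. *)
Definition lam (u t : R) : R[i] := eit (t * a u) * (expR (- (t ^+ 2 * s u / 2)))%:C%C.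

Lemma normc_lam u t : normc (lam u t) = expR (- (t ^+ 2 * s u / 2)).
Proof. by rewrite Normc.normcM normc_eit mul1r normc_real ger0_norm ?expR_ge0. Qed.

Lemma normc_lam_le u t : normc (lam u t) <= expR (- (t ^+ 2 * c0 / 2)).
Proof.
by rewrite normc_lam ler_expR lerN2 ler_pM2r// ler_wpM2l ?sqr_ge0.
Qed.

Lemma normc_lam_le1 u t : normc (lam u t) <= 1.
Proof.
rewrite (le_trans (normc_lam_le u t))// -[leRHS]expR0 ler_expR oppr_le0.
by rewrite divr_ge0// mulr_ge0 ?sqr_ge0// ltW.
Qed.

Definition Lam us t j l := \prod_(i < l) lam (us (j + i).+1) t.

Lemma normc_Lam_le us t j l : normc (Lam us t j l) <= expR (- (l%:R * t ^+ 2 * c0 / 2)).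
Proof.
have -> : - (l%:R * t ^+ 2 * c0 / 2) = l%:R * (- (t ^+ 2 * c0 / 2)) by ring.
rewrite expRM_natl /Lam; elim: l => [|l IH]; first by rewrite big_ord0 Normc.normc1 expr0.
rewrite big_ord_recr /= Normc.normcM exprSr ler_pM ?normc_ge0//.
exact: normc_lam_le.
Qed.

Lemma normc_Lam_le1 us t j l : normc (Lam us t j l) <= 1.
Proof.
rewrite (le_trans (normc_Lam_le us t j l))// -[leRHS]expR0 ler_expR oppr_le0.
by rewrite divr_ge0// mulr_ge0 ?(ltW c00)// mulr_ge0// sqr_ge0.
Qed.

Lemma LamS us t j l : Lam us t j l.+1 = lam (us j.+1) t * Lam us t j.+1 l.
Proof.
rewrite /Lam big_ord_recl addn0; congr (_ * _); apply: eq_bigr => i _.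
by rewrite /= /bump /= addnA addn1.
Qed.

Lemma corrector_bound : exists B : R, 1 <= B /\ forall u x,
  [/\ `|g u x - a u| <= B, `|h u x| <= B, `|w u x| <= B, `|s u| <= B &
   forall v, `|h u x - h v x| <= B * `|u - v| /\ `|w u x - w v x| <= B * `|u - v|].
Proof.
have [B1 [? _ b1 _]] := lipfB hg la; have [B2 [? _ b2 l2]] := lh.
have [B3 [? _ b3 l3]] := lw; have [B4 [? _ b4 _]] := ls.
exists (1 + B1 + B2 + B3 + B4); split; first lra.
move=> u x; split=> [||||v].
- by apply: (le_trans (b1 u x)); lra.
- by apply: (le_trans (b2 u x)); lra.
- by apply: (le_trans (b3 u x)); lra.
- by apply: (le_trans (b4 u x)); lra.
split.
  by apply: (le_trans (l2 u v x)); rewrite ler_wpM2r//; lra.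
by apply: (le_trans (l3 u v x)); rewrite ler_wpM2r//; lra.
Qed.

Lemma eigenvector_step : exists C : R, 0 <= C /\ forall u t x, `|t| <= 1 ->
  normc (tw (Q u) (g u) t (psi (h u) (w u) t) x - lam u t * psi (h u) (w u) t x) <=
  C * `|t| ^+ 3.
Proof.
have [B [B1 HB]] := corrector_bound.
have [C [C0 HC]] := eigenvector_expansion (T := T) B1.
exists C; split=> // u t x t1.
have mga : bmr (fun y => g u y - a u) by apply: bmrB => //; exact: bmr_cst.
have -> : tw (Q u) (g u) t (psi (h u) (w u) t) x =
    eit (t * a u) * tw (Q u) (fun y => g u y - a u) t (psi (h u) (w u) t) x.
  rewrite /tw /cop -cintZ; [|exact: prob_kernel|by apply: bmC_phase => //; exact: bmC_psi].
  congr cintegral; apply/funext => y; rewrite mulrA -eitD; congr (eit _ * _); ring.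
rewrite /lam -mulrA -mulrBr Normc.normcM normc_eit mul1r.
apply: HC => //.
- by move=> y; have [] := HB u y.
- by move=> y; have [] := HB u y.
- by move=> y; have [] := HB u y.
- have [_ _ _ + _] := HB u x; rewrite ler_norml => /andP[_ ->].
  by rewrite (le_trans _ (s_ge u))// ltW.
Qed.

Lemma psi_lip : exists C : R, 0 <= C /\ forall u v t x, `|t| <= 1 ->
  normc (psi (h u) (w u) t x - psi (h v) (w v) t x) <= C * `|t| * `|u - v| /\
  normc (psi (h u) (w u) t x - 1) <= C * `|t|.
Proof.
have [B [B1 HB]] := corrector_bound.
exists (2 * B); split; first lra.
move=> u v t x t1; have [_ hB wB _ /(_ v)[hL wL]] := HB u x; split; last first.
  by apply: normc_psi_sub1 => //; lra.
apply: (le_trans (ler_normc_ReIm _)).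
rewrite !(cReD, cImD, cReN, cImN) /=.
have -> : 1 - t ^+ 2 * w u x - (1 - t ^+ 2 * w v x) = - (t ^+ 2 * (w u x - w v x)) by ring.
have -> : t * h u x - t * h v x = t * (h u x - h v x) by ring.
rewrite normrN (normrM (t ^+ 2)) (normrX 2 t) (normrM t (h u x - h v x)).
have t0 := normr_ge0 t.
have : `|t| ^+ 2 * `|w u x - w v x| <= `|t| * (B * `|u - v|).
  by rewrite ler_pM ?exprn_ge0// expr2 ler_piMr.
have : `|t| * `|h u x - h v x| <= `|t| * (B * `|u - v|) by rewrite ler_wpM2l.
lra.
Qed.

(** Telescoping with [psi] taken at the current parameter: each step costs [O(t^3)] for the
    eigenvector equation and [O(t eta)] for moving [psi] to the next parameter, while exchanging
    [psi] with 1 at both ends costs [O(t)]. *)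
Lemma product_expansion : exists C : R, 0 <= C /\ forall us (eta t : R) j l x,
  `|t| <= 1 -> (forall i, `|us i.+1 - us i| <= eta) ->
  normc (prodtw Q g us t j l (fun=> 1) x - Lam us t j l) <=
    C * (`|t| + l%:R * `|t| ^+ 3 + l%:R * `|t| * eta).
Proof.
have [C1 [C10 HC1]] := eigenvector_step; have [C2 [C20 HC2]] := psi_lip.
exists (C1 + 2 * C2); split; first by rewrite addr_ge0// mulr_ge0.
move=> us eta t j l x t1 heta.
pose ps i := psi (h (us i)) (w (us i)) t.
have bps i : bounded_measurable (ps i) by exact: bmC_psi.
have t0 := normr_ge0 t.
have key : normc (prodtw Q g us t j l (ps (j + l)%N) x - Lam us t j l * ps j x) <=
    l%:R * (C1 * `|t| ^+ 3 + C2 * `|t| * eta).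
  elim: l j x => [|l IH] j x.
    by rewrite addn0 /= /Lam big_ord0 mul1r subrr Normc.normc0 mul0r.
  rewrite [prodtw _ _ _ _ _ _]/= LamS addnS -addSn.
  set A := tw _ _ _; set W := prodtw _ _ _ _ _ _ _; set Lm := Lam _ _ _ _.
  have bW : bounded_measurable W by exact: bm_prodtw.
  have -> : A W x - lam (us j.+1) t * Lm * ps j x =
    A (fun y => W y - Lm * ps j.+1 y) x +
    Lm * ((A (ps j.+1) x - lam (us j.+1) t * ps j.+1 x) +
       lam (us j.+1) t * (ps j.+1 x - ps j x)).
    by rewrite /A twB// ?twZ//; [ring|exact: bmCZ].
  rewrite (le_trans (ler_normcD _ _))// -natr1 mulrDl mul1r lerD//.
    apply: ler_normc_tw => //; first by apply: bmCB => //; exact: bmCZ.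
    by move=> y; exact: IH.
  rewrite Normc.normcM -[leRHS]mul1r ler_pM ?normc_ge0//; first exact: normc_Lam_le1.
  rewrite (le_trans (ler_normcD _ _))// lerD//; first exact: HC1.
  rewrite Normc.normcM -[leRHS]mul1r ler_pM ?normc_ge0//; first exact: normc_lam_le1.
  have [h1 _] := HC2 (us j.+1) (us j) t x t1.
  by rewrite (le_trans h1)// ler_wpM2l// mulr_ge0.
have -> : prodtw Q g us t j l (fun=> 1) x - Lam us t j l =
  prodtw Q g us t j l (fun y => 1 - ps (j + l)%N y) x +
  (prodtw Q g us t j l (ps (j + l)%N) x - Lam us t j l * ps j x) +
  Lam us t j l * (ps j x - 1).
  by rewrite prodtwB//; [ring|exact: bmC_cst].
have k1 : normc (prodtw Q g us t j l (fun y => 1 - ps (j + l)%N y) x) <= C2 * `|t|.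
  apply: ler_normc_prodtw => //; first by apply: bmCB => //; exact: bmC_cst.
  by move=> y; rewrite normcBC; have [] := HC2 (us (j + l)%N) 0 t y t1.
have k2 : normc (Lam us t j l * (ps j x - 1)) <= C2 * `|t|.
  rewrite Normc.normcM -[leRHS]mul1r ler_pM ?normc_ge0//; first exact: normc_Lam_le1.
  by have [] := HC2 (us j) 0 t x t1.
apply: (le_trans (ler_normcD _ _)); apply: (le_trans (lerD (ler_normcD _ _) k2)).
apply: (le_trans (lerD (lerD k1 key) (lexx _))).
have n0 : 0 <= l%:R * `|t| ^+ 3 by rewrite mulr_ge0 ?exprn_ge0.
have eta0 : 0 <= eta by apply: le_trans (heta 0%N).
have n1 : 0 <= l%:R * `|t| * eta by rewrite !mulr_ge0.
have := mulr_ge0 C10 n1; have := mulr_ge0 C20 n0; have := mulr_ge0 C10 t0.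
have := mulr_ge0 C20 n1; lra.
Qed.

Lemma iter_tw0 k (f : T -> R) n F : bounded_measurable F -> forall x,
  iter n (tw k f 0) F x = Complex (iter n (op k) (fun y => complex.Re (F y)) x)
                                  (iter n (op k) (fun y => complex.Im (F y)) x).
Proof.
move=> hF; have hk G : tw k f 0 G = cop k G.
  by rewrite /tw; congr cop; apply/funext => y; rewrite mul0r eit0 mul1r.
elim: n => [|n IH] x /=; first by case: (F x).
rewrite hk copE; congr Complex; rewrite /op; apply: eq_Rintegral => y _; by rewrite IH.
Qed.

(* Freezing the parameters and setting [t = 0] costs [O(eta + |t|)]; the frozen untwisted
   operator contracts oscillations. *)
Lemma prodtw_mixing : exists (p : nat) (C : R), 0 <= C /\ forall us (eta t : R) j F (M : R),
  0 <= eta -> (forall i, `|us i.+1 - us i| <= eta) -> bounded_measurable F ->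
  (forall x, normc (F x) <= M) -> exists c : R[i], normc c <= M /\ forall x,
    normc (prodtw Q g us t j p F x - c) <= (8^-1 + C * (eta + `|t|)) * M.
Proof.
(* Real and imaginary parts of [F] oscillate by at most [2 M] each, hence the factor 4. *)
have [J hJ] := @geometric_small _ 4 r 8^-1 hr (ltac:(by rewrite invr_gt0)).
have [B [B0 HB]] := prodtw_freeze L0 Qclip hg.
pose p := (J * m)%N; exists p, (p%:R * (B * (p%:R + 1))); split.
  by rewrite !mulr_ge0// addr_ge0.
move=> us eta t j F M eta0 heta hF hM.
have M0 : 0 <= M by apply: le_trans (hM point); exact: normc_ge0.
pose G := iter p (tw (Q (us j)) (g (us j)) 0) F.
have /bmCP[bR bI] := hF.
have GM x : normc (G x) <= M.
  rewrite /G -(prodtw_const _ _ _ _ 0); exact: ler_normc_prodtw.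
exists (G point); split=> // x.
have h1 : normc (G x - G point) <= 8^-1 * M.
  rewrite /G !iter_tw0// (le_trans (ler_normc_ReIm _))//=.
  have o1 y z : `|complex.Re (F y) - complex.Re (F z)| <= 2 * M.
    have := le_trans (ler_Re_normc _) (hM y); have := le_trans (ler_Re_normc _) (hM z).
    by have := ler_normB (complex.Re (F y)) (complex.Re (F z)); lra.
  have o2 y z : `|complex.Im (F y) - complex.Im (F z)| <= 2 * M.
    have := le_trans (ler_Im_normc _) (hM y); have := le_trans (ler_Im_normc _) (hM z).
    by have := ler_normB (complex.Im (F y)) (complex.Im (F z)); lra.
  have := osc_contraction_pow (Qosc (us j)) J bR o1 x point.
  have := osc_contraction_pow (Qosc (us j)) J bI o2 x point.
  have := ler_wpM2r M0 hJ; rewrite -/p; lra.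
have hz i : (j < i <= j + p)%N -> `|us i - us j| <= p%:R * eta.
  move=> /andP[ji ip]; have [q qp ->] : exists2 q, (q <= p)%N & i = (j + q)%N.
    by exists (i - j)%N; move: ji ip; clear; lia.
  apply: (@le_trans _ _ (q%:R * eta)); last by rewrite ler_wpM2r// ler_nat.
  elim: q {qp ji ip} => [|q IH]; first by rewrite addn0 subrr normr0 mul0r.
  rewrite addnS -natr1 mulrDl mul1r.
  have -> : us (j + q).+1 - us j = (us (j + q)%N - us j) + (us (j + q).+1 - us (j + q)%N) by ring.
  by rewrite (le_trans (ler_normD _ _))// lerD.
have pe : 0 <= p%:R * eta by rewrite mulr_ge0.
have h2 := HB us t (us j) 0 (p%:R * eta) j p F M x pe hF hM hz.
rewrite normr0 mul0r addr0 subr0 -/G in h2.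
have -> : prodtw Q g us t j p F x - G point =
  (prodtw Q g us t j p F x - G x) + (G x - G point) by ring.
rewrite (le_trans (ler_normcD _ _))// mulrDl addrC lerD//.
apply: (le_trans h2); rewrite -!mulrA ler_wpM2l// ler_wpM2l// mulrA ler_wpM2r//.
have t0 := normr_ge0 t; have := ler0n R p; have pt : 0 <= p%:R * `|t| by rewrite mulr_ge0.
lra.
Qed.

(* On a block of length of order [t^-2] the first [p] steps make [F] nearly constant and the
   remaining ones multiply a constant by [Lam], which is small in modulus. *)
Lemma block_contraction : exists del Bc : R, [/\ 0 < del, 0 < Bc &
  forall us (eta t : R) j l F (M : R), 0 < t <= del -> Bc <= l%:R * t ^+ 2 <= Bc + 1 ->
  0 <= eta -> l%:R * eta <= 1 ->
  (forall i, `|us i.+1 - us i| <= eta) -> bounded_measurable F ->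
  (forall x, normc (F x) <= M) ->
  forall x, normc (prodtw Q g us t j l F x) <= 2^-1 * M].
Proof.
have [C1 [C10 HC1]] := product_expansion.
have [p [C2 [C20 HC2]]] := prodtw_mixing.
(* The [p] mixing steps take at most 1 off [l t^2]; what remains gives an exponent of at least 7,
   and [e^-7 <= 1 / 8]. *)
pose Bc : R := 1 + 14 / c0.
have Bc1 : 1 <= Bc by rewrite /Bc lerDl divr_ge0// ltW.
(* For [t D <= 1] the errors of order [t] total at most [1 / 4], which with [1 / 8] from mixing and
   [1 / 8] from [Lam] makes [1 / 2]; moreover [p t^2 <= 1]. *)
pose D : R := 4 * (2 * C2 + C1 * (Bc + 3)) + p%:R + 1.
have D0 : 1 <= D.
  rewrite /D -addrA -[X in X <= _]add0r lerD ?lerDr//.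
  by rewrite mulr_ge0// addr_ge0// mulr_ge0//; lra.
exists D^-1, Bc; split; [by rewrite invr_gt0; lra|lra|].
move=> us eta t j l F M /andP[t0 tD] /andP[l1 l2] eta0 leta heta hF hM x.
have M0 : 0 <= M by apply: le_trans (hM point); exact: normc_ge0.
have tDD : t * D <= 1 by rewrite -ler_pdivlMr ?mul1r//; lra.
have t1 : t <= 1 by nra.
have tt : t ^+ 2 <= t by rewrite expr2 ler_piMr// ltW.
have pt : p%:R * t ^+ 2 <= 1.
  apply: (le_trans _ tDD); rewrite mulrC ler_pM// ?sqr_ge0//.
  rewrite /D; have : 0 <= 4 * (2 * C2 + C1 * (Bc + 3)).
    by rewrite mulr_ge0// addr_ge0// mulr_ge0//; lra.
  lra.
have tsq : 0 < t ^+ 2 by rewrite exprn_gt0.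
have pl : (p <= l)%N.
  by rewrite -(ler_nat R) -(ler_pM2r tsq); lra.
(* From [l eta <= 1 <= Bc <= l t^2]. *)
have etat : eta <= t.
  apply: le_trans tt.
  have l0 : 0 < l%:R :> R by rewrite -(pmulr_lgt0 _ tsq); lra.
  by rewrite -(ler_pM2l l0); lra.
rewrite -(subnK pl) prodtw_cat.
set q := (l - p)%N.
have qE : q%:R = l%:R - p%:R :> R by rewrite natrB.
have [c [cM Hc]] := HC2 us eta t (j + q)%N F M eta0 heta hF hM.
set G := prodtw Q g us t (j + q) p F in Hc *.
have bG : bounded_measurable G by exact: bm_prodtw.
have b1 := bmC_cst (T := T) (1 : R[i]).
have bc := bmC_cst (T := T) c.
have -> : prodtw Q g us t j q G x =
  prodtw Q g us t j q (fun y => G y - c) x + c * prodtw Q g us t j q (fun=> 1) x.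
  rewrite prodtwB//.
  have -> : (fun _ : T => c) = fun y => c * (fun=> 1) y by apply/funext => y; rewrite mulr1.
  by rewrite prodtwZ//; ring.
have k1 : normc (prodtw Q g us t j q (fun y => G y - c) x) <=
    (8^-1 + C2 * (eta + `|t|)) * M.
  by apply: ler_normc_prodtw => //; exact: bmCB.
have tn : `|t| = t by rewrite ger0_norm// ltW.
have t1' : `|t| <= 1 by rewrite tn.
have k2 : normc (prodtw Q g us t j q (fun=> 1) x) <=
   C1 * (`|t| + q%:R * `|t| ^+ 3 + q%:R * `|t| * eta) + 8^-1.
  have -> : prodtw Q g us t j q (fun=> 1) x =
    (prodtw Q g us t j q (fun=> 1) x - Lam us t j q) + Lam us t j q by ring.
  rewrite (le_trans (ler_normcD _ _))// lerD//; first exact: HC1.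
  rewrite (le_trans (normc_Lam_le _ _ _ _))//.
  have k3 : 7 <= q%:R * t ^+ 2 * c0 / 2.
    rewrite qE mulrBl; apply: (@le_trans _ _ ((Bc - 1) * c0 / 2)).
      by rewrite /Bc addrAC subrr add0r divfK ?gt_eqF//; lra.
    by rewrite ler_wpM2r// ler_wpM2r ?(ltW c00)//; lra.
  rewrite expRN lef_pV2 ?posrE ?expR_gt0//.
  by apply: le_trans (expR_ge1Dx _); lra.
have q0 : 0 <= q%:R :> R by [].
have qt : q%:R * t ^+ 2 <= Bc + 1.
  rewrite qE mulrBl; have h0 : 0 <= p%:R * t ^+ 2 by rewrite mulr_ge0// ltW.
  lra.
have qe : q%:R * eta <= 1.
  rewrite qE mulrBl; have h0 : 0 <= p%:R * eta by rewrite mulr_ge0.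
  lra.
rewrite (le_trans (ler_normcD _ _))// Normc.normcM.
apply: (@le_trans _ _ ((8^-1 + C2 * (eta + `|t|)) * M +
  M * (C1 * (`|t| + q%:R * `|t| ^+ 3 + q%:R * `|t| * eta) + 8^-1))).
  by rewrite lerD// ler_pM ?normc_ge0.
rewrite -[X in X + _]mulrC -mulrDr mulrC ler_wpM2r//.
rewrite tn.
have e1 : C2 * (eta + t) <= 2 * C2 * t.
  have := ler_wpM2l C20 etat; lra.
have e2 : C1 * (t + q%:R * t ^+ 3 + q%:R * t * eta) <= C1 * (Bc + 3) * t.
  rewrite -(mulrA C1) ler_wpM2l//.
  have := ler_wpM2l (ltW t0) qt; have := ler_wpM2l (ltW t0) qe.
  rewrite exprS; lra.
have e3 : (2 * C2 + C1 * (Bc + 3)) * t <= 4^-1.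
  have : (4 * (2 * C2 + C1 * (Bc + 3))) * t <= t * D.
    rewrite mulrC ler_wpM2l ?(ltW t0)// /D; have := ler0n R p; lra.
  lra.
lra.
Qed.

Lemma half_pow_le (q : nat) : (2^-1 : R) ^+ q <= (q.+1%:R)^-1.
Proof.
rewrite exprVn lef_pV2 ?posrE ?exprn_gt0 ?ltr0n// -natrX ler_nat.
by elim: q => // q IH; rewrite expnS; lia.
Qed.

(** Blocks of length [l] of order [t^-2] give [2^-(n / l)], which is weakened to
    [1 / (n / l + 1) <= l / n]. The range [l > n] is included: no block fits and the bound exceeds
    that of a contraction. *)
Lemma decay_near_zero : exists del C : R, [/\ 0 < del, 0 <= C &
  forall n t, (0 < n)%N -> 0 < t <= del -> forall F (M : R), bounded_measurable F ->
  (forall x, normc (F x) <= M) ->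
  forall x, normc (prodtw Q g (fun k => k%:R / n%:R) t 0 n F x) <= C / (n%:R * t ^+ 2) * M].
Proof.
have [del [Bc [del0 Bc0 H]]] := block_contraction.
exists (Num.min del 1), (Bc + 1); split; [by rewrite lt_min del0/=|lra|].
move=> n t n0 /andP[t0]; rewrite le_min => /andP[td t1] F M hF hM x.
have M0 : 0 <= M by apply: le_trans (hM point); exact: normc_ge0.
have nR : 0 < n%:R :> R by rewrite ltr0n.
have tsq : 0 < t ^+ 2 by rewrite exprn_gt0.
have z0 : 0 <= Bc / t ^+ 2 by rewrite divr_ge0// ltW.
have /truncn_itv/andP[l1 l2] := z0.
set l := (Num.truncn (Bc / t ^+ 2)).+1 in l2.
have hl1 : Bc <= l%:R * t ^+ 2 by rewrite -ler_pdivrMr// ltW.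
have hl2 : l%:R * t ^+ 2 <= Bc + 1.
  rewrite -natr1 mulrDl mul1r lerD//; first by rewrite -ler_pdivlMr.
  by rewrite exprn_ile1// ltW.
have e0 : 0 <= n%:R^-1 :> R by rewrite invr_ge0.
have half0 : 0 <= 2^-1 :> R by rewrite invr_ge0.
have := @prodtw_blocks _ _ _ Q g hg (fun k => k%:R / n%:R) t l n 2^-1 half0.
move=> /(_ _ F M hF hM x) hb; apply: (le_trans (hb _)).
  move=> j G N jn bG hN y; apply: (H _ n%:R^-1) => //.
  - by rewrite t0.
  - by rewrite hl1.
  - by rewrite ler_pdivrMr// mul1r ler_nat; apply: leq_trans jn; exact: leq_addl.
  - move=> i; rewrite -mulrBl -natr1 addrAC subrr add0r mul1r ger0_norm//.
rewrite ler_wpM2r//; apply: (le_trans (half_pow_le _)).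
have q0 : 0 < (n %/ l).+1%:R :> R by rewrite ltr0n.
rewrite -[leLHS]mul1r ler_pdivrMr// mulrAC ler_pdivlMr ?mul1r; last by rewrite mulr_gt0.
apply: (@le_trans _ _ (l%:R * (n %/ l).+1%:R * t ^+ 2)).
  rewrite ler_wpM2r ?(ltW tsq)// -natrM ler_nat mulnC.
  exact/ltnW/ltn_ceil.
by rewrite mulrAC ler_wpM2r.
Qed.

End near_zero.

(** * Markov chains *)

Section functional_extension.
Context {R : realType} {d : measure_display} {T : measurableType d}.

(** Plays the part of a monotone class argument: the common bound makes both functionals continuous
    for the supremum norm, which is what [bmr_ind] asks for. *)
Lemma bmr_functional_ext (l1 l2 : (T -> R) -> R) (C : R) :
  (forall (a : R) f g, bmr f -> bmr g -> l1 (fun x => a * f x + g x) = a * l1 f + l1 g) ->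
  (forall (a : R) f g, bmr f -> bmr g -> l2 (fun x => a * f x + g x) = a * l2 f + l2 g) ->
  (forall f (M : R), bmr f -> (forall x, `|f x| <= M) -> `|l1 f| <= C * M) ->
  (forall f (M : R), bmr f -> (forall x, `|f x| <= M) -> `|l2 f| <= C * M) ->
  (forall A, measurable A -> l1 (\1_A) = l2 (\1_A)) ->
  forall f, bmr f -> l1 f = l2 f.
Proof.
move=> lin1 lin2 b1 b2 ind; apply: bmr_ind => //.
  by move=> a f g hf hg e1 e2; rewrite lin1// lin2// e1 e2.
move=> f hf hlim; apply/eqP; rewrite -subr_eq0 -normr_le0; apply/ler_addgt0Pl => e e0.
rewrite addr0; have C0 : 0 <= C.
  by have := b1 _ 1 (bmr_cst 1) (fun=> ltac:(by rewrite normr1)); rewrite mulr1; apply: le_trans.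
have e0' : 0 < e / (2 * (C + 1)) by rewrite divr_gt0// mulr_gt0// ltr_wpDl.
have [g [hg eg fg]] := hlim _ e0'.
have hfg : bmr (fun x => -1 * g x + f x) by apply: bmrD => //; exact: bmrZ.
have hle x : `|-1 * g x + f x| <= e / (2 * (C + 1)) by rewrite mulN1r addrC.
have := b1 _ _ hfg hle; have := b2 _ _ hfg hle.
rewrite lin1// lin2// eg => h1 h2.
have -> : l1 f - l2 f = (-1 * l2 g + l1 f) - (-1 * l2 g + l2 f) by ring.
rewrite (le_trans (ler_normB _ _))//.
have h3 : C * (e / (2 * (C + 1))) <= e / 2.
  have -> : e / 2 = (C + 1) * (e / (2 * (C + 1))).
    by field; rewrite gt_eqF// ltr_wpDl.
  by rewrite ler_wpM2r ?(ltW e0')// lerDl.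
lra.
Qed.

End functional_extension.

Section markov_chains.
Context {R : realType} {d d' : measure_display} {T : measurableType d}
  {Omega : measurableType d'}.
Variables (N : nat) (P : probability Omega R) (mu : probability T R)
  (K : nat -> R.-pker T ~> T) (X : nat -> Omega -> T).
Hypothesis hX : markov_chain N P mu K X.

(** [Omega] with the sigma-algebra generated by [X 0, ..., X k], so that [bmr] over [Om k] means
    bounded and determined by the past up to time [k]. *)
Local Notation Om k := (g_sigma_algebraType
  (\bigcup_(j in [set j | (j <= k)%N]) preimage_set_system setT (X j) measurable)).

Let P1 : P setT = 1%E.
Proof. exact: probability_setT. Qed.

Let mX k : (k <= N)%N -> measurable_fun setT (X k).
Proof. by case: hX => + _ _; exact. Qed.

Lemma measurable_past k (H : set Omega) : (k <= N)%N -> past X k H -> measurable H.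
Proof.
move=> kN; apply: smallest_sub; first exact: sigma_algebra_measurable.
by move=> _ [j /= jk [A mA <-]]; apply: mX => //; exact: leq_trans kN.
Qed.

Lemma bmr_past k (F : Omega -> R) : (k <= N)%N -> bmr (F : Om k -> R) -> bmr F.
Proof.
move=> kN [mF bF]; split=> // _ A mA; rewrite setTI.
apply: (measurable_past kN); have := mF measurableT A mA; rewrite setTI.
exact.
Qed.

Lemma measurable_coordinate j k : (j <= k)%N ->
  measurable_fun setT (X j : Om k -> T).
Proof.
move=> jk _ A mA; apply: sub_sigma_algebra; exists j => //.
by exists A.
Qed.

Lemma bmr_coordinate k (f : T -> R) : (k <= N)%N -> bmr f -> bmr (fun w => f (X k w)).
Proof.
move=> kN [mf [M hM]]; split; last by exists M.
by apply: measurableT_comp => //; exact: mX.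
Qed.

Lemma bmr_coordinate_past j k (f : T -> R) : (j <= k)%N -> bmr f ->
  bmr ((fun w => f (X j w)) : Om k -> R).
Proof.
move=> jk [mf [M hM]]; split; last by exists M.
by apply: measurableT_comp => //; exact: measurable_coordinate.
Qed.

(** Both sides are linear and bounded in [F] and in [v]. Extending once in each variable reduces the
    claim to a past event and a measurable set, where it is the last clause of [markov_chain]. *)
Lemma markov_step k (F : Omega -> R) (v : T -> R) : (k < N)%N ->
  bmr (F : Om k -> R) -> bmr v ->
  \int[P]_w (F w * v (X k.+1 w)) = \int[P]_w (F w * op (K k.+1) v (X k w)).
Proof.
move=> kN hF hv; have kN' := ltnW kN.
have bX (f : T -> R) : bmr f -> bmr (fun w => f (X k.+1 w)).
  by move=> hf; exact: (bmr_coordinate kN hf).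
have bO (f : T -> R) : bmr f -> bmr (fun w => op (K k.+1) f (X k w)).
  by move=> hf; exact: (bmr_coordinate kN' (bmr_op _ hf)).
suff ind H : past X k H -> \int[P]_w (\1_H w * v (X k.+1 w)) =
    \int[P]_w (\1_H w * op (K k.+1) v (X k w)).
  have [_ [M hM]] := hv.
  have M0 : 0 <= M by apply: le_trans (hM point).
  move: F hF; apply: (@bmr_functional_ext R _ (Om k)
    (fun F => \int[P]_w (F w * v (X k.+1 w)))
    (fun F => \int[P]_w (F w * op (K k.+1) v (X k w))) M).
  - move=> a f g /(bmr_past kN') hf /(bmr_past kN') hg.
    under eq_Rintegral do rewrite mulrDl -mulrA.
    by rewrite RintD// ?RintZ//; [exact/bmrM/bX|apply: bmrZ; exact/bmrM/bX|exact/bmrM/bX].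
  - move=> a f g /(bmr_past kN') hf /(bmr_past kN') hg.
    under eq_Rintegral do rewrite mulrDl -mulrA.
    by rewrite RintD// ?RintZ//; [exact/bmrM/bO|apply: bmrZ; exact/bmrM/bO|exact/bmrM/bO].
  - move=> f L /(bmr_past kN') hf fL; apply: ler_norm_Rint => //; first exact/bmrM/bX.
    by move=> w; rewrite normrM mulrC ler_pM.
  - move=> f L /(bmr_past kN') hf fL; apply: ler_norm_Rint => //; first exact/bmrM/bO.
    by move=> w; rewrite normrM mulrC ler_pM//; exact: ler_norm_op.
  - by move=> A mA; exact: ind.
move=> pH; have mH := measurable_past kN' pH; have bH := bmr_indic (R := R) mH.
have n1 w : `|\1_H w| <= 1 :> R by rewrite indicE; case: (_ \in _); rewrite ?normr1 ?normr0.
move: v hv; apply: (@bmr_functional_ext R _ T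
  (fun v => \int[P]_w (\1_H w * v (X k.+1 w)))
  (fun v => \int[P]_w (\1_H w * op (K k.+1) v (X k w))) 1).
- move=> a f g hf hg; under eq_Rintegral do rewrite mulrDr mulrCA.
  by rewrite RintD// ?RintZ//; [exact/bmrM/bX|apply: bmrZ; exact/bmrM/bX|exact/bmrM/bX].
- move=> a f g hf hg; rewrite (opD _ (bmrZ a hf) hg) (opZ _ a hf).
  under eq_Rintegral do rewrite mulrDr mulrCA.
  by rewrite RintD// ?RintZ//; [exact/bmrM/bO|apply: bmrZ; exact/bmrM/bO|exact/bmrM/bO].
- move=> f L hf fL; apply: ler_norm_Rint => //; first exact/bmrM/bX.
  by move=> w; rewrite normrM ler_pM.
- move=> f L hf fL; apply: ler_norm_Rint => //; first exact/bmrM/bO.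
  by move=> w; rewrite normrM ler_pM//; exact: ler_norm_op.
- move=> A mA; have [_ _ hm] := hX; have := hm k kN H A pH mA.
  have mXA : measurable (X k.+1 @^-1` A) by rewrite -[_ @^-1` _]setTI; exact: mX.
  move=> /(congr1 fine) e.
  transitivity (\int[P]_w \1_(H `&` X k.+1 @^-1` A) w).
    by apply: eq_Rintegral => w _; rewrite indicI.
  rewrite Rint_indic; last exact: measurableI.
  rewrite e -[RHS]/(fine (\int[P]_w _)).
  rewrite integral_mkcond; congr fine; apply: eq_integral => w _.
  rewrite patchE /op Rint_indic// indicE; case: ifPn => wH.
    rewrite mul1r fineK// ge0_fin_numE//.
    apply: (@le_lt_trans _ _ (K k.+1 (X k w) setT)).
      by apply: le_measure => //; rewrite ?inE.
    by rewrite prob_kernel ltry.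
  by rewrite mul0r.
Qed.

Lemma cintegral_markov_step k (F : Omega -> R[i]) (V : T -> R[i]) : (k < N)%N ->
  bounded_measurable (F : Om k -> R[i]) -> bounded_measurable V ->
  cintegral P (fun w => F w * V (X k.+1 w)) =
  cintegral P (fun w => F w * cop (K k.+1) V (X k w)).
Proof.
move=> kN /bmCP[FR FI] /bmCP[VR VI]; have kN' := ltnW kN.
have FR' := bmr_past kN' FR; have FI' := bmr_past kN' FI.
have bX (f : T -> R) : bmr f -> bmr (fun w => f (X k.+1 w)).
  by move=> hf; exact: (bmr_coordinate kN hf).
have bO (f : T -> R) : bmr f -> bmr (fun w => op (K k.+1) f (X k w)).
  by move=> hf; exact: (bmr_coordinate kN' (bmr_op _ hf)).
apply: complexP => /=.
  under eq_Rintegral do rewrite cReM.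
  under [RHS]eq_Rintegral do rewrite cReM.
  have h1 := bmrM FR' (bX _ VR); have h2 := bmrM FI' (bX _ VI).
  have h3 := bmrM FR' (bO _ VR); have h4 := bmrM FI' (bO _ VI).
  by rewrite (RintB P1 h1 h2) (RintB P1 h3 h4) (markov_step kN FR VR) (markov_step kN FI VI).
under eq_Rintegral do rewrite cImM.
under [RHS]eq_Rintegral do rewrite cImM.
have h1 := bmrM FR' (bX _ VI); have h2 := bmrM FI' (bX _ VR).
have h3 := bmrM FR' (bO _ VI); have h4 := bmrM FI' (bO _ VR).
by rewrite (RintD P1 h1 h2) (RintD P1 h3 h4) (markov_step kN FR VI) (markov_step kN FI VR).
Qed.

Variable G : nat -> T -> R.
Hypothesis bG : forall k, bmr (G k).

Definition psum (n : nat) (w : Omega) : R := \sum_(1 <= j < n.+1) G j (X j w).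

Lemma psumS n w : psum n.+1 w = psum n w + G n.+1 (X n.+1 w).
Proof. by rewrite /psum big_nat_recr. Qed.

Lemma bmr_psum_past n k : (n <= k)%N -> bmr (psum n : Om k -> R).
Proof.
elim: n => [|n IH] nk.
  have -> : psum 0 = fun=> 0 by apply/funext => w; rewrite /psum big_geq.
  exact: bmr_cst.
have -> : psum n.+1 = fun w => psum n w + G n.+1 (X n.+1 w).
  by apply/funext => w; exact: psumS.
by apply: bmrD; [apply: IH; exact: ltnW|exact: bmr_coordinate_past].
Qed.

Lemma bmr_psum n : (n <= N)%N -> bmr (psum n).
Proof. by move=> nN; apply: (bmr_past nN); exact: bmr_psum_past. Qed.

Lemma char_psum_step t k (V : T -> R[i]) : (k < N)%N -> bounded_measurable V ->
  cintegral P (fun w => eit (t * psum k.+1 w) * V (X k.+1 w)) =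
  cintegral P (fun w => eit (t * psum k w) * tw (K k.+1) (G k.+1) t V (X k w)).
Proof.
move=> kN hV.
have -> : (fun w => eit (t * psum k.+1 w) * V (X k.+1 w)) =
    fun w => eit (t * psum k w) * (fun y => eit (t * G k.+1 y) * V y) (X k.+1 w).
  by apply/funext => w; rewrite psumS mulrDr eitD mulrA.
apply: (@cintegral_markov_step k (fun w => eit (t * psum k w))
  (fun y => eit (t * G k.+1 y) * V y) kN); last exact: bmC_phase.
apply: bmC_eit; have [m _] := bmr_psum_past (leqnn k).
by apply: measurable_funM.
Qed.

End markov_chains.

Section characteristic_function.
Context {R : realType} {d d' : measure_display} {T : measurableType d}
  {Omega : measurableType d'}.
Variables (N : nat) (P : probability Omega R) (mu : probability T R)
  (Q : R -> R.-pker T ~> T) (g : R -> T -> R) (us : nat -> R) (X : nat -> Omega -> T).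
Hypothesis hX : markov_chain N P mu (fun k => Q (us k)) X.
Hypothesis hg : lipf g.

Lemma char_psum t j l (V : T -> R[i]) : (j + l <= N)%N -> bounded_measurable V ->
  cintegral P (fun w => eit (t * psum X (fun k => g (us k)) (j + l)%N w) * V (X (j + l)%N w)) =
  cintegral P (fun w => eit (t * psum X (fun k => g (us k)) j w) * prodtw Q g us t j l V (X j w)).
Proof.
elim: l j V => [|l IH] j V; first by rewrite addn0.
rewrite -addSnnS => jN hV; rewrite IH//.
apply: (@char_psum_step _ _ _ _ _ N P mu _ X hX (fun k => g (us k)) _ t j).
- by move=> k; have [B [_ + _ _]] := hg; exact.
- by apply: leq_trans jN; rewrite addSn ltnS leq_addr.
- exact: bm_prodtw.
Qed.

Lemma char_psumE t n : (n <= N)%N ->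
  cintegral P (fun w => eit (t * psum X (fun k => g (us k)) n w)) =
  cintegral P (fun w => prodtw Q g us t 0 n (fun=> 1) (X 0%N w)).
Proof.
move=> nN; have := @char_psum t 0 n (fun=> 1) nN (bmC_cst 1).
rewrite add0n; under [X in cintegral P X = _ -> _]eq_fun do rewrite mulr1.
move=> ->; congr cintegral; apply/funext => w.
by rewrite /psum big_geq// mulr0 eit0 mul1r.
Qed.

End characteristic_function.

(** * Stationary chains: mean, asymptotic variance and its positivity *)

Section stationary_chain.
Context {R : realType} {d d' : measure_display} {T : measurableType d}
  {Omega : measurableType d'}.
Variables (P : probability Omega R) (mu : probability T R)
  (k : R.-pker T ~> T) (X : nat -> Omega -> T).
Hypothesis hX : forall N, markov_chain N P mu (fun=> k) X.
Hypothesis hmu : invariant_measure k mu.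

Let P1 : P setT = 1%E.
Proof. exact: probability_setT. Qed.
Let mu1 : mu setT = 1%E.
Proof. exact: probability_setT. Qed.

Lemma Rint_invariant f : bmr f -> \int[mu]_x op k f x = \int[mu]_x f x.
Proof.
move: f; apply: (@bmr_functional_ext R _ T (fun f => \int[mu]_x op k f x)
  (fun f => \int[mu]_x f x) 1).
- move=> a f g hf hg; have hf' := bmrZ a hf.
  rewrite (opD k hf' hg) (opZ k a hf) RintD ?RintZ//; try exact: bmr_op.
  by apply: bmrZ; exact: bmr_op.
- by move=> a f g hf hg; rewrite RintD ?RintZ//; exact: bmrZ.
- move=> f M hf hM; rewrite mul1r ler_norm_Rint//; first exact: bmr_op.
  exact: ler_norm_op.
- by move=> f M hf hM; rewrite mul1r ler_norm_Rint.
- move=> A mA; transitivity (fine (mu A)); last by rewrite Rint_indic.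
  rewrite -(hmu mA) -[LHS]/(fine (\int[mu]_x _)).
  congr fine; apply: eq_integral => x _; rewrite /op Rint_indic// fineK//.
  rewrite ge0_fin_numE//; apply: (@le_lt_trans _ _ (k x setT)).
    by apply: le_measure => //; rewrite ?inE.
  by rewrite prob_kernel ltry.
Qed.

Lemma Rint_chain n f : bmr f -> \int[P]_w f (X n w) = \int[mu]_x f x.
Proof.
have bX j (h : T -> R) : bmr h -> bmr (fun w => h (X j w)).
  by move=> hh; exact: (bmr_coordinate (hX j) (leqnn j) hh).
elim: n f => [|n IH] f hf; last first.
  have := @markov_step _ _ _ _ _ _ _ _ _ _ (hX n.+1) n (fun=> 1) f (ltnSn n) (bmr_cst 1) hf.
  under eq_Rintegral do rewrite mul1r.
  under [X in _ = X -> _]eq_Rintegral do rewrite mul1r.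
  by move=> ->; rewrite IH ?Rint_invariant//; exact: bmr_op.
move: f hf; apply: (@bmr_functional_ext R _ T (fun f => \int[P]_w f (X 0%N w))
  (fun f => \int[mu]_x f x) 1).
- move=> a f g hf hg; have hf' := bX 0%N _ hf; have hg' := bX 0%N _ hg.
  by rewrite RintD ?RintZ//; exact: bmrZ.
- by move=> a f g hf hg; rewrite RintD ?RintZ//; exact: bmrZ.
- by move=> f M hf hM; rewrite mul1r ler_norm_Rint//; exact: bX.
- by move=> f M hf hM; rewrite mul1r ler_norm_Rint.
- move=> A mA; have [m0 h0 _] := hX 0%N.
  have mXA : measurable (X 0%N @^-1` A) by rewrite -[_ @^-1` _]setTI; exact: m0.
  transitivity (fine (mu A)); last by rewrite Rint_indic.
  rewrite -(h0 A mA).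
  transitivity (\int[P]_w \1_(X 0%N @^-1` A) w); last by rewrite Rint_indic.
  by apply: eq_Rintegral.
Qed.

Variables (g h w : T -> R) (a s : R).
Hypothesis bg : bmr g.
Hypothesis bh : bmr h.
Hypothesis bw : bmr w.
Hypothesis E1 : forall x, op k (fun y => (g y - a) + h y) x = h x.
Hypothesis E2 : forall x,
  op k (fun y => (g y - a) ^+ 2 / 2 + (g y - a) * h y + w y) x = w x + s / 2.

Let bga : bmr (fun y => g y - a).
Proof. by apply: bmrB => //; exact: bmr_cst. Qed.

Lemma stationary_mean : \int[mu]_x g x = a.
Proof.
have b1 : bmr (fun y => (g y - a) + h y) by exact: bmrD.
have := Rint_invariant b1.
have -> : op k (fun y => (g y - a) + h y) = h by apply/funext => x; exact: E1.
rewrite RintD// RintB ?Rint_cst//; [lra|exact: bmr_cst].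
Qed.

(** Integrating the second Poisson equation cancels [w] and identifies [s] with the integral of
    [(g - a)^2 + 2 (g - a) h]; then complete the square. *)
Lemma stationary_varianceE : \int[mu]_x ((g x - a) + h x) ^+ 2 =
  \int[mu]_x h x ^+ 2 + s.
Proof.
have b0 : bmr (fun y => (g y - a) ^+ 2 / 2).
  by apply: (@bmrM _ _ _ (fun y => (g y - a) ^+ 2)); [exact: bmrX|exact: bmr_cst].
have b1 : bmr (fun y => (g y - a) ^+ 2 / 2 + (g y - a) * h y).
  by apply: bmrD => //; exact: bmrM.
have b2 := bmrD b1 bw.
have := Rint_invariant b2.
have -> : op k (fun y => (g y - a) ^+ 2 / 2 + (g y - a) * h y + w y) = fun x => w x + s / 2.
  by apply/funext => x; exact: E2.
rewrite (RintD mu1 b1 bw) (RintD mu1 bw (bmr_cst (s / 2))) (Rint_cst mu1) => e.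
have bh2 : bmr (fun x => h x ^+ 2) by exact: bmrX.
transitivity (\int[mu]_x (h x ^+ 2 + 2 * ((g x - a) ^+ 2 / 2 + (g x - a) * h x))).
  by apply: eq_Rintegral => x _; field.
by rewrite RintD ?RintZ//; [lra|exact: bmrZ].
Qed.

Definition csum n (v : Omega) : R := \sum_(1 <= j < n.+1) (g (X j v) - a).

Let bcsum n : bmr (csum n).
Proof. exact: (bmr_psum (hX n) (fun=> bga) (leqnn n)). Qed.

Let bX j (f : T -> R) : bmr f -> bmr (fun v => f (X j v)).
Proof. by move=> hf; exact: (bmr_coordinate (hX j) (leqnn j) hf). Qed.

(* [csum n + h (X n)] is a martingale with increments of variance [s]. *)
Lemma second_moment n :
  \int[P]_v (csum n v + h (X n v)) ^+ 2 = \int[mu]_x h x ^+ 2 + n%:R * s.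
Proof.
have bh2 : bmr (fun x => h x ^+ 2) by exact: bmrX.
elim: n => [|n IH].
  rewrite mul0r addr0 -(Rint_chain 0 bh2); apply: eq_Rintegral => v _.
  by rewrite /csum big_geq// add0r.
have bq : bmr (fun y => (g y - a) + h y) by exact: bmrD.
have bq2 : bmr (fun y => ((g y - a) + h y) ^+ 2) by exact: bmrX.
have c2 : bmr (fun v => csum n v ^+ 2) by exact: bmrX.
(* By the first Poisson equation, pairing [csum n] with the next term [(g - a) + h] amounts to
   pairing it with [h (X n)]. *)
have := @markov_step _ _ _ _ _ _ _ _ _ _ (hX n.+1) n (csum n) _ (ltnSn n)
   (bmr_psum_past X (fun=> bga) (leqnn n)) bq.
have -> : op k (fun y => (g y - a) + h y) = h by apply/funext => x; exact: E1.
move=> e.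
have b1 := bmrM (bcsum n) (bX n.+1 bq).
have b2 := bmrM (bcsum n) (bX n bh).
have b3 := bX n.+1 bq2; have b4 := bX n bh2.
transitivity (\int[P]_v (csum n v ^+ 2 + 2 * (csum n v * ((g (X n.+1 v) - a) + h (X n.+1 v))) +
    ((g (X n.+1 v) - a) + h (X n.+1 v)) ^+ 2)).
  by apply: eq_Rintegral => v _; rewrite /csum big_nat_recr//=; ring.
rewrite (RintD P1 (bmrD c2 (bmrZ 2 b1)) b3) (RintD P1 c2 (bmrZ 2 b1)) (RintZ P1 2 b1) e.
rewrite (Rint_chain n.+1 bq2) stationary_varianceE.
have : \int[P]_v (csum n v + h (X n v)) ^+ 2 =
  \int[P]_v (csum n v ^+ 2) + 2 * \int[P]_v (csum n v * h (X n v)) + \int[P]_v (h (X n v) ^+ 2).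
  rewrite -(RintZ P1 2 b2) -(RintD P1 c2 (bmrZ 2 b2)) -(RintD P1 (bmrD c2 (bmrZ 2 b2)) b4).
  by apply: eq_Rintegral => v _; ring.
rewrite IH (Rint_chain n bh2) -natr1; lra.
Qed.

Lemma variance_csum n :
  fine (variance P (fun v => \sum_(1 <= j < n.+1) g (X j v))) = \int[P]_v csum n v ^+ 2.
Proof.
set S := fun v => _; have bS : bmr S by exact: (bmr_psum (hX n) (fun=> bg) (leqnn n)).
have SE v : S v = csum n v + n%:R * a.
  rewrite /S /csum sumrB big_const_nat subn1 /=.
  by rewrite iter_addr addr0 mulr_natl subrK.
have ES : fine ('E_P[S])%E = n%:R * a.
  rewrite unlock -[LHS]/(\int[P]_v S v) /S.
  have -> : \int[P]_v \sum_(1 <= j < n.+1) g (X j v) = \sum_(1 <= j < n.+1) \int[P]_v g (X j v).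
    by rewrite Rint_sum// => j; exact: bX.
  under eq_bigr do rewrite (Rint_chain _ bg) stationary_mean.
  by rewrite big_const_nat subn1 /= iter_addr addr0 mulr_natl.
rewrite /variance unlock ES unlock -[LHS]/(\int[P]_v _).
apply: eq_Rintegral => v _.
transitivity ((S v - n%:R * a) * (S v - n%:R * a)); first by [].
by rewrite SE; ring.
Qed.

(** Removing [h (X n)] from the martingale [M] produces a cross term, bounded by
    [eps M^2 + h^2 / eps]: a relative error [eps] and an absolute one independent of [n]. *)
Lemma csum_second_moment n (eps B : R) : 0 < eps -> (forall x, `|h x| <= B) ->
  `|\int[P]_v csum n v ^+ 2 - (\int[mu]_x h x ^+ 2 + n%:R * s)| <=
  eps * (\int[mu]_x h x ^+ 2 + n%:R * s) + (eps^-1 + 1) * B ^+ 2.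
Proof.
move=> eps0 hB; have B0 : 0 <= B by apply: le_trans (hB point).
have bM : bmr (fun v => csum n v + h (X n v)) by apply: bmrD => //; exact: bX.
have bM2 : bmr (fun v => (csum n v + h (X n v)) ^+ 2) by exact: bmrX.
have bS2 : bmr (fun v => csum n v ^+ 2) by exact: bmrX.
rewrite -second_moment -(RintB P1 bS2 bM2) -(RintZ P1 _ bM2).
have le_pt v : `|csum n v ^+ 2 - (csum n v + h (X n v)) ^+ 2| <=
    eps * (csum n v + h (X n v)) ^+ 2 + (eps^-1 + 1) * B ^+ 2.
  set M := csum n v + _; set z := h (X n v).
  have -> : csum n v = M - z by rewrite /M /z; ring.
  have zB : z ^+ 2 <= B ^+ 2.
    by rewrite -[z ^+ 2]real_normK ?num_real// lerXn2r ?nnegrE// hB.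
  have z2 := sqr_ge0 z; have ei : 0 < eps^-1 by rewrite invr_gt0.
  have h1 : 0 <= (eps * M - z) ^+ 2 * eps^-1 by rewrite mulr_ge0 ?sqr_ge0// ltW.
  have h2 : 0 <= (eps * M + z) ^+ 2 * eps^-1 by rewrite mulr_ge0 ?sqr_ge0// ltW.
  have e1 : (eps * M - z) ^+ 2 * eps^-1 = eps * M ^+ 2 - 2 * M * z + eps^-1 * z ^+ 2.
    by field; rewrite gt_eqF.
  have e2 : (eps * M + z) ^+ 2 * eps^-1 = eps * M ^+ 2 + 2 * M * z + eps^-1 * z ^+ 2.
    by field; rewrite gt_eqF.
  have h3 : eps^-1 * z ^+ 2 <= eps^-1 * B ^+ 2 by rewrite ler_wpM2l// ltW.
  have -> : (M - z) ^+ 2 - M ^+ 2 = z ^+ 2 - 2 * M * z by ring.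
  by rewrite ler_norml; apply/andP; split; lra.
have bD : bmr (fun v => csum n v ^+ 2 - (csum n v + h (X n v)) ^+ 2) by exact: bmrB.
have bE : bmr (fun v => eps * (csum n v + h (X n v)) ^+ 2) by exact: bmrZ.
have c := bmr_cst (T := Omega) ((eps^-1 + 1) * B ^+ 2).
rewrite -[X in _ + X](Rint_cst P1) -(RintD P1 bE c) ler_norml; apply/andP; split.
  rewrite lerNl -mulN1r -(RintZ P1 _ bD); apply: Rint_le => //.
  - exact: bmrZ.
  - exact: bmrD.
  - by move=> v; have := le_pt v; rewrite ler_norml mulN1r => /andP[]; lra.
apply: Rint_le => //; first exact: bmrD.
by move=> v; apply: le_trans (le_pt v); exact: ler_norm.
Qed.

Lemma asymptotic_varianceE : asymptotic_variance P g X = s.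
Proof.
have [_ [B hB]] := bh; have B0 : 0 <= B by apply: le_trans (hB point).
apply/cvg_lim => //; apply/cvgrPdist_le => e e0.
have bh2 : bmr (fun x => h x ^+ 2) by exact: bmrX.
have H0 : 0 <= \int[mu]_x h x ^+ 2 by apply: Rintegral_ge0 => x _; exact: sqr_ge0.
have HB : \int[mu]_x h x ^+ 2 <= B ^+ 2.
  apply: (le_trans (ler_norm _)); apply: ler_norm_Rint => // x.
  by rewrite normrX lerXn2r ?nnegrE.
have Bs : 0 < B ^+ 2 + `|s| + 1 by rewrite ltr_wpDl// addr_ge0// sqr_ge0.
(* After division by [n] the relative error takes at most [e / 2]; [D] collects the terms that do
   not grow with [n]. *)
pose eps := e / (2 * (B ^+ 2 + `|s| + 1)).
have eps0 : 0 < eps by rewrite divr_gt0// mulr_gt0.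
pose D := (eps^-1 + 1) * B ^+ 2 + B ^+ 2.
have D0 : 0 <= D by rewrite addr_ge0 ?mulr_ge0 ?sqr_ge0// addr_ge0// invr_ge0 ltW.
exists (Num.bound (2 * D / e)).+1 => // n /= nb.
have n0 : 0 < n%:R :> R by rewrite ltr0n; exact: leq_ltn_trans nb.
have nD : D <= n%:R * (e / 2).
  have : 2 * D / e <= n%:R.
    apply: (@le_trans _ _ (Num.bound (2 * D / e))%:R); last by rewrite ler_nat ltnW.
    by rewrite ltW//; apply: le_lt_trans (archi_boundP _) => //; rewrite divr_ge0 ?mulr_ge0// ltW.
  by rewrite ler_pdivrMr//; lra.
have := csum_second_moment n eps0 hB.
rewrite variance_csum; set V := \int[P]_v _; set H := \int[mu]_x _ => hV; rewrite -/H in HB H0.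
have -> : s - n%:R^-1 * V = - (n%:R^-1 * (V - n%:R * s)) by field; rewrite gt_eqF.
rewrite normrN normrM ger0_norm ?invr_ge0 ?(ltW n0)// ler_pdivrMl//.
have -> : V - n%:R * s = (V - (H + n%:R * s)) + H by ring.
rewrite (le_trans (ler_normD _ _))// (ger0_norm H0).
have h1 : eps * (H + n%:R * s) <= n%:R * (e / 2).
  have -> : n%:R * (e / 2) = eps * (n%:R * (B ^+ 2 + `|s| + 1)).
    by rewrite /eps; field; rewrite gt_eqF.
  rewrite ler_wpM2l ?(ltW eps0)// !mulrDr mulr1.
  have n1 : 1 <= n%:R :> R by rewrite ler1n -(ltr0n R).
  have : n%:R * s <= n%:R * `|s| by rewrite ler_wpM2l ?(ltW n0)// ler_norm.
  have : B ^+ 2 <= n%:R * B ^+ 2 by rewrite ler_peMl// sqr_ge0.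
  lra.
rewrite /D in nD; lra.
Qed.

Hypothesis rho : forall t, t != 0 -> (spectral_radius (tw k g t) < 1)%E.

(* If [s <= 0], the centred sums are bounded in mean square, so that their characteristic
   functions stay close to 1 near 0; this contradicts the decay of the iterates of the
   twisted operator. *)
Lemma stationary_variance_gt0 : 0 < s.
Proof.
rewrite ltNge; apply/negP => s0.
have [_ [B hB]] := bh; have B0 : 0 <= B by apply: le_trans (hB point).
have bh2 : bmr (fun x => h x ^+ 2) by exact: bmrX.
have H0 : 0 <= \int[mu]_x h x ^+ 2 by apply: Rintegral_ge0 => x _; exact: sqr_ge0.
have HB : \int[mu]_x h x ^+ 2 <= B ^+ 2.
  apply: (le_trans (ler_norm _)); apply: ler_norm_Rint => // x.
  by rewrite normrX lerXn2r ?nnegrE.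
have B2 : 0 <= B ^+ 2 by exact: sqr_ge0.
have SB n : \int[P]_v csum n v ^+ 2 <= 4 * B ^+ 2.
  have := @csum_second_moment n 1 B ltr01 hB; rewrite invr1 mul1r => /(le_trans (ler_norm _)).
  have : n%:R * s <= 0 by rewrite mulr_ge0_le0.
  lra.
(* With second moments at most [4 B^2], the bound [|t S| <= t (1 + S^2) / 2] keeps the
   characteristic function within [1 / 2] of 1, while the decay puts its modulus below [1 / 4]. *)
pose t := (1 + 4 * B ^+ 2)^-1.
have t0 : 0 < t by rewrite invr_gt0; lra.
have [||||N HN] := @power_decay _ _ _ (tw k g t).
- by move=> F hF; exact: bmC_tw.
- by move=> c F G hF hG; exact: tw_lin.
- by move=> F M hF hM; exact: ler_normc_tw.
- by apply: rho; rewrite gt_eqF.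
have lg : lipf (fun _ : R => g).
  have [_ [M hM]] := bg; exists M; split=> //; first by apply: le_trans (hM point).
  by move=> u v x; rewrite subrr normr0 mulr_ge0//; apply: le_trans (hM point).
have h1 : normc (cintegral P (fun v => eit (t * psum X (fun=> g) N v))) <= 4^-1.
  rewrite (@char_psumE _ _ _ _ _ N P mu (fun=> k) (fun=> g) (fun=> 0) X (hX N) lg)//.
  apply: ler_normc_cint => //.
    have /bmCP[b1 b2] := @bm_prodtw _ _ _ (fun=> k) (fun=> g) lg (fun=> 0) t 0 N _ (bmC_cst 1).
    by apply/bmCP; split; [exact: (bX 0%N b1)|exact: (bX 0%N b2)].
  move=> v; rewrite prodtw_const -[4^-1]mul1r; apply: HN; first exact: bmC_cst.
  by move=> y; rewrite Normc.normc1.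
have bphase : bounded_measurable (fun v => eit (t * csum N v)).
  by apply: bmC_eit; have [m _] := bmrZ t (bcsum N).
have h2 : normc (cintegral P (fun v => eit (t * csum N v))) <= 4^-1.
  have -> : (fun v => eit (t * csum N v)) = fun v => eit (- (t * (N%:R * a))) * eit (t * psum X (fun=> g) N v).
    apply/funext => v; rewrite -eitD; congr eit.
    rewrite /csum /psum sumrB big_const_nat subn1 /= iter_addr addr0 mulr_natl; ring.
  rewrite cintZ//; first by rewrite Normc.normcM normc_eit mul1r.
  apply: bmC_eit; have [m _] := bmrZ t (bmr_psum (hX N) (fun=> bg) (leqnn N)).
  exact: m.
have h3 : normc (cintegral P (fun v => eit (t * csum N v)) - 1) <= 2^-1.
  rewrite -[X in _ - X](cint_cst P1) -cintB//; last exact: bmC_cst.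
  have bS2 : bmr (fun v => csum N v ^+ 2) by exact: bmrX.
  have bf : bmr (fun v => t / 2 * (1 + csum N v ^+ 2)).
    by apply: bmrZ; apply: bmrD => //; exact: bmr_cst.
  apply: (le_trans (ler_normc_cint_fun P1 _ bf _)).
  - by apply: bmCB => //; exact: bmC_cst.
  - move=> v; apply: (le_trans (normc_eitB1 _)); rewrite normrM (gtr0_norm t0).
    rewrite -[leRHS]mulrA ler_wpM2l ?(ltW t0)//.
    have := sqr_ge0 (`|csum N v| - 1); rewrite sqrrB1 real_normK ?num_real//; lra.
  - rewrite RintZ//; last by apply: bmrD => //; exact: bmr_cst.
    rewrite RintD// ?Rint_cst//; last exact: bmr_cst.
    apply: (@le_trans _ _ (t / 2 * (1 + 4 * B ^+ 2))).
      by rewrite ler_wpM2l ?divr_ge0 ?(ltW t0)// lerD2l.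
    rewrite le_eqVlt; apply/orP; left; apply/eqP; rewrite /t; field.
    by rewrite gt_eqF//; lra.
have := ler_normcD (1 - cintegral P (fun v => eit (t * csum N v))) (cintegral P (fun v => eit (t * csum N v))).
rewrite subrK Normc.normc1 normcBC; lra.
Qed.

End stationary_chain.

(** * The Fejer kernel *)

Section lebesgue_helpers.
Context {R : realType}.
Local Notation leb := (@lebesgue_measure R).
Implicit Types (f g F : R -> R).

Lemma Rint_itv_FTC2 F f (a b : R) : a <= b -> (forall x : R, is_derive x 1 F (f x)) ->
  continuous f -> \int[leb]_(x in `[a, b]) f x = F b - F a.
Proof.
rewrite le_eqVlt => /predU1P[->|ab] dF cf.
  by rewrite set_itv1 Rintegral_set1 subrr.
have cF : continuous F.
  by move=> x; apply: differentiable_continuous; apply/derivable1_diffP; exact: ex_derive.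
rewrite /Rintegral (@continuous_FTC2 _ f F)//.
- exact: continuous_subspaceT.
- split.
  + by move=> x _; exact: ex_derive.
  + by apply: cvg_at_right_filter; exact: cF.
  + by apply: cvg_at_left_filter; exact: cF.
- by move=> x _; rewrite derive1E; exact: derive_val.
Qed.

Lemma continuous_itv_integrable f (a b : R) : continuous f ->
  leb.-integrable `[a, b] (EFin \o f).
Proof.
move=> cf; apply: continuous_compact_integrable; first exact: segment_compact.
exact: continuous_subspaceT.
Qed.

Lemma integrable_bounded_by f g : measurable_fun setT f ->
  leb.-integrable setT (EFin \o g) -> (forall x, `|f x| <= g x) ->
  leb.-integrable setT (EFin \o f).
Proof.
move=> mf ig fg; apply: (le_integrable _ _ _ ig) => //; first exact/measurable_EFinP.
by move=> x _; rewrite lee_fin (le_trans (fg x))// ler_norm.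
Qed.

Lemma integrable_inv1Dsqr : leb.-integrable setT (EFin \o (fun x => (1 + x ^+ 2)^-1)).
Proof.
have c : continuous (fun x : R => (1 + x ^+ 2)^-1) by exact: continuous_oneDsqrV.
have p x : 0 <= (1 + x ^+ 2)^-1 :> R by rewrite invr_ge0 addr_ge0// sqr_ge0.
apply/integrableP; split.
  by apply/measurable_EFinP; exact: continuous_measurable_fun.
under eq_integral do rewrite /= ger0_norm//.
rewrite (ge0_symfun_integralT p c); last by move=> x /=; rewrite sqrrN.
by rewrite -set_itvcy (integral0y_oneDsqr R) -EFinM ltry.
Qed.

Lemma lipschitz_continuous f (C : R) : (forall x y, `|f x - f y| <= C * `|x - y|) ->
  continuous f.
Proof.
move=> fC x; apply/cvgrPdist_le => e e0.
have C0 : 0 <= C.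
  by have := fC 1 0; rewrite subr0 normr1 mulr1; apply: le_trans.
have C1 : 0 < C + 1 by rewrite ltr_wpDl.
exists (e / (C + 1)) => /=; first by rewrite divr_gt0.
move=> y /= xy; rewrite (le_trans (fC x y))//.
apply: (@le_trans _ _ ((C + 1) * `|x - y|)).
  by rewrite ler_wpM2r// lerDl.
by rewrite mulrC -ler_pdivlMr// ltW.
Qed.

End lebesgue_helpers.

Section fejer_kernel.
Context {R : realType}.
Local Notation leb := (@lebesgue_measure R).
Implicit Types (T x y : R).

(** Half of the even triangle function: cosine transforms see only [t >= 0], so characteristic
    functions need comparing on [[0, T]] only. Its transform [fej T] is the Fejer kernel
    [(1 - cos (T x)) / (T x^2)], left unnormalised. *)
Definition tent T t : R := (1 - t / T) * \1_`[0, T] t.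
Definition fej T x : R := \int[leb]_t (tent T t * cos (t * x)).

Lemma fej_itv T x : fej T x = \int[leb]_(t in `[0, T]) ((1 - t / T) * cos (t * x)).
Proof.
rewrite [RHS]Rintegral_mkcond; apply: eq_Rintegral => t _.
by rewrite patchE /tent indicE; case: ifPn => _; rewrite ?mulr1// mulr0 mul0r.
Qed.

Lemma tent_ge0 T t : 0 < T -> 0 <= tent T t.
Proof.
move=> T0; rewrite /tent indicE; case: (boolP (_ \in _)); last by rewrite mulr0.
rewrite inE /= in_itv/= => /andP[t0 tT]; rewrite mulr1 subr_ge0.
by rewrite ler_pdivrMr// mul1r.
Qed.

Lemma tent_le T t : 0 < T -> tent T t <= \1_`[0, T] t.
Proof.
move=> T0; rewrite /tent indicE; case: (boolP (_ \in _)); last by rewrite mulr0.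
rewrite inE /= in_itv/= => /andP[t0 tT]; rewrite mulr1 gerBl.
by rewrite divr_ge0// ltW.
Qed.

Lemma measurable_tent T : measurable_fun setT (tent T).
Proof.
apply: measurable_funM; last exact: measurable_indic.
by apply: measurable_funB => //; exact: measurable_funM.
Qed.

Lemma integrable_indic_seg (a b : R) : leb.-integrable setT (EFin \o \1_`[a, b]).
Proof. exact: integrable_indic_itv. Qed.

Lemma integrable_tent T : 0 < T -> leb.-integrable setT (EFin \o tent T).
Proof.
move=> T0; apply: (integrable_bounded_by (measurable_tent T) (integrable_indic_seg 0 T)).
by move=> t; rewrite ger0_norm ?tent_ge0// tent_le.
Qed.

Lemma continuous_fej_integrand T x : continuous (fun t : R => (1 - t / T) * cos (t * x)).
Proof.
move=> t; apply: cvgM; last first.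
  apply: continuous_comp; last exact: continuous_cos.
  by apply: cvgM; [exact: cvg_id|exact: cvg_cst].
by apply: cvgB; [exact: cvg_cst|apply: cvgM; [exact: cvg_id|exact: cvg_cst]].
Qed.

Lemma fej0 T : 0 < T -> fej T 0 = T / 2.
Proof.
move=> T0; have dF (t : R) : is_derive t 1 (fun t => t - t * t * (2 * T)^-1)
    ((1 - t / T) * cos (t * 0)).
  rewrite mulr0 cos0 mulr1; apply: is_derive_eq; rewrite /= /GRing.scale/=; field.
  by rewrite gt_eqF.
rewrite fej_itv (Rint_itv_FTC2 (ltW T0) dF); last exact: continuous_fej_integrand.
by field; rewrite gt_eqF.
Qed.

Lemma fejE T x : 0 < T -> x != 0 -> fej T x = (1 - cos (T * x)) / (T * x ^+ 2).
Proof.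
move=> T0 x0; have dF (t : R) : is_derive t 1 (fun t => (1 - t * T^-1) * sin (t * x) * x^-1
   - cos (t * x) * (T * x ^+ 2)^-1) ((1 - t / T) * cos (t * x)).
  by apply: is_derive_eq; rewrite /= /GRing.scale/=; field; rewrite x0 gt_eqF.
rewrite fej_itv (Rint_itv_FTC2 (ltW T0) dF); last exact: continuous_fej_integrand.
rewrite !mul0r sin0 cos0; field; by rewrite x0 gt_eqF.
Qed.

Lemma fej_ge0 T x : 0 < T -> 0 <= fej T x.
Proof.
move=> T0; have [->|x0] := eqVneq x 0; first by rewrite fej0// divr_ge0// ltW.
rewrite fejE//; apply: divr_ge0; first by rewrite subr_ge0 cos_le1.
by rewrite mulr_ge0 ?sqr_ge0// ltW.
Qed.

Lemma fej_le T x : 0 < T -> fej T x <= T / 2.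
Proof.
move=> T0; have [->|x0] := eqVneq x 0; first by rewrite fej0.
have x2 : 0 < x ^+ 2 by rewrite exprn_even_gt0.
rewrite fejE// ler_pdivrMr ?(mulr_gt0 T0 x2)//.
have := cos_ge (T * x); rewrite exprMn; have -> : T / 2 * (T * x ^+ 2) = T ^+ 2 * x ^+ 2 / 2 by ring.
lra.
Qed.

Lemma fej_le_tail T x : 0 < T -> x != 0 -> fej T x <= 2 / (T * x ^+ 2).
Proof.
move=> T0 x0; rewrite fejE// ler_wpM2r//.
  by rewrite invr_ge0 mulr_ge0 ?sqr_ge0// ltW.
by have := cos_geN1 (T * x); lra.
Qed.

Lemma fej_lip T x y : 0 < T -> `|fej T x - fej T y| <= T ^+ 2 * `|x - y|.
Proof.
move=> T0; pose f (z t : R) := (1 - t / T) * cos (t * z).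
have cf z : continuous (f z) by exact: continuous_fej_integrand.
have cB : continuous (fun t => f x t - f y t).
  by move=> t; apply: cvgB; exact: cf.
rewrite !fej_itv -RintegralB//; try by apply: continuous_itv_integrable; exact: cf.
apply: (le_trans (le_normr_Rintegral _ _)) => //; first by apply: continuous_itv_integrable; exact: cB.
have -> : T ^+ 2 * `|x - y| = \int[leb]_(t in `[0, T]) (T * `|x - y|).
  rewrite Rintegral_cst//= lebesgue_measure_itv/= lte_fin T0 -EFinD /= subr0.
  by ring.
apply: le_Rintegral => //.
- by apply: integrable_norm; apply: continuous_itv_integrable; exact: cB.
- by apply: continuous_itv_integrable => t; exact: cvg_cst.
- move=> t /=; rewrite in_itv/= => /andP[t0 tT]; rewrite -mulrBr normrM.
  rewrite -[leRHS]mul1r ler_pM//.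
    rewrite ger0_norm; last by rewrite subr_ge0 ler_pdivrMr// mul1r.
    by rewrite gerBl divr_ge0// ltW.
  apply: (@le_trans _ _ (normc (eit (t * x) - eit (t * y)))).
    have := ler_Re_normc (eit (t * x) - eit (t * y)).
    by rewrite cReD cReN.
  rewrite (le_trans (eit_lip _ _))// -mulrBr normrM ler_wpM2r// ger0_norm//.
Qed.

Lemma continuous_fej T : 0 < T -> continuous (fej T).
Proof. by move=> T0; apply: lipschitz_continuous => x y; exact: fej_lip. Qed.

Lemma measurable_fej T : 0 < T -> measurable_fun setT (fej T).
Proof. by move=> T0; apply: continuous_measurable_fun; exact: continuous_fej. Qed.

Lemma fej_le_inv1Dsqr T x : 0 < T -> fej T x <= (T + 4 / T) * (1 + x ^+ 2)^-1.
Proof.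
move=> T0; have x1 : 0 < 1 + x ^+ 2 by rewrite ltr_wpDr ?sqr_ge0.
have T4 : 0 < 4 / T by rewrite divr_gt0.
have [xs|xl] := leP (x ^+ 2) 1.
  rewrite ler_pdivlMr//; apply: (@le_trans _ _ (T / 2 * 2)).
    by rewrite ler_pM// ?fej_ge0 ?fej_le//; lra.
  lra.
have x0 : x != 0 by apply/eqP => xE; rewrite xE expr0n/= in xl; lra.
rewrite (le_trans (fej_le_tail T0 x0))// ler_pdivlMr//.
rewrite mulrAC ler_pdivrMr; last by rewrite mulr_gt0//; lra.
have -> : (T + 4 / T) * (T * x ^+ 2) = T ^+ 2 * x ^+ 2 + 4 * x ^+ 2 by field; rewrite gt_eqF.
have : 0 <= T ^+ 2 * x ^+ 2 by rewrite mulr_ge0 ?sqr_ge0.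
lra.
Qed.

Lemma integrable_fej T : 0 < T -> leb.-integrable setT (EFin \o fej T).
Proof.
move=> T0; have ig : leb.-integrable setT (EFin \o (fun x => (T + 4 / T) * (1 + x ^+ 2)^-1)).
  exact: (integrableZl measurableT (T + 4 / T) (integrable_inv1Dsqr)).
apply: (integrable_bounded_by (measurable_fej T0) ig) => x.
by rewrite ger0_norm ?fej_ge0// fej_le_inv1Dsqr.
Qed.

(** Normalising only requires a lower bound on the mass that is uniform in [T]: on [[0, 1 / T]] the
    kernel is at least [T / 4]. *)
Lemma fej_mass_ge T : 0 < T -> 4^-1 <= \int[leb]_x fej T x.
Proof.
move=> T0; have Ti : 0 < T^-1 by rewrite invr_gt0.
have i1 : leb.-integrable setT (EFin \o (fun x => T / 4 * \1_`[0, T^-1] x)).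
  exact: (integrableZl measurableT (T / 4) (integrable_indic_seg 0 T^-1)).
have -> : 4^-1 = \int[leb]_x (T / 4 * \1_`[0, T^-1] x).
  rewrite RintegralZl//; last exact: integrable_indic_seg.
  rewrite Rint_indic//= lebesgue_measure_itv/= lte_fin Ti -EFinD /= subr0.
  by field; rewrite gt_eqF.
apply: le_Rintegral => //; first exact: integrable_fej.
move=> x _; rewrite indicE; case: (boolP (_ \in _)); last by rewrite mulr0 fej_ge0.
rewrite inE /= in_itv/= mulr1 => /andP[x0 xT].
have [->|xn0] := eqVneq x 0; first by rewrite fej0//; lra.
have x2 : 0 < x ^+ 2 by rewrite exprn_even_gt0.
rewrite fejE// ler_pdivlMr ?(mulr_gt0 T0 x2)//.
have Tx : 0 <= T * x <= 1.
  rewrite mulr_ge0//= ?(ltW T0)//.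
  by rewrite mulrC -ler_pdivlMr// mul1r.
have := cos_ge_quartic (T * x); set z := T * x in Tx *.
have -> : T / 4 * (T * x ^+ 2) = z ^+ 2 / 4 by rewrite /z; ring.
have z4 : z ^+ 4 <= z ^+ 2.
  have /andP[? ?] := Tx.
  by rewrite (_ : 4 = 2 + 2)%N// exprD ler_piMr ?sqr_ge0// exprn_ile1.
have := sqr_ge0 z; lra.
Qed.

(* A weight of the order of [1 / (1 + x^2)] whose Fourier transform has compact support. *)
Definition fej2 x : R := fej 1 x + fej 1 (x - 1).

(* [1 - cos x] and [1 - cos (x - 1)] never vanish together. *)
Lemma fej2_ge : exists c : R, 0 < c /\ forall x, c * (1 + x ^+ 2)^-1 <= fej2 x.
Proof.
(* [cos x + cos (x - 1) = 2 cos (1 / 2) cos (x - 1 / 2)] is at most [2 cos (1 / 2)], so the two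
   numerators add up to at least [2 c]. *)
pose c : R := 1 - cos (2^-1); exists c.
have c0 : 0 < c.
  have := cos_ge_quartic (2^-1 : R); rewrite /c; rewrite !exprS expr0; lra.
split=> // x.
have x1 : 0 < 1 + x ^+ 2 by rewrite ltr_wpDr ?sqr_ge0.
have key y : y ^+ 2 <= 2 * (1 + x ^+ 2) -> (1 - cos y) / (2 * (1 + x ^+ 2)) <= fej 1 y.
  move=> yx; have [->|y0] := eqVneq y 0; first by rewrite cos0 subrr mul0r fej_ge0.
  have y2 : 0 < y ^+ 2 by rewrite exprn_even_gt0.
  rewrite fejE// !mul1r ler_wpM2l ?subr_ge0 ?cos_le1//.
  by rewrite lef_pV2 ?posrE// mulr_gt0.
have h1 : x ^+ 2 <= 2 * (1 + x ^+ 2) by have := sqr_ge0 x; lra.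
have h2 : (x - 1) ^+ 2 <= 2 * (1 + x ^+ 2) by have := sqr_ge0 (x + 1); nra.
apply: le_trans (lerD (key _ h1) (key _ h2)).
rewrite -mulrDl (_ : c / _ = (2 * c) / (2 * (1 + x ^+ 2))); last by field; rewrite gt_eqF.
rewrite ler_wpM2r ?invr_ge0 ?mulr_ge0 ?(ltW x1)//.
have e : cos x + cos (x - 1) = 2 * cos (2^-1) * cos (x - 2^-1).
  set z := x - 2^-1; have -> : x - 1 = z - 2^-1 by rewrite /z; field.
  have -> : x = z + 2^-1 by rewrite /z; ring.
  clearbody z.
  by rewrite cosD cosB; ring.
have ch : 0 <= cos (2^-1 : R) by have := cos_ge (2^-1 : R); rewrite !exprS expr0; lra.
have : cos (2^-1) * cos (x - 2^-1) <= cos (2^-1) by rewrite ler_piMr// cos_le1.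
rewrite /c; lra.
Qed.

End fejer_kernel.

Section fubini_bounded.
Context {R : realType} {d : measure_display} {T : measurableType d}.
Variable P : probability T R.
Local Notation leb := (@lebesgue_measure R).

(** Used with [k] a tent, to express means of [fej] by characteristic functions, and with [k] a test
    function, to exchange mean and convolution. *)
Lemma Rint_Fubini (k : R -> R) (h : T * measurableTypeR R -> R) (M : R) :
  leb.-integrable setT (EFin \o k) -> measurable_fun setT h -> (forall p, `|h p| <= M) ->
  leb.-integrable setT (EFin \o (fun t => k t * \int[P]_w h (w, t))) /\
  \int[P]_w \int[leb]_t (k t * h (w, t)) = \int[leb]_t (k t * \int[P]_w h (w, t)).
Proof.
move=> ik mh hM; have P1 : P setT = 1%E by exact: probability_setT.
have [mk _] := integrableP _ _ _ ik; have mk' : measurable_fun setT (k : measurableTypeR R -> R) by exact/measurable_EFinP.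
have mh1 w : measurable_fun setT (fun t => h (w, t)) by exact: measurableT_comp mh (pair1_measurable _).
have mh2 t : measurable_fun setT (fun w => h (w, t)) by exact: measurableT_comp mh (pair2_measurable _).
have bh t : bmr (fun w => h (w, t)) by split; [exact: mh2|exists M => w].
have inorm : leb.-integrable setT (EFin \o (fun t => `|k t| * M)).
  apply: (@integrableZr _ _ _ leb setT measurableT M (EFin \o (fun t => `|k t|))).
  exact: (integrable_norm ik).
have M0 : 0 <= M by exact: le_trans (hM (point, 0)).
have i1 w : leb.-integrable setT (EFin \o (fun t => k t * h (w, t))).
  apply: (integrable_bounded_by _ inorm); first exact: (measurable_funM mk' (mh1 w)).
  by move=> t; rewrite normrM ler_wpM2l.
pose f (p : T * measurableTypeR R) := (k p.2 * h p)%:E.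
have mf : measurable_fun setT f.
  apply/measurable_EFinP; apply: measurable_funM => //.
  exact: measurableT_comp.
have intf : (P \x leb)%E.-integrable setT f.
  apply: (proj2 (@integrable12ltyP _ _ _ _ R P leb f mf)); rewrite /f /=.
  apply: (@le_lt_trans _ _ (\int[P]_x (\int[leb]_t (`|k t| * M))%:E)%E); last first.
    by rewrite integral_cst//= P1 mule1 ltry.
  apply: ge0_le_integral => //.
  - by move=> w _; apply: integral_ge0.
  - apply: (@measurable_fun_fubini_tonelli_F _ _ _ _ _ leb (abse \o f)) => //=.
    exact: measurableT_comp.
  - move=> w _; rewrite /Rintegral fineK ?(integrable_fin_num measurableT inorm)//.
    apply: ge0_le_integral => //.
    + apply/measurable_EFinP; apply: (measurableT_comp (@normr_measurable _ _)).
      exact: measurable_funM.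
    + by case/integrableP: inorm.
    + by move=> t _; rewrite lee_fin normrM ler_wpM2l.
have inner t : (\int[P]_w (k t * h (w, t))%:E)%E = (k t * \int[P]_w h (w, t))%:E.
  rewrite -[LHS]fineK; last first.
    by apply: integrable_fin_num => //; apply: (bmr_integrable P1); exact: bmrZ.
  by congr EFin; rewrite -RintegralZl//; exact: bmr_integrable.
split.
  apply: (integrable_bounded_by _ inorm).
    have := measurable_fubini_G intf; rewrite /fubini_G /f /= => mG.
    apply/measurable_EFinP; move: mG; congr (measurable_fun _ _).
    by apply/funext => t; exact: inner.
  by move=> t; rewrite normrM ler_wpM2l// ler_norm_Rint.
have := Fubini intf; rewrite /f /= => E.
transitivity (fine (\int[P]_w \int[leb]_t (k t * h (w, t))%:E)%E).
  congr fine; apply: eq_integral => w _.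
  by rewrite /Rintegral fineK// (integrable_fin_num measurableT (i1 w)).
by rewrite E; congr fine; apply: eq_integral => t _; exact: inner.
Qed.

End fubini_bounded.

Section whole_line.
Context {R : realType}.
Local Notation leb := (@lebesgue_measure R).
Implicit Types (f F : R -> R).

Lemma integral_shift f (c : R) : continuous f -> (forall x, 0 <= f x) ->
  (\int[leb]_x (f x)%:E = \int[leb]_x (f (x - c))%:E)%E.
Proof.
move=> cf f0; have dF (x : R) : is_derive x 1 (fun x : R => x - c) 1.
  by apply: is_derive_eq; rewrite subr0.
have F1 : ((fun x : R => x - c)^`())%classic = cst 1.
  by apply/funext => x; rewrite derive1E; exact: derive_val.
rewrite (@increasing_ge0_integration_by_substitutionT _ (fun x => x - c))//.
- by apply: eq_integral => x _; rewrite F1 /= mulr1.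
- by move=> x y xy; rewrite ltrD2r.
- by rewrite F1 => x; exact: cvg_cst.
- by rewrite F1; exact: is_cvg_cst.
- by rewrite F1; exact: is_cvg_cst.
- exact: cvg_addrr_Ny.
- exact: cvg_addrr.
Qed.

Lemma Rint_shift f (c : R) : continuous f -> (forall x, 0 <= f x) ->
  \int[leb]_x f (x - c) = \int[leb]_x f x.
Proof. by move=> cf f0; rewrite /Rintegral (integral_shift c cf f0). Qed.

Lemma integrable_shift f (c : R) : continuous f -> (forall x, 0 <= f x) ->
  leb.-integrable setT (EFin \o f) -> leb.-integrable setT (EFin \o (fun x => f (x - c))).
Proof.
move=> cf f0 /integrableP[mf fi]; apply/integrableP; split.
  apply/measurable_EFinP; apply: (measurableT_comp (f := f)); first exact/measurable_EFinP.
  exact: measurable_funB.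
under eq_integral do rewrite /= ger0_norm//.
rewrite -integral_shift//; move: fi; under eq_integral do rewrite /= ger0_norm//.
by [].
Qed.

(** The fundamental theorem of calculus on [[-n, n]], carried to the limit by dominated convergence;
    integer cut-offs are enough. *)
Lemma Rint_derive_line F f :
  (forall x : R, is_derive x 1 F (f x)) -> continuous f ->
  leb.-integrable setT (EFin \o f) ->
  F n%:R @[n --> \oo] --> (0 : R) -> F (- n%:R) @[n --> \oo] --> (0 : R) ->
  \int[leb]_x f x = 0.
Proof.
move=> dF cf iF Fp Fm.
pose D n : set R := [set` `[- n%:R, n%:R]].
pose fn n x : \bar R := (f x * \1_(D n) x)%:E.
have mf : measurable_fun setT f by exact: continuous_measurable_fun.
have [_ _ lim] : [/\ leb.-integrable setT (EFin \o f),
    (\int[leb]_x `|fn n x - (f x)%:E|)%E @[n --> \oo] --> 0%E &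
    (\int[leb]_x fn n x)%E @[n --> \oo] --> (\int[leb]_x (f x)%:E)%E].
  apply: (@dominated_convergence _ _ _ leb setT measurableT fn (EFin \o f)
    (EFin \o (fun x => `|f x|))).
  - move=> n; apply/measurable_EFinP; apply: measurable_funM => //.
    by apply: measurable_indic; exact: measurable_itv.
  - exact/measurable_EFinP.
  - apply: aeW => x _; apply: cvg_near_cst.
    near=> n; rewrite /fn indicE mem_set ?mulr1//=.
    rewrite /D /= in_itv/= -ler_norml.
    near: n; exact: nbhs_infty_ger.
  - exact: (integrable_norm iF).
  - apply: aeW => x n _; rewrite lee_fin normrM indicE.
    by case: (_ \in _); rewrite ?normr1 ?normr0 ?mulr1 ?mulr0.
have E n : (\int[leb]_x fn n x)%E = (F n%:R - F (- n%:R))%:E.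
  have nn : - n%:R <= n%:R :> R by rewrite ge0_cp.
  rewrite -(Rint_itv_FTC2 nn dF cf) /Rintegral fineK; last first.
    by apply: integrable_fin_num => //; exact: continuous_itv_integrable.
  rewrite [RHS]integral_mkcond; apply: eq_integral => x _.
  by rewrite patchE /fn indicE; case: ifPn; rewrite ?mulr1 ?mulr0.
have c0 : (F n%:R - F (- n%:R))%:E @[n --> \oo] --> (0 : R)%:E.
  apply: cvg_EFin; first by near=> n.
  rewrite -[0 : R]subr0; exact: (cvgB Fp Fm).
rewrite /Rintegral; suff -> : (\int[leb]_x (f x)%:E = 0)%E by [].
apply: (cvg_unique _ lim); first exact: ereal_hausdorff.
by rewrite (_ : (fun n => _) = fun n => (F n%:R - F (- n%:R))%:E)//; apply/funext => n; exact: E.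
Unshelve. all: by end_near.
Qed.

End whole_line.

(** * Characteristic function of normal laws *)

Section gaussian.
Context {R : realType}.
Local Notation leb := (@lebesgue_measure R).
Variables (m s : R).
Hypothesis s0 : 0 < s.
Local Notation pdf := (normal_pdf m s).

Let s_neq0 : s != 0. Proof. exact: lt0r_neq0. Qed.

Lemma normal_pdf_prod x : pdf x = normal_peak s * normal_fun m s x.
Proof. by rewrite normal_pdfE. Qed.

Lemma is_derive_normal_pdf (x : R) :
  is_derive x 1 pdf (- ((x - m) / s ^+ 2 * pdf x)).
Proof.
rewrite normal_pdfE// /normal_fun; apply: is_derive_eq.
rewrite /GRing.scale/=; set e := expR _; move: e (normal_peak s) => e p.
by field; exact: s_neq0.
Qed.

(** A quarter of the exponent is kept for the law of deviation [2 s]; the other three quarters beat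
    the linear factor through [1 + y <= e^y]. This supplies the majorant for differentiating under
    the integral. *)
Lemma normal_fun_moment x : `|x - m| * normal_fun m s x <= s * normal_fun m (2 * s) x.
Proof.
rewrite /normal_fun; set z := x - m; pose w := z ^+ 2 / (8 * s ^+ 2).
have s2 : 0 < s ^+ 2 by rewrite exprn_gt0.
have -> : - z ^+ 2 / (s ^+ 2 *+ 2) = - (3 * w) - w.
  by rewrite /w -mulr_natr; field; exact: s_neq0.
have -> : - z ^+ 2 / ((2 * s) ^+ 2 *+ 2) = - w.
  by rewrite /w -mulr_natr; field; exact: s_neq0.
rewrite expRD mulrA ler_wpM2r ?expR_ge0// expRN ler_pdivrMr ?expR_gt0//.
apply: (@le_trans _ _ (s * (1 + 3 * w))); last by rewrite ler_wpM2l ?expR_ge1Dx// ltW.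
rewrite -(ler_pM2l s0) mulrA -expr2 (_ : s ^+ 2 * (1 + 3 * w) = s ^+ 2 + 3 / 8 * `|z| ^+ 2).
  have := sqr_ge0 (s - `|z| / 2); have := sqr_ge0 (`|z|); rewrite !expr2; lra.
by rewrite real_normK ?num_real// /w; field; exact: s_neq0.
Qed.

Lemma normal_pdf_moment x : `|x - m| * pdf x <= s * normal_peak s.
Proof.
rewrite normal_pdf_prod mulrCA [leRHS]mulrC ler_wpM2l ?normal_peak_ge0//.
rewrite (le_trans (normal_fun_moment x))// ler_piMr ?(ltW s0)//.
rewrite /normal_fun -[leRHS]expR0 ler_expR mulNr oppr_le0 divr_ge0 ?sqr_ge0//.
by rewrite mulrn_wge0// sqr_ge0.
Qed.

Let dom x := s * normal_peak s / normal_peak (2 * s) * normal_pdf m (2 * s) x.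

Let pdf_dom x : `|x - m| * pdf x <= dom x.
Proof.
have s2 : 2 * s != 0 by rewrite mulf_neq0.
rewrite /dom normal_pdf_prod normal_pdfE// mulrCA -!mulrA [leRHS]mulrCA ler_wpM2l ?normal_peak_ge0//.
rewrite mulKf ?normal_fun_moment// gt_eqF// normal_peak_gt0//.
Qed.

Let integrable_dom : leb.-integrable setT (EFin \o dom).
Proof. exact: (integrableZl measurableT _ (integrable_normal_pdf m (2 * s))). Qed.

Lemma Rint_normal_pdf : \int[leb]_x pdf x = 1.
Proof. by rewrite /Rintegral integral_normal_pdf. Qed.

Lemma integrable_normal_pdfM (f : R -> R) : bmr (f : measurableTypeR R -> R) ->
  leb.-integrable setT (EFin \o (fun x => pdf x * f x)).
Proof.
move=> [mf [M hM]]; have i1 : leb.-integrable setT (EFin \o (fun x => M * pdf x)).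
  exact: (integrableZl measurableT M (integrable_normal_pdf m s)).
apply: (integrable_bounded_by _ i1).
  by apply: measurable_funM => //; exact: measurable_normal_pdf.
move=> x; rewrite normrM mulrC (ger0_norm (normal_pdf_ge0 _ _ _)).
by rewrite ler_wpM2r ?normal_pdf_ge0.
Qed.

Lemma Rint_normal_prob (f : R -> R) : bmr (f : measurableTypeR R -> R) ->
  \int[normal_prob m s]_x f x = \int[leb]_x (pdf x * f x).
Proof.
have P1 : normal_prob m s setT = 1%E by exact: probability_setT.
move: f; apply: (@bmr_functional_ext R _ (measurableTypeR R)
  (fun f => \int[normal_prob m s]_x f x) (fun f => \int[leb]_x (pdf x * f x)) 1).
- by move=> a f g hf hg; rewrite RintD ?RintZ//; exact: bmrZ.
- move=> a f g hf hg; have hf' := bmrZ a hf.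
  rewrite -RintegralZl//; last exact: integrable_normal_pdfM.
  rewrite -RintegralD//; last 2 first.
  + exact: (integrableZl measurableT a (integrable_normal_pdfM hf)).
  + exact: integrable_normal_pdfM.
  by apply: eq_Rintegral => x _; ring.
- by move=> f M hf hM; rewrite mul1r; exact: ler_norm_Rint.
- move=> f M hf hM; rewrite mul1r.
  apply: le_trans (le_normr_Rintegral _ _) _ => //; first exact: integrable_normal_pdfM.
  rewrite -[leRHS]mulr1 -Rint_normal_pdf -RintegralZl//; last exact: integrable_normal_pdf.
  apply: le_Rintegral => //.
  + by apply: integrable_norm; exact: integrable_normal_pdfM.
  + exact: (integrableZl measurableT M (integrable_normal_pdf m s)).
  + move=> x _; rewrite normrM mulrC (ger0_norm (normal_pdf_ge0 _ _ _)).
    by rewrite ler_wpM2r ?normal_pdf_ge0.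
- move=> A mA; rewrite Rint_indic// /normal_prob /Rintegral; congr fine.
  rewrite [LHS]integral_mkcond; apply: eq_integral => x _.
  by rewrite patchE indicE; case: (x \in A); rewrite ?mulr1 ?mulr0.
Qed.

Section characteristic_function.
Variable q : R.
Let c t x := pdf x * cos (t * (x - m) + q).
Let c' t x := - ((x - m) * pdf x * sin (t * (x - m) + q)).

Let phase_meas t : measurable_fun setT (fun x : measurableTypeR R => t * (x - m) + q).
Proof. by apply: measurable_funD => //; apply: measurable_funM => //; exact: measurable_funB. Qed.

Let integrable_c t : leb.-integrable setT (EFin \o c t).
Proof. by apply: integrable_normal_pdfM; apply: bmr_cos; exact: phase_meas. Qed.

Let dc (t x : R) : is_derive t 1 (c ^~ x) (c' t x).
Proof. by rewrite /c /c'; apply: is_derive_eq; rewrite /GRing.scale/=; ring. Qed.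

Let c'E t x : partial1of2 c t x = c' t x.
Proof. by rewrite partial1of2E; apply: derive_val. Qed.

Let c'_dom t x : `|c' t x| <= dom x.
Proof.
rewrite /c' normrN !normrM (ger0_norm (normal_pdf_ge0 _ _ _)).
apply: le_trans (pdf_dom x); rewrite ler_piMr//.
  by rewrite mulr_ge0// normal_pdf_ge0.
by rewrite ler_norml sin_geN1 sin_le1.
Qed.

Let C t := \int[leb]_x c t x.

Let dC (t : R) : is_derive t 1 C (\int[leb]_x c' t x).
Proof.
have Ia : `]t - 1, t + 1[%classic t by rewrite /= in_itv/=; apply/andP; split; lra.
have intc x : `]t - 1, t + 1[%classic x -> leb.-integrable setT (EFin \o c x).
  by move=> _; exact: integrable_c.
have der (x y : R) : `]t - 1, t + 1[%classic x -> setT y -> derivable (c ^~ y) x 1.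
  by move=> _ _; exact: (@ex_derive _ _ _ _ _ _ _ (dc x y)).
have dom0 y : 0 <= dom y by apply: le_trans (c'_dom t y).
have ub (x y : R) : `]t - 1, t + 1[%classic x -> setT y -> `|partial1of2 c x y| <= dom y.
  by move=> _ _; rewrite c'E.
apply: DeriveDef.
  exact: (derivable_under_integral measurableT Ia intc der dom0 integrable_dom ub).
rewrite -derive1E.
rewrite (differentiation_under_integral measurableT Ia intc der dom0 integrable_dom ub).
by apply: eq_Rintegral => x _; exact: c'E.
Qed.

(** Integration by parts based on [pdf' = - (x - m) / s^2 pdf]: the function [F] tends to 0 along
    the integers because [|x| pdf] is bounded, so its derivative has integral 0. *)
Let c'_int t : \int[leb]_x c' t x = - (s ^+ 2 * t * C t).
Proof.
pose F x := pdf x * sin (t * (x - m) + q).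
pose f x := (s ^+ 2)^-1 * c' t x + t * c t x.
have dp (x : R) := is_derive_normal_pdf x.
have dF (x : R) : is_derive x 1 F (f x).
  rewrite /F /f /c' /c; apply: is_derive_eq.
  rewrite /GRing.scale/=; set sn := sin _; set cs := cos _; move: sn cs (pdf x) => sn cs p.
  by field; exact: s_neq0.
have derivable_continuous (h : R -> R) : (forall x : R, derivable h x 1) -> continuous h.
  by move=> dh x; apply: differentiable_continuous; apply/derivable1_diffP; exact: dh.
have cc : continuous (c t).
  by apply: derivable_continuous => x; rewrite /c; exact: ex_derive.
have cc' : continuous (c' t).
  by apply: derivable_continuous => x; rewrite /c'; exact: ex_derive.
have ic' : leb.-integrable setT (EFin \o c' t).
  apply: (integrable_bounded_by _ integrable_dom) => //.
  exact: continuous_measurable_fun.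
have i1 : leb.-integrable setT (EFin \o (fun x => (s ^+ 2)^-1 * c' t x)).
  exact: (integrableZl measurableT _ ic').
have i2 : leb.-integrable setT (EFin \o (fun x => t * c t x)).
  exact: (integrableZl measurableT _ (integrable_c t)).
pose K := s * normal_peak s + (`|m| + 1) * normal_peak s.
have FK x : `|F x| * (`|x| + 1) <= K.
  rewrite /F normrM (ger0_norm (normal_pdf_ge0 _ _ _)).
  apply: (@le_trans _ _ (pdf x * (`|x - m| + (`|m| + 1)))).
    apply: ler_pM; rewrite ?mulr_ge0 ?normal_pdf_ge0 ?addr_ge0//.
      by rewrite ler_piMr ?normal_pdf_ge0// ler_norml sin_geN1 sin_le1.
    by rewrite addrA lerD2r -[X in `|X| <= _](subrK m) ler_normD.
  rewrite mulrDr lerD//; first by rewrite mulrC normal_pdf_moment.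
  by rewrite mulrC ler_wpM2l ?normal_pdf_ub// addr_ge0.
have lim (e : nat -> R) : (forall n, `|e n| = n%:R) -> F (e n) @[n --> \oo] --> (0 : R).
  move=> en; apply/norm_cvg0P; apply: (@squeeze_cvgr _ _ _ _ (fun=> 0) (fun n => K * harmonic n)).
  - apply: nearW => n; rewrite normr_ge0/= /harmonic ler_pdivlMr//.
    by rewrite -natr1 -en; exact: FK.
  - exact: cvg_cst.
  - rewrite -[X in _ --> X](mulr0 K); apply: cvgM; first exact: cvg_cst.
    exact: cvg_harmonic.
have : \int[leb]_x f x = 0.
  apply: (Rint_derive_line dF).
  - by move=> x; apply: cvgD; (apply: cvgM; [exact: cvg_cst|]); [exact: cc'|exact: cc].
  - exact: (integrableD measurableT i1 i2).
  - by apply: lim => n; rewrite normr_nat.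
  - by apply: lim => n; rewrite normrN normr_nat.
rewrite /f RintegralD// !RintegralZl// -/(C t) => E.
have s2 : s ^+ 2 != 0 by rewrite expf_neq0.
apply: (mulfI (invr_neq0 s2)); apply/eqP; rewrite -subr_eq0 -E; apply/eqP; field.
exact: s_neq0.
Qed.

(** The integral satisfies [C' = - s^2 t C], so [C] times [e^(s^2 t^2 / 2)] is constant. The free
    phase [q] lets one computation serve for cosine and sine. *)
Lemma Rint_normal_pdf_cos t :
  \int[leb]_x (pdf x * cos (t * (x - m) + q)) = cos q * expR (- ((s * t) ^+ 2 / 2)).
Proof.
pose H t := C t * expR (s ^+ 2 / 2 * (t * t)).
have dH (u : R) : is_derive u 1 H 0.
  have := dC u; rewrite c'_int => dCu; rewrite /H; apply: is_derive_eq.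
  rewrite /GRing.scale/=; set e := expR _; by move: e (C u) => e z; field.
have := is_derive_0_is_cst t 0 dH; rewrite /H !mulr0 expR0 mulr1.
have -> : C 0 = cos q.
  rewrite /C /c; under eq_Rintegral do rewrite mul0r add0r.
  by rewrite RintegralZr ?Rint_normal_pdf ?mul1r//; exact: integrable_normal_pdf.
move=> <-; rewrite -(mulrA (C t)) -[X in _ * X]expRD.
have -> : s ^+ 2 / 2 * (t * t) + - ((s * t) ^+ 2 / 2) = 0 by field.
by rewrite expR0 mulr1.
Qed.
End characteristic_function.

Lemma cintegral_normal_eit t :
  cintegral (normal_prob m s) (fun x => eit (t * x)) =
  eit (t * m) * (expR (- ((s * t) ^+ 2 / 2)))%:C%C.
Proof.
have mt : measurable_fun setT (fun x : measurableTypeR R => t * x).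
  by apply: measurable_funM.
apply: complexP => /=; rewrite !Rint_normal_prob ?mulr0 ?subr0 ?add0r//.
- rewrite -(Rint_normal_pdf_cos (t * m) t).
  by apply: eq_Rintegral => x _; congr (_ * cos _); ring.
- exact: bmr_cos.
- rewrite (_ : sin (t * m) = cos (t * m - pi / 2)); last first.
    by rewrite cosB cos_pihalf sin_pihalf mulr0 mulr1 add0r.
  rewrite -(Rint_normal_pdf_cos (t * m - pi / 2) t).
  apply: eq_Rintegral => x _; congr (_ * _).
  have -> : t * (x - m) + (t * m - pi / 2) = t * x - pi / 2 by ring.
  by rewrite cosB cos_pihalf sin_pihalf mulr0 mulr1 add0r.
- exact: bmr_sin.
Qed.

Lemma normal_prob_mean_le (f : R -> R) : bmr (f : measurableTypeR R -> R) ->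
  leb.-integrable setT (EFin \o f) -> (forall x, 0 <= f x) ->
  \int[normal_prob m s]_x f x <= normal_peak s * \int[leb]_x f x.
Proof.
move=> bf fi f0; rewrite Rint_normal_prob// -RintegralZl//.
apply: le_Rintegral => //; first exact: integrable_normal_pdfM.
  exact: (integrableZl measurableT _ fi).
by move=> x _; rewrite ler_wpM2r// normal_pdf_ub.
Qed.

Lemma normal_prob_mean_flat (f : R -> R) : bmr (f : measurableTypeR R -> R) ->
  leb.-integrable setT (EFin \o f) ->
  (normal_peak s)^-1 * \int[normal_prob m s]_x f x = \int[leb]_x (normal_fun m s x * f x).
Proof.
move=> bf fi; rewrite Rint_normal_prob// -RintegralZl//; last exact: integrable_normal_pdfM.
apply: eq_Rintegral => x _; rewrite normal_pdf_prod -mulrA mulKf//.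
by rewrite gt_eqF// normal_peak_gt0.
Qed.

End gaussian.

(** * Smoothing by the Fejer kernel *)

Section approximation.
Context {R : realType}.
Local Notation leb := (@lebesgue_measure R).
Implicit Types (T x y : R) (G : R -> R).

Lemma fejN T x : fej T (- x) = fej T x.
Proof. by apply: eq_Rintegral => t _; rewrite mulrN cosN. Qed.

Lemma compact_support_cut G : compact (closure [set x | G x != 0]) ->
  exists rho : R, 1 <= rho /\ forall x, rho < `|x| -> G x = 0.
Proof.
move=> /compact_bounded[M [_ hM]]; exists (Num.max 1 (M + 1)); split.
  by rewrite le_max lexx.
move=> x; rewrite gt_max => /andP[_ hx]; apply/eqP/negPn/negP => Gx.
have := hM (M + 1) _ x (@subset_closure _ [set x | G x != 0] x Gx); rewrite ltrDl ltr01 => /(_ isT) h.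
by move: (lt_le_trans hx h); rewrite ltxx.
Qed.

Section compactly_supported.
Variables (G : R -> R) (rho : R).
Hypotheses (cG : continuous G) (rho1 : 1 <= rho) (G0 : forall x, rho < `|x| -> G x = 0).

Lemma compact_support_bound : exists M : R, 0 <= M /\ forall x, `|G x| <= M.
Proof.
have rr : - rho <= rho by have := rho1; lra.
have cn : {within `[- rho, rho], continuous (fun x => `|G x|)}.
  apply: continuous_subspaceT => x; apply: (continuous_comp (@cG x)).
  exact: norm_continuous.
have [c _ hc] := EVT_max rr cn; exists `|G c|; split=> // x.
have [xr|rx] := leP `|x| rho; last by rewrite (G0 rx) normr0.
by apply: hc; rewrite in_itv/= -ler_norml.
Qed.

Lemma compact_support_unif (e : R) : 0 < e ->
  exists del : R, 0 < del /\ forall x y, `|x - y| <= del -> `|G x - G y| <= e.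
Proof.
move=> e0; pose K := [set` `[- (rho + 1), rho + 1]].
pose P (n : nat) (x : R) := forall y, `|x - y| <= (n.+1%:R)^-1 -> `|G x - G y| <= e.
have cK : compact K by exact: segment_compact.
have /compact_near_coveringP/(_ nat \oo P) := cK; case.
  move=> x Kx; have e2 : 0 < e / 2 by rewrite divr_gt0.
  have /cvgrPdist_le/(_ _ e2)[d /= d0 hd] := @cG x.
  have d2 : 0 < d / 2 by rewrite divr_gt0.
  near_simpl; exists (ball x (d / 2), [set n | (n.+1%:R)^-1 < d / 2 :> R]).
    split; first exact: nbhsx_ballx.
    exact: near_infty_natSinv_lt (PosNum d2).
  move=> [x' n] [/= bx nd] y xy.
  rewrite (splitr e) -(subrK (G x) (G x')) -addrA (le_trans (ler_normD _ _))// lerD//.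
    by rewrite distrC; apply: hd; rewrite /ball/= (lt_trans bx)//; lra.
  apply: hd; rewrite /ball/= (splitr d) -(subrK x' x) -addrA.
  by rewrite (le_lt_trans (ler_normD _ _))// ltrD// (le_lt_trans xy).
move=> N _ HN; exists (N.+1%:R)^-1; split; first by rewrite invr_gt0.
move=> x y xy; have [Kx|Kx] := pselect (K x); first exact: (HN N (leqnn N) x Kx y xy).
have xr : rho + 1 < `|x| by rewrite ltNge; apply/negP => h; apply: Kx; rewrite /K/= in_itv/= -ler_norml.
have N1 : (N.+1%:R)^-1 <= 1 :> R by rewrite invf_le1// ler1n.
have xy1 := le_trans xy N1.
have yr : rho < `|y| by have := lerB_dist x y; lra.
by rewrite (G0 yr) G0 ?subrr ?normr0 ?(ltW e0)//; lra.
Unshelve. all: by end_near.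
Qed.

Lemma compact_support_integrable : leb.-integrable setT (EFin \o G).
Proof.
have [M [M0 hM]] := compact_support_bound.
have i1 : leb.-integrable setT (EFin \o (fun x => M * \1_`[- rho, rho] x)).
  exact: (integrableZl measurableT M (integrable_indic_seg (- rho) rho)).
apply: (integrable_bounded_by _ i1); first exact: continuous_measurable_fun.
move=> x; have [xr|rx] := leP `|x| rho.
  by rewrite indicE mem_set ?mulr1//= in_itv/= -ler_norml.
by rewrite (G0 rx) normr0 mulr_ge0.
Qed.

Section smoothing.
Variable T : R.
Hypothesis T0 : 0 < T.

Lemma fej_shiftE x : (fun y => fej T (x - y)) = (fun y => fej T (y - x)).
Proof. by apply/funext => y; rewrite -fejN opprB. Qed.

Lemma integrable_fej_shift x : leb.-integrable setT (EFin \o (fun y => fej T (x - y))).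
Proof.
rewrite fej_shiftE; apply: (integrable_shift x (continuous_fej T0)).
  by move=> z; exact: fej_ge0.
exact: integrable_fej.
Qed.

Lemma Rint_fej_shift x : \int[leb]_y fej T (x - y) = \int[leb]_y fej T y.
Proof.
rewrite fej_shiftE; apply: (Rint_shift x (continuous_fej T0)).
by move=> z; exact: fej_ge0.
Qed.

Lemma integrable_fej_conv x : leb.-integrable setT (EFin \o (fun y => G y * fej T (x - y))).
Proof.
have [M [M0 hM]] := compact_support_bound.
apply: (@integrable_bounded_by _ _ (fun y => M * fej T (x - y))).
- apply: measurable_funM; first exact: continuous_measurable_fun.
  by apply: (measurableT_comp (measurable_fej T0)); exact: measurable_funB.
- exact: (integrableZl measurableT M (integrable_fej_shift x)).
- by move=> y; rewrite normrM (ger0_norm (fej_ge0 _ T0)) ler_wpM2r// fej_ge0.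
Qed.

Lemma inv1Dsqr_shift x :
  leb.-integrable setT (EFin \o (fun y => (1 + (y - x) ^+ 2)^-1)) /\
  \int[leb]_y (1 + (y - x) ^+ 2)^-1 = \int[leb]_y (1 + y ^+ 2)^-1.
Proof.
have c : continuous (fun x : R => (1 + x ^+ 2)^-1) by exact: continuous_oneDsqrV.
have p y : 0 <= (1 + y ^+ 2)^-1 :> R by rewrite invr_ge0 addr_ge0// sqr_ge0.
split; first exact: (integrable_shift x c p (@integrable_inv1Dsqr R)).
exact: (Rint_shift x c p).
Qed.

Lemma fej_away (del z : R) : 0 < del -> del < `|z| ->
  fej T z <= 2 * (1 + (del ^+ 2)^-1) / T * (1 + z ^+ 2)^-1.
Proof.
move=> del0 dz; have d2 : 0 < del ^+ 2 by rewrite exprn_gt0.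
have zn : z != 0 by rewrite -normr_gt0 (lt_trans del0).
have dz2 : del ^+ 2 <= z ^+ 2.
  by rewrite -[leRHS]real_normK ?num_real// ler_sqr ?nnegrE ?normr_ge0 ?ltW.
have z2 : 0 < z ^+ 2 by apply: lt_le_trans dz2.
apply: (le_trans (fej_le_tail T0 zn)).
rewrite (_ : 2 * (1 + _) / T * _ = 2 / T * ((1 + (del ^+ 2)^-1) / (1 + z ^+ 2))); last by ring.
have -> : 2 / (T * z ^+ 2) = 2 / T * (z ^+ 2)^-1 by field; rewrite zn gt_eqF.
apply: ler_wpM2l; first by rewrite divr_ge0// ltW.
rewrite ler_pdivlMr; last by lra.
rewrite mulrDr mulr1 mulVf ?gt_eqF// addrC lerD2l.
by rewrite lef_pV2.
Qed.

Lemma fej_approx_near (w del M x : R) : 0 < del -> 0 <= w ->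
  (forall y, `|x - y| <= del -> `|G x - G y| <= w) -> (forall y, `|G y| <= M) ->
  `|(\int[leb]_z fej T z) * G x - \int[leb]_y (G y * fej T (x - y))| <=
  w * (\int[leb]_z fej T z) +
  2 * M * (2 * (1 + (del ^+ 2)^-1) / T) * \int[leb]_y (1 + y ^+ 2)^-1.
Proof.
move=> del0 w0 hw hM; have M0 : 0 <= M by apply: le_trans (hM 0).
have ifs := integrable_fej_shift x; have [iv <-] := inv1Dsqr_shift x.
have f0 y := fej_ge0 y T0.
rewrite -!(Rint_fej_shift x).
have -> : (\int[leb]_y fej T (x - y)) * G x - \int[leb]_y (G y * fej T (x - y)) =
     \int[leb]_y ((G x - G y) * fej T (x - y)).
  have iG := integrable_fej_conv x.
  have iGx : leb.-integrable setT (EFin \o (fun y => G x * fej T (x - y))).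
    exact: (integrableZl measurableT _ ifs).
  rewrite mulrC -(RintegralZl _ measurableT ifs)// -(RintegralB measurableT iGx iG)//.
  by apply: eq_Rintegral => y _; ring.
set A := 2 * M * _.
have A0 : 0 <= A.
  apply: mulr_ge0; first by rewrite mulr_ge0.
  apply: divr_ge0; last exact: ltW.
  by apply: mulr_ge0 => //; rewrite addr_ge0// invr_ge0 sqr_ge0.
have AE z : A * z = 2 * M * (2 * (1 + (del ^+ 2)^-1) / T * z) by rewrite /A; ring.
clearbody A.
have i1 : leb.-integrable setT (EFin \o (fun y => w * fej T (x - y))).
  exact: (integrableZl measurableT _ ifs).
have i2 : leb.-integrable setT (EFin \o (fun y => A * (1 + (y - x) ^+ 2)^-1)).
  exact: (integrableZl measurableT _ iv).
pose B y := w * fej T (x - y) + A * (1 + (y - x) ^+ 2)^-1.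
have iB : leb.-integrable setT (EFin \o B) by exact: (integrableD measurableT i1 i2).
rewrite -(RintegralZl _ measurableT ifs)// -(RintegralZl _ measurableT iv)// -(RintegralD measurableT i1 i2)// -/(\int[leb]_y B y).
have dB y : `|(G x - G y) * fej T (x - y)| <= B y.
  have v0 : 0 <= A * (1 + (y - x) ^+ 2)^-1.
    by apply: mulr_ge0 => //; rewrite invr_ge0 addr_ge0// sqr_ge0.
  have u0 : 0 <= w * fej T (x - y) by exact: mulr_ge0.
  rewrite normrM (ger0_norm (f0 _)) /B.
  have [xy|yx] := leP `|x - y| del.
    by apply: (@le_trans _ _ (w * fej T (x - y))); [rewrite ler_wpM2r// hw|rewrite lerDl].
  apply: (@le_trans _ _ (A * (1 + (y - x) ^+ 2)^-1)); last by rewrite lerDr.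
  rewrite AE (_ : (y - x) ^+ 2 = (x - y) ^+ 2); last by ring.
  apply: ler_pM => //; last exact: fej_away.
  by rewrite (le_trans (ler_normB _ _))//; have := hM x; have := hM y; lra.
have mB : measurable_fun setT (fun y => (G x - G y) * fej T (x - y)).
  apply: measurable_funM.
    by apply: measurable_funB => //; exact: continuous_measurable_fun.
  by apply: (measurableT_comp (measurable_fej T0)); exact: measurable_funB.
have iD := integrable_bounded_by mB iB dB.
apply: (le_trans (le_normr_Rintegral measurableT iD)).
by apply: le_Rintegral => //; exact: (integrable_norm iD).
Qed.

(** Far from the support the error is the convolution itself and must decay like [1 / x^2] to stay
    below the weight; it does, since [|x - y| >= |x| / 2] for [y] in [[-rho, rho]]. *)
Lemma fej_approx_far x : 2 * rho < `|x| ->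
  `|\int[leb]_y (G y * fej T (x - y))| <=
  16 / T * (\int[leb]_y `|G y|) * (1 + x ^+ 2)^-1.
Proof.
move=> rx; have r1 := rho1; pose b := 16 / T * (1 + x ^+ 2)^-1.
have x2 : 0 < 1 + x ^+ 2 by rewrite ltr_wpDr ?sqr_ge0.
have iN : leb.-integrable setT (EFin \o (fun y => `|G y|)).
  exact: (integrable_norm compact_support_integrable).
rewrite mulrAC -/b -(RintegralZl _ measurableT iN)//.
have dB y : `|G y * fej T (x - y)| <= b * `|G y|.
  rewrite normrM (ger0_norm (fej_ge0 _ T0)) mulrC.
  have [yr|ry] := leP `|y| rho; last by rewrite (G0 ry) normr0 !mulr0.
  apply: ler_wpM2r => //.
  have xy : `|x| / 2 <= `|x - y| by have := lerB_dist x y; lra.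
  have xyn : x - y != 0 by rewrite -normr_gt0; lra.
  apply: (le_trans (fej_le_tail T0 xyn)).
  have h : (1 + x ^+ 2) / 8 <= (x - y) ^+ 2.
    rewrite -[(x - y) ^+ 2]real_normK ?num_real// -[x ^+ 2]real_normK ?num_real//.
    by have := normr_ge0 x; nra.
  have h0 : 0 < (x - y) ^+ 2 by apply: lt_le_trans h; rewrite divr_gt0.
  rewrite /b (_ : 16 / T / (1 + x ^+ 2) = 2 / (T * ((1 + x ^+ 2) / 8))); last first.
    by field; rewrite (gt_eqF T0) gt_eqF.
  apply: ler_wpM2l => //; rewrite lef_pV2 ?posrE; last 2 first.
  - exact: (mulr_gt0 T0 h0).
  - by apply: mulr_gt0 => //; exact: divr_gt0.
  by rewrite ler_pM2l.
have iG := integrable_fej_conv x.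
apply: (le_trans (le_normr_Rintegral measurableT iG)); apply: le_Rintegral => //.
  exact: (integrable_norm iG).
exact: (integrableZl measurableT _ iN).
Qed.
End smoothing.

(* The error is measured against [fej2], whose expectations under two laws are again compared
   through their characteristic functions on a compact interval. *)
Lemma fej_approx (eta : R) : 0 < eta ->
  exists T, 0 < T /\ forall x,
    `|G x - (\int[leb]_z fej T z)^-1 * \int[leb]_y (G y * fej T (x - y))| <= eta * fej2 x.
Proof.
move=> eta0; have [M [M0 hM]] := compact_support_bound.
have [c [c0 hc]] := @fej2_ge R.
have ec : 0 < eta * c by rewrite mulr_gt0.
set q := 1 + 4 * rho ^+ 2.
have q0 : 0 < q by rewrite /q; have := sqr_ge0 rho; lra.
(* On [|x| <= 2 rho] one has [1 + x^2 <= q], so the weight is at least [c / q] there; [w] takes half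
   of the allowed error. *)
have [w [w0 wE]] : exists w : R, 0 < w /\ w = eta * c / (2 * q).
  by exists (eta * c / (2 * q)); split=> //; rewrite divr_gt0 ?mulr_gt0.
have [del [del0 hdel]] := compact_support_unif w0.
have [A [A0 AE]] : exists A : R, 0 <= A /\
    2 * M * (2 * (1 + (del ^+ 2)^-1)) * (\int[leb]_y (1 + y ^+ 2)^-1) = A.
  eexists; split; last by [].
  apply: mulr_ge0; last first.
    by apply: Rintegral_ge0 => y _; rewrite invr_ge0 addr_ge0// sqr_ge0.
  apply: mulr_ge0; first by rewrite mulr_ge0.
  by apply: mulr_ge0 => //; rewrite addr_ge0// invr_ge0 sqr_ge0.
have [N [N0 NE]] : exists N : R, 0 <= N /\ \int[leb]_y `|G y| = N.
  by eexists; split; last by []; exact: Rintegral_ge0.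
(* Since the mass [k] is at least [1 / 4], these inequalities give [A / T <= w k] and
   [16 N / T <= k eta c]. *)
have [T [T0 [TA TN]]] : exists T : R, 0 < T /\ (4 * A <= w * T /\ 64 * N <= eta * c * T).
  exists (1 + 4 * A / w + 64 * N / (eta * c)).
  have h1 : 0 <= 4 * A / w by rewrite divr_ge0 ?mulr_ge0// ltW.
  have h2 : 0 <= 64 * N / (eta * c) by rewrite divr_ge0 ?mulr_ge0// ltW.
  split; first by lra.
  split; rewrite !mulrDr mulr1 [X in X <= _]mulrC.
    rewrite (_ : w * (4 * A / w) = 4 * A); last by field; rewrite gt_eqF.
    by have := mulr_ge0 (ltW w0) h2; lra.
  rewrite (_ : eta * c * (64 * N / (eta * c)) = 64 * N); last first.
    by field; rewrite (gt_eqF c0) (gt_eqF eta0).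
  by have := mulr_ge0 (ltW ec) h1; lra.
exists T; split=> // x.
have := fej_mass_ge T0; set k := \int[leb]_z fej T z => k4.
have k0 : 0 < k by lra.
suff H : `|k * G x - \int[leb]_y (G y * fej T (x - y))| <= k * (eta * fej2 x).
  rewrite -(ler_pM2l k0) (le_trans _ H)// -[X in X * _ <= _](gtr0_norm k0) -normrM.
  by rewrite mulrBr mulVKf// gt_eqF.
have x2 : 0 < 1 + x ^+ 2 by rewrite ltr_wpDr ?sqr_ge0.
have hx : k * (eta * c / (1 + x ^+ 2)) <= k * (eta * fej2 x).
  apply: ler_wpM2l; first exact: ltW.
  by rewrite -mulrA; apply: ler_wpM2l; [exact: ltW|exact: hc].
apply: le_trans hx.
have [xr|rx] := leP `|x| (2 * rho).
  apply: (le_trans (fej_approx_near T0 del0 (ltW w0) (fun y => hdel x y) hM)).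
  rewrite -/k (_ : 2 * M * _ * _ = A / T); last by rewrite -AE; ring.
  apply: (@le_trans _ _ (k * (eta * c / q))); last first.
    apply: ler_wpM2l; first exact: ltW.
    apply: ler_wpM2l; first exact: ltW.
    rewrite lef_pV2 ?posrE// /q lerD2l.
    by rewrite -[leLHS]real_normK ?num_real//; have := normr_ge0 x; nra.
  have -> : k * (eta * c / q) = w * k + w * k by rewrite wE; field; rewrite gt_eqF.
  rewrite lerD2l ler_pdivrMr//; apply: (@le_trans _ _ (w * T * 4^-1)); first by lra.
  by rewrite -!mulrA ler_pM2l// mulrC ler_pM2r.
have Gx : G x = 0 by apply: G0; have := rho1; lra.
rewrite Gx mulr0 sub0r normrN; apply: (le_trans (fej_approx_far T0 rx)).
rewrite NE mulrA ler_wpM2r ?invr_ge0 ?(ltW x2)//.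
rewrite mulrAC ler_pdivrMr//; apply: (@le_trans _ _ (4^-1 * (eta * c * T))); first by lra.
by rewrite -[leRHS]mulrA; apply: ler_wpM2r => //; apply: mulr_ge0; exact: ltW.
Qed.

End compactly_supported.
End approximation.

(** * Comparison of two laws through their characteristic functions *)

Section fejer_comparison.
Context {R : realType} {d1 d2 : measure_display}.
Context {T1 : measurableType d1} {T2 : measurableType d2}.
Variables (P1 : probability T1 R) (P2 : probability T2 R) (Z1 : T1 -> R) (Z2 : T2 -> R).
Hypotheses (mZ1 : measurable_fun setT Z1) (mZ2 : measurable_fun setT Z2).
Local Notation leb := (@lebesgue_measure R).

Section one_measure.
Context {d : measure_display} {Om : measurableType d}.
Variables (P : probability Om R) (Z : Om -> R).
Hypothesis mZ : measurable_fun setT Z.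

Let Pn : P setT = 1%E. Proof. exact: probability_setT. Qed.

Lemma Rint_cos_shift (t y : R) : \int[P]_w cos (t * (Z w - y)) =
  complex.Re (eit (- (t * y)) * cintegral P (fun w => eit (t * Z w))).
Proof.
rewrite -cintZ//; last by apply: bmC_eit; exact: measurable_funM.
rewrite /cintegral /=; apply: eq_Rintegral => w _.
by rewrite -cosD; congr cos; ring.
Qed.

Lemma Rint_fej (T y : R) : 0 < T ->
  leb.-integrable setT (EFin \o (fun t => tent T t * \int[P]_w cos (t * (Z w - y)))) /\
  \int[P]_w fej T (Z w - y) = \int[leb]_t (tent T t * \int[P]_w cos (t * (Z w - y))).
Proof.
move=> T0; apply: (@Rint_Fubini _ _ _ P (tent T)
  (fun p : Om * measurableTypeR R => cos (p.2 * (Z p.1 - y))) 1 (integrable_tent T0)).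
  apply: measurableT_comp; first exact: continuous_measurable_fun (@continuous_cos R).
  apply: measurable_funM => //; apply: measurable_funB => //.
  exact: measurableT_comp mZ _.
by move=> p; rewrite ler_norml cos_geN1 cos_le1.
Qed.

Lemma bmr_fej (T y : R) : 0 < T -> bmr (fun w => fej T (Z w - y)).
Proof.
move=> T0; split; last by exists (T / 2) => w; rewrite ger0_norm ?fej_ge0// fej_le.
by apply: (measurableT_comp (measurable_fej T0)); exact: measurable_funB.
Qed.

Lemma bmr_fej2 : bmr (fun w => fej2 (Z w)).
Proof.
apply: bmrD; last exact: bmr_fej.
by have := bmr_fej 0 (@ltr01 R); congr bmr; apply/funext => w; rewrite subr0.
Qed.

Lemma Rint_fej_conv (G : R -> R) (T : R) : 0 < T ->
  leb.-integrable setT (EFin \o G) ->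
  leb.-integrable setT (EFin \o (fun y => G y * \int[P]_w fej T (Z w - y))) /\
  \int[P]_w \int[leb]_y (G y * fej T (Z w - y)) =
  \int[leb]_y (G y * \int[P]_w fej T (Z w - y)).
Proof.
move=> T0 iG; apply: (@Rint_Fubini _ _ _ P G
  (fun p : Om * measurableTypeR R => fej T (Z p.1 - p.2)) (T / 2) iG).
  apply: (measurableT_comp (measurable_fej T0)); apply: measurable_funB => //.
  exact: measurableT_comp mZ _.
by move=> p; rewrite ger0_norm ?fej_ge0// fej_le.
Qed.

Lemma bmr_fej_conv (G : R -> R) (T : R) : 0 < T -> leb.-integrable setT (EFin \o G) ->
  bmr (fun w => \int[leb]_y (G y * fej T (Z w - y))).
Proof.
move=> T0 iG; have iN := integrable_norm iG.
have ic x : leb.-integrable setT (EFin \o (fun y => G y * fej T (x - y))).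
  have i1 : leb.-integrable setT (EFin \o (fun y => `|G y| * (T / 2))).
    exact: (integrableZr measurableT _ iN).
  apply: (integrable_bounded_by _ i1).
    apply: measurable_funM; first by case/integrableP: iG => /measurable_EFinP.
    by apply: (measurableT_comp (measurable_fej T0)); exact: measurable_funB.
  by move=> y; rewrite normrM ler_wpM2l// ger0_norm ?fej_ge0// fej_le.
have lip (x x' : R) : `|\int[leb]_y (G y * fej T (x - y)) - \int[leb]_y (G y * fej T (x' - y))|
    <= (\int[leb]_y `|G y|) * T ^+ 2 * `|x - x'|.
  rewrite -(RintegralB measurableT (ic x) (ic x')).
  have iD := integrableB measurableT (ic x) (ic x').
  apply: (le_trans (le_normr_Rintegral measurableT iD)).
  rewrite -mulrA -(RintegralZr _ measurableT iN); apply: le_Rintegral => //.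
  - exact: (integrable_norm iD).
  - exact: (integrableZr measurableT _ iN).
  - move=> y _; rewrite /= -mulrBr normrM ler_wpM2l//.
    by rewrite (le_trans (fej_lip _ _ T0))// (_ : x - y - (x' - y) = x - x')//; ring.
split.
  have mF : measurable_fun setT (fun x : R => \int[leb]_y (G y * fej T (x - y))).
    by apply: continuous_measurable_fun; exact: lipschitz_continuous lip.
  exact: (measurableT_comp mF mZ).
exists ((\int[leb]_y `|G y|) * (T / 2)) => w.
apply: (le_trans (le_normr_Rintegral measurableT (ic (Z w)))).
rewrite -(RintegralZr _ measurableT iN); apply: le_Rintegral => //.
- exact: (integrable_norm (ic (Z w))).
- exact: (integrableZr measurableT _ iN).
- by move=> y _; rewrite normrM ler_wpM2l// ger0_norm ?fej_ge0// fej_le.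
Qed.

Lemma Rint_fej_approx (G : R -> R) (T eta : R) : 0 < T -> leb.-integrable setT (EFin \o G) ->
  bmr (fun w => G (Z w)) ->
  (forall x, `|G x - (\int[leb]_z fej T z)^-1 * \int[leb]_y (G y * fej T (x - y))| <=
     eta * fej2 x) ->
  `|\int[P]_w G (Z w) -
    (\int[leb]_z fej T z)^-1 * \int[leb]_y (G y * \int[P]_w fej T (Z w - y))| <=
  eta * \int[P]_w fej2 (Z w).
Proof.
move=> T0 iG bG h; have [_ <-] := Rint_fej_conv T0 iG.
have bc := bmr_fej_conv T0 iG; set k := (X in X * _).
have bk : bmr (fun w => k * \int[leb]_y (G y * fej T (Z w - y))) by exact: bmrZ.
rewrite -(RintZ Pn _ bc) -(RintB Pn bG bk) -(RintZ Pn _ bmr_fej2).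
have bD := bmrB bG bk.
apply: (le_trans (le_normr_Rintegral measurableT (bmr_integrable Pn bD))).
apply: le_Rintegral => //; first exact: (integrable_norm (bmr_integrable Pn bD)).
  by apply: (bmr_integrable Pn); apply: bmrZ; exact: bmr_fej2.
Qed.

End one_measure.

(** Means of [fej T] are tent averages of real parts of characteristic functions; translating by [y]
    only inserts a factor of modulus 1, so the bound is uniform in [y]. *)
Lemma fej_char_diff (T e y : R) (D : R -> R) : 0 < T ->
  leb.-integrable `[0, T] (EFin \o D) -> \int[leb]_(t in `[0, T]) D t <= e ->
  (forall t, 0 <= t <= T -> normc (cintegral P1 (fun w => eit (t * Z1 w)) -
                                   cintegral P2 (fun w => eit (t * Z2 w))) <= D t) ->
  `|\int[P1]_w fej T (Z1 w - y) - \int[P2]_w fej T (Z2 w - y)| <= e.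
Proof.
move=> T0 iD De hD.
have [i1 ->] := Rint_fej P1 mZ1 y T0; have [i2 ->] := Rint_fej P2 mZ2 y T0.
rewrite -(RintegralB measurableT i1 i2).
have i12 := integrableB measurableT i1 i2.
apply: le_trans De; apply: (le_trans (le_normr_Rintegral measurableT i12)).
have iD' : leb.-integrable setT (EFin \o (D \_ `[0, T])).
  by rewrite -restrict_EFin; apply/integrable_restrict => //; rewrite setTI.
rewrite [leRHS]Rintegral_mkcond; apply: le_Rintegral => //; first exact: (integrable_norm i12).
move=> t _; rewrite /= -mulrBr normrM patchE.
have := tent_ge0 t T0; have := tent_le t T0; rewrite indicE.
case: ifPn => [|_ h1 h2]; last by rewrite (le_anti (introT andP (conj h1 h2))) normr0 mul0r.
rewrite inE /= in_itv/= => ht h1 h2; rewrite (ger0_norm h2) !Rint_cos_shift//.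
rewrite -cReN -cReD -mulrBr; set z := eit _ * _.
have zD : normc z <= D t.
  by rewrite /z Normc.normcM normc_eit mul1r; exact: hD.
rewrite -[leRHS]mul1r; apply: ler_pM => //.
exact: le_trans (ler_Re_normc z) zD.
Qed.

(** Smoothing leaves errors [eta] times the mean of [fej2] under each law. Under [P1] this mean is
    compared with that under [P2], at frequency cut-off 1; [fej2] is a sum of two translates, hence
    [2 e1]. The factor 4 is the inverse of the mass bound. *)
Lemma fej_transfer (G : R -> R) (T eta e1 eT : R) : 0 < T ->
  leb.-integrable setT (EFin \o G) -> bmr (fun w => G (Z1 w)) -> bmr (fun w => G (Z2 w)) ->
  (forall x, `|G x - (\int[leb]_z fej T z)^-1 * \int[leb]_y (G y * fej T (x - y))| <=
     eta * fej2 x) -> 0 <= eta ->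
  (forall y, `|\int[P1]_w fej T (Z1 w - y) - \int[P2]_w fej T (Z2 w - y)| <= eT) ->
  (forall y, `|\int[P1]_w fej 1 (Z1 w - y) - \int[P2]_w fej 1 (Z2 w - y)| <= e1) ->
  `|\int[P1]_w G (Z1 w) - \int[P2]_w G (Z2 w)| <=
  eta * (2 * \int[P2]_w fej2 (Z2 w) + 2 * e1) + 4 * (\int[leb]_y `|G y|) * eT.
Proof.
move=> T0 iG b1 b2 h eta0 heT he1.
have P1n : P1 setT = 1%E by exact: probability_setT.
have P2n : P2 setT = 1%E by exact: probability_setT.
have A1 := Rint_fej_approx P1 mZ1 T0 iG b1 h.
have A2 := Rint_fej_approx P2 mZ2 T0 iG b2 h.
have k4 := fej_mass_ge T0; set k := \int[leb]_z fej T z in A1 A2 k4.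
have W : \int[P1]_w fej2 (Z1 w) <= \int[P2]_w fej2 (Z2 w) + 2 * e1.
  have c1 y := bmr_fej mZ1 y (@ltr01 R); have c2 y := bmr_fej mZ2 y (@ltr01 R).
  have fE z : fej2 z = fej 1 (z - 0) + fej 1 (z - 1) :> R by rewrite subr0.
  under eq_Rintegral do rewrite fE; under [in leRHS]eq_Rintegral do rewrite fE.
  rewrite (RintD P1n (c1 0) (c1 1)) (RintD P2n (c2 0) (c2 1)).
  have aux (a b c e f : R) : a - c <= f -> b - e <= f -> a + b <= c + e + 2 * f by lra.
  exact: aux (le_trans (ler_norm _) (he1 0)) (le_trans (ler_norm _) (he1 1)).
have [i1 _] := Rint_fej_conv P1 mZ1 T0 iG; have [i2 _] := Rint_fej_conv P2 mZ2 T0 iG.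
set S1 := \int[leb]_y _ in A1; set S2 := \int[leb]_y _ in A2.
have S12 : `|S1 - S2| <= (\int[leb]_y `|G y|) * eT.
  have iN := integrable_norm iG; have iD := integrableB measurableT i1 i2.
  rewrite -(RintegralB measurableT i1 i2) -(RintegralZr _ measurableT iN).
  apply: (le_trans (le_normr_Rintegral measurableT iD)); apply: le_Rintegral => //.
  - exact: (integrable_norm iD).
  - exact: (integrableZr measurableT _ iN).
  - by move=> y _; rewrite /= -mulrBr normrM ler_wpM2l.
have k0 : 0 < k by lra.
have kS : `|k^-1 * (S1 - S2)| <= 4 * ((\int[leb]_y `|G y|) * eT).
  rewrite normrM gtr0_norm ?invr_gt0//; apply: ler_pM => //.
    by rewrite invr_ge0 ltW.
  by rewrite -[leRHS]invrK lef_pV2 ?posrE.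
rewrite (_ : _ - _ = (\int[P1]_w G (Z1 w) - k^-1 * S1) - (\int[P2]_w G (Z2 w) - k^-1 * S2)
  + k^-1 * (S1 - S2)); last by ring.
rewrite (le_trans (ler_normD _ _))// lerD//; last by rewrite -mulrA.
rewrite (le_trans (ler_normB _ _))// (le_trans (lerD A1 A2))// -mulrDr ler_wpM2l//.
by move: W; lra.
Qed.

End fejer_comparison.

(** * From characteristic functions to the local limit theorem *)

Section local_limit_criterion.
Context {R : realType}.
Local Notation leb := (@lebesgue_measure R).

Lemma derivable_lipschitz (f df : R -> R) (C : R) :
  (forall x : R, is_derive x 1 f (df x)) -> (forall x, `|df x| <= C) ->
  forall x y, `|f x - f y| <= C * `|x - y|.
Proof.
move=> fd dC x y; wlog yx : x y / y <= x.
  by move=> H; have [/H//|/ltW/H] := leP y x; rewrite distrC [`|y - x|]distrC.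
have [|c _ ->] := @MVT_segment R f df y x yx (fun z _ => fd z).
  by apply: derivable_within_continuous => z _; exact: (@ex_derive _ _ _ _ _ _ _ (fd z)).
by rewrite normrM ler_wpM2r.
Qed.

Lemma normal_fun_le1 (m s x : R) : normal_fun m s x <= 1.
Proof.
rewrite /normal_fun -[leRHS]expR0 ler_expR mulNr oppr_le0 divr_ge0 ?sqr_ge0//.
by rewrite mulrn_wge0// sqr_ge0.
Qed.

Lemma normal_fun_lipschitz (m s x y : R) : 0 < s ->
  `|normal_fun m s x - normal_fun m s y| <= s^-1 * `|x - y|.
Proof.
move=> s0; have s_neq0 : s != 0 by rewrite gt_eqF.
apply: (@derivable_lipschitz _ (fun x => - ((x - m) / s ^+ 2 * normal_fun m s x))).
  move=> z; rewrite /normal_fun; apply: is_derive_eq.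
  by rewrite /GRing.scale/=; set e := expR _; move: e => e; field.
move=> z; rewrite normrN !normrM (ger0_norm (normal_fun_ge0 _ _ _)).
rewrite mulrAC normfV (ger0_norm (sqr_ge0 s)) ler_pdivrMr ?exprn_gt0//.
rewrite (_ : s^-1 * s ^+ 2 = s); last by field.
apply: (le_trans (normal_fun_moment m s0 z)).
by rewrite ler_piMr ?normal_fun_le1// ltW.
Qed.

(** The prefactor of the limit theorem is the reciprocal of the maximum of the approximating normal
    density. *)
Lemma normal_peakE (a : R) (n : nat) : 0 < a ->
  (normal_peak (a * Num.sqrt n%:R))^-1 = a * Num.sqrt (2 * pi * n%:R).
Proof.
move=> a0; rewrite /normal_peak invrK.
rewrite (_ : (a * Num.sqrt n%:R) ^+ 2 * pi *+ 2 = a ^+ 2 * (2 * pi * n%:R)).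
  by rewrite sqrtrM ?sqr_ge0// sqrtr_sqr gtr0_norm.
by rewrite exprMn sqr_sqrtr// -mulr_natr; ring.
Qed.

Lemma sandwich (A B C g p q r e : R) : A <= C -> C <= B -> p <= r -> r <= q ->
  q - p <= e / 4 -> 0 <= g -> g <= 1 -> 0 <= e ->
  `|B - q * g| <= e / 2 -> `|A - p * g| <= e / 2 -> `|C - r * g| <= e.
Proof.
move=> AC CB pr rq qp g0 g1 e0; rewrite !ler_norml => /andP[b1 b2] /andP[a1 a2].
have h1 : (q - r) * g <= q - r by rewrite ler_piMr// subr_ge0.
have h2 : (r - p) * g <= r - p by rewrite ler_piMr// subr_ge0.
by move: h1 h2; rewrite !mulrBl => h1 h2; apply/andP; split; lra.
Qed.

Variables (d : nat -> measure_display) (Om : forall n, measurableType (d n)).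
Variables (P : forall n, probability (Om n) R) (S : forall n, Om n -> R).
Variables (a b : R).
Hypotheses (a0 : 0 < a) (bS : forall n, (0 < n)%N -> bmr (@S n)).

Let phi n t := cintegral (P n) (fun w => eit (t * S w)).
Let gam n t := eit (t * (b * n%:R)) * (expR (- ((a * Num.sqrt n%:R * t) ^+ 2 / 2)))%:C%C.

(** Stated with an integrable majorant [D], so that the modulus of the difference is never itself
    integrated. *)
Hypothesis char_close : forall T e : R, 0 < T -> 0 < e ->
  exists N, forall n, (N <= n)%N -> exists D : R -> R,
    [/\ leb.-integrable `[0, T] (EFin \o D),
        forall t, 0 <= t <= T -> normc (phi n t - gam n t) <= D t &
        Num.sqrt n%:R * \int[leb]_(t in `[0, T]) D t <= e].

Let scaled G n v := a * Num.sqrt (2 * pi * n%:R) * \int[P n]_w G (S w - v).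
Let gauss n v := expR (- (v - b * n%:R) ^+ 2 / (2 * n%:R * a ^+ 2)).
Let llt (G : R -> R) := forall e : R, 0 < e -> exists N, forall n, (N <= n)%N ->
  forall v, `|scaled G n v - (\int[leb]_x G x) * gauss n v| <= e.

Lemma gaussE n v : (0 < n)%N -> gauss n v = normal_fun (b * n%:R - v) (a * Num.sqrt n%:R) 0.
Proof.
move=> n0; rewrite /gauss /normal_fun sub0r opprB exprMn sqr_sqrtr//.
by congr (expR (_ / _)); rewrite -mulr_natr; ring.
Qed.

(** Recentring multiplies both characteristic functions by the same phase; this is the source of
    uniformity in [v]. *)
Lemma char_close_shift n (v t : R) : (0 < n)%N ->
  normc (cintegral (P n) (fun w => eit (t * (S w - v))) -
    cintegral (normal_prob (b * n%:R - v) (a * Num.sqrt n%:R)) (fun x => eit (t * x))) =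
  normc (phi n t - gam n t).
Proof.
move=> n0; have s0 : 0 < a * Num.sqrt n%:R by rewrite mulr_gt0// sqrtr_gt0 ltr0n.
have P1 : P n setT = 1%E by exact: probability_setT.
rewrite cintegral_normal_eit//.
have -> : cintegral (P n) (fun w => eit (t * (S w - v))) = eit (- (t * v)) * phi n t.
  rewrite /phi -cintZ//; last by apply: bmC_eit; apply: measurable_funM => //; have [] := bS n0.
  by congr cintegral; apply/funext => w; rewrite -eitD; congr eit; ring.
have -> : eit (t * (b * n%:R - v)) = eit (- (t * v)) * eit (t * (b * n%:R)).
  by rewrite -eitD; congr eit; ring.
by rewrite -mulrA -mulrBr Normc.normcM normc_eit mul1r.
Qed.

(** The law of [S - v] is compared with the normal law of mean [b n - v] and deviation
    [s = a sqrt n]. Divided by its peak, the density of the latter is [1 / s]-Lipschitz, so on the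
    support of [G] it is nearly its value at 0, which is [gauss n v]. *)
Lemma llt_continuous (G : R -> R) (rho : R) : continuous G -> 1 <= rho ->
  (forall x, rho < `|x| -> G x = 0) -> llt G.
Proof.
move=> cG rho1 G0 e e0.
have aux (u w : R) : 0 < w -> u * 4 <= w -> u <= w / 2 by lra.
have aux2 (x y z : R) : x * 4 <= y -> z * 4 <= y -> x + z <= y / 2 by lra.
have [M [M0 hM]] := compact_support_bound cG rho1 G0.
have mG : measurable_fun setT G by exact: continuous_measurable_fun.
have iG := compact_support_integrable cG rho1 G0; have iN := integrable_norm iG.
have [NG [NG0 NGE]] : exists N : R, 0 <= N /\ \int[leb]_y `|G y| = N.
  by eexists; split; last by []; exact: Rintegral_ge0.
have if2 : leb.-integrable setT (EFin \o (@fej2 R)).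
  have i1 : leb.-integrable setT (EFin \o fej (1 : R)) by exact: integrable_fej.
  have i2 : leb.-integrable setT (EFin \o (fun x : R => fej 1 (x - 1))).
    apply: integrable_shift i1; first exact: continuous_fej.
    by move=> x; exact: fej_ge0.
  exact: (integrableD measurableT i1 i2).
have [F [F0 FE]] : exists F : R, 0 <= F /\ \int[leb]_y fej2 y = F.
  by eexists; split; last by []; apply: Rintegral_ge0 => x _; rewrite addr_ge0// fej_ge0.
pose c := a * Num.sqrt (2 * pi).
have c0 : 0 < c by rewrite mulr_gt0// sqrtr_gt0 mulr_gt0// pi_gt0.
(* Gives [2 eta F <= e / 4]; likewise [e'] makes the terms coming from the characteristic functions
   at most [e / 4]. *)
pose eta := e / (8 * F + 1).
have F8 : 0 < 8 * F + 1 by lra.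
have eta0 : 0 < eta by rewrite divr_gt0.
have [T [T0 hT]] := fej_approx cG rho1 G0 eta0.
pose e' := e / (8 * c * eta + 16 * NG * c + 1).
have den : 0 < 8 * c * eta + 16 * NG * c + 1.
  have := mulr_ge0 NG0 (ltW c0); have := mulr_gt0 c0 eta0.
  by rewrite -!mulrA; lra.
have e'0 : 0 < e' by rewrite divr_gt0.
have [N1 hN1] := char_close (@ltr01 R) e'0; have [N2 hN2] := char_close T0 e'0.
pose N3 := (Num.truncn ((4 * rho * NG / (a * e)) ^+ 2)).+1.
exists (N1 + N2 + N3).+1 => n nN v.
have n0 : (0 < n)%N by exact: leq_trans nN.
have n1 : (N1 <= n)%N by move: nN; clear; lia.
have n2 : (N2 <= n)%N by move: nN; clear; lia.
have n3 : (N3 <= n)%N by move: nN; clear; lia.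
have sn0 : 0 < Num.sqrt n%:R :> R by rewrite sqrtr_gt0 ltr0n.
set s := a * Num.sqrt n%:R; have s0 : 0 < s by rewrite mulr_gt0.
have [D1 [iD1 hD1 eD1]] := hN1 n n1; have [D2 [iD2 hD2 eD2]] := hN2 n n2.
set m := b * n%:R - v.
pose P2 := normal_prob m s : probability (measurableTypeR R) R.
have mS : measurable_fun setT (fun w => @S n w - v).
  by apply: measurable_funB => //; have [] := bS n0.
have mid : measurable_fun setT (fun x : measurableTypeR R => x) by exact: measurable_id.
have divn (x y : R) : Num.sqrt n%:R * x <= y -> x <= y / Num.sqrt n%:R.
  by move=> h; rewrite ler_pdivlMr// mulrC.
have f1 y : `|\int[P n]_w fej 1 (S w - v - y) - \int[P2]_x fej 1 (x - y)| <= e' / Num.sqrt n%:R.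
  apply: (fej_char_diff mS mid y (@ltr01 R) iD1 (divn _ _ eD1)) => t ht.
  by rewrite (char_close_shift v t n0); exact: hD1.
have fT y : `|\int[P n]_w fej T (S w - v - y) - \int[P2]_x fej T (x - y)| <= e' / Num.sqrt n%:R.
  apply: (fej_char_diff mS mid y T0 iD2 (divn _ _ eD2)) => t ht.
  by rewrite (char_close_shift v t n0); exact: hD2.
have bG (d' : measure_display) (O : measurableType d') (Z : O -> R) :
    measurable_fun setT Z -> bmr (fun w => G (Z w)).
  by move=> mZ; split; [exact: (measurableT_comp mG mZ)|exists M => w; exact: hM].
have tr := fej_transfer mS mid T0 iG (bG _ _ _ mS) (bG _ _ _ mid) hT (ltW eta0) fT f1.
have W2 : \int[P2]_x fej2 x <= normal_peak s * F.
  rewrite -FE; apply: (@normal_prob_mean_le R m s s0 (@fej2 R) (bmr_fej2 mid) if2).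
  by move=> x; rewrite addr_ge0// fej_ge0.
pose q := (normal_peak s)^-1.
have p0 : 0 < normal_peak s by rewrite normal_peak_gt0// gt_eqF.
have q0 : 0 < q by rewrite invr_gt0.
have qE : q = c * Num.sqrt n%:R.
  by rewrite /q /s normal_peakE// sqrtrM ?mulrA// mulr_ge0// pi_ge0.
have qN : q * \int[P2]_x G x = \int[leb]_x (normal_fun m s x * G x).
  exact: (@normal_prob_mean_flat R m s s0 G (bG _ _ _ mid) iG).
have scE : scaled G n v = q * \int[P n]_w G (S w - v) by rewrite /scaled -normal_peakE.
have first_part : `|scaled G n v - \int[leb]_x (normal_fun m s x * G x)| <= e / 2.
  rewrite scE -qN -mulrBr normrM (gtr0_norm q0).
  apply: (le_trans (ler_wpM2l (ltW q0) tr)); rewrite NGE.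
  apply: (@le_trans _ _ (q * (eta * (2 * (normal_peak s * F) + 2 * (e' / Num.sqrt n%:R)) +
      4 * NG * (e' / Num.sqrt n%:R)))).
    by rewrite ler_pM2l// lerD2r ler_pM2l// lerD2r ler_pM2l.
  have -> : q * (eta * (2 * (normal_peak s * F) + 2 * (e' / Num.sqrt n%:R)) +
      4 * NG * (e' / Num.sqrt n%:R)) =
      eta * F * 2 * (q * normal_peak s) + (2 * c * eta + 4 * NG * c) * e'.
    have qc : q / Num.sqrt n%:R = c by rewrite qE mulfK ?gt_eqF.
    by rewrite -qc; ring.
  rewrite {1}/q mulVf ?gt_eqF// mulr1.
  apply: aux2.
    rewrite (_ : eta * F * 2 * 4 = eta * (8 * F)); last by ring.
    by rewrite /eta mulrAC ler_pdivrMr// ler_pM2l// lerDl.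
  rewrite (_ : _ * e' * 4 = (8 * c * eta + 16 * NG * c) * e'); last by ring.
  by rewrite /e' mulrA ler_pdivrMr// mulrC ler_pM2l// lerDl.
have second_part : `|\int[leb]_x (normal_fun m s x * G x) - (\int[leb]_x G x) * gauss n v| <= e / 2.
  rewrite gaussE// -/m -/s.
  have inG : leb.-integrable setT (EFin \o (fun x => normal_fun m s x * G x)).
    apply: (integrable_bounded_by _ iN).
      by apply: measurable_funM => //; exact: measurable_normal_fun.
    move=> x; rewrite normrM ler_piMl// ger0_norm ?normal_fun_le1//.
    exact: normal_fun_ge0.
  have iGz : leb.-integrable setT (EFin \o (fun x => G x * normal_fun m s 0)).
    exact: (integrableZr measurableT _ iG).
  have iD := integrableB measurableT inG iGz.
  have iM : leb.-integrable setT (EFin \o (fun x => `|G x| * (rho / s))).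
    exact: (integrableZr measurableT _ iN).
  rewrite -(RintegralZr _ measurableT iG) -(RintegralB measurableT inG iGz).
  apply: (le_trans (le_normr_Rintegral measurableT iD)).
  apply: (@le_trans _ _ (NG * (rho / s))).
    rewrite -NGE -(RintegralZr _ measurableT iN); apply: le_Rintegral => //.
      exact: (integrable_norm iD).
    move=> x _; rewrite /= mulrC -mulrBr normrM; have [xr|rx] := leP `|x| rho; last first.
      by rewrite (G0 _ rx) normr0 !mul0r.
    apply: ler_wpM2l => //; apply: (le_trans (normal_fun_lipschitz _ _ _ s0)).
    by rewrite subr0 mulrC ler_wpM2r// invr_ge0 ltW.
  pose y := 4 * rho * NG / (a * e); have ae : 0 < a * e by rewrite mulr_gt0.
  have y0 : 0 <= y by rewrite divr_ge0 ?(ltW ae)// mulr_ge0// mulr_ge0// (le_trans ler01).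
  have ys : y <= Num.sqrt n%:R.
    rewrite -(ger0_norm y0) -sqrtr_sqr ler_wsqrtr//.
    apply: (le_trans (ltW (truncnS_gt _))).
    by rewrite ler_nat.
  have : rho * NG * 4 <= Num.sqrt n%:R * (a * e).
    by rewrite -ler_pdivrMr// (_ : rho * NG * 4 / (a * e) = y)// /y; ring.
  rewrite mulrA ler_pdivrMr// /s (_ : e / 2 * _ = Num.sqrt n%:R * (a * e) / 2); last by ring.
  by rewrite [NG * rho]mulrC; exact: aux (mulr_gt0 sn0 ae).
rewrite (splitr e) -(subrK (\int[leb]_x (normal_fun m s x * G x)) (scaled G n v)) -addrA.
by rewrite (le_trans (ler_normD _ _))// lerD.
Qed.

(** A trapezoid on [[al, be]] with flanks of width [h]; it degenerates to a lower triangle when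
    [be - al < 2 h], and to 0 when [be <= al]. *)
Definition trap (h al be x : R) : R :=
  Num.max 0 (Num.min 1 (Num.min ((x - al) / h) ((be - x) / h))).

Lemma continuous_trap h al be : continuous (trap h al be).
Proof.
have c1 (l : R) x : {for x, continuous (fun x : R => (x - l) / h : R)}.
  by apply: cvgM; [apply: cvgB; [exact: cvg_id|exact: cvg_cst]|exact: cvg_cst].
have c2 (l : R) x : {for x, continuous (fun x : R => (l - x) / h : R)}.
  by apply: cvgM; [apply: cvgB; [exact: cvg_cst|exact: cvg_id]|exact: cvg_cst].
have cc (l : R) x : {for x, continuous (fun _ : R => l : R)} by exact: cvg_cst.
move=> x.
exact: (continuous_max (cc 0 x) (continuous_min (cc 1 x) (continuous_min (c1 al x) (c2 be x)))).
Qed.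

Lemma trap_ge0 h al be x : 0 <= trap h al be x.
Proof. by rewrite le_max lexx. Qed.

Lemma trap_le1 h al be x : trap h al be x <= 1.
Proof. by rewrite ge_max ler01 ge_min lexx. Qed.

Lemma trap_out h al be x : 0 < h -> ~~ (al < x < be) -> trap h al be x = 0.
Proof.
move=> h0; rewrite negb_and -!leNgt => xab; apply/max_idPl.
rewrite !ge_min; apply/orP; right; apply/orP.
case/orP: xab => ?; [left|right]; rewrite pmulr_lle0 ?invr_gt0//; lra.
Qed.

Lemma trap_in h al be x : 0 < h -> al + h <= x <= be - h -> trap h al be x = 1.
Proof.
move=> h0 /andP[xa xb]; rewrite /trap (min_idPl _); first by apply/max_idPr.
by rewrite le_min !ler_pdivlMr// !mul1r; apply/andP; split; lra.
Qed.

Lemma trap_cut h al be x : 0 < h -> 1 + `|al| + `|be| < `|x| -> trap h al be x = 0.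
Proof.
move=> h0 hx; apply: trap_out => //; apply/negP => /andP[ax xb].
have := ler_norm be; have := ler_norm (- al); rewrite normrN.
by move: hx; have [x0|x0] := leP 0 x; rewrite ?(ger0_norm x0) ?(ltr0_norm x0);
  have := normr_ge0 al; have := normr_ge0 be; lra.
Qed.

Lemma llt_interval (I : set R) : is_interval I -> bounded_set I -> llt (\1_I).
Proof.
move=> itvI bI e e0.
have aux (x y z : R) : x <= 1 -> 0 <= y -> 0 <= z -> x - y <= 1 + z by lra.
have mI : measurable I by exact: is_interval_measurable.
(* Whether the ends belong to [I] is left open; for empty [I] both inclusions are vacuous with
   [al = be = 0]. *)
have [al [be [inI outI]]] : exists al be : R,
    (forall x, al < x < be -> I x) /\ (forall x, I x -> al <= x <= be).
  have [->|/set0P I0] := eqVneq I set0.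
    by exists 0, 0; split=> // x /andP[x0 x1]; have := lt_trans x0 x1; rewrite ltxx.
  have [M [_ hM]] := bI; have IM x : I x -> `|x| <= M + 1 by apply: hM; rewrite ltrDl.
  have hs : has_sup I by split=> //; exists (M + 1) => x /IM; rewrite ler_norml => /andP[].
  have hi : has_inf I by split=> //; exists (- (M + 1)) => x /IM; rewrite ler_norml => /andP[].
  exists (inf I), (sup I); split=> x; last first.
    by move=> Ix; rewrite ge_inf ?ub_le_sup//; [case: hs|case: hi].
  move=> /andP[xi xs].
  have [y Iy yx] := inf_lt hi.1 xi; have [z Iz xz] := sup_gt hs.1 xs.
  by apply: (itvI y z) => //; rewrite (ltW yx) ltW.
(* Inner and outer trapezoid differ only within [h] of the two ends, so their integrals differ by at
   most [4 h = e / 4]. *)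
pose h := e / 16; have h0 : 0 < h by rewrite divr_gt0.
pose fm := trap h al be; pose fp := trap h (al - h) (be + h).
have fmI x : fm x <= \1_I x.
  have [xab|xab] := boolP (al < x < be).
    by rewrite indicE mem_set ?trap_le1//; exact: inI.
  by rewrite /fm trap_out.
have Ifp x : \1_I x <= fp x.
  rewrite indicE; case: (boolP (x \in I)) => [|_]; last exact: trap_ge0.
  by rewrite inE => /outI /andP[xa xb]; rewrite /fp trap_in//; lra.
have rho1 (l m : R) : 1 <= 1 + `|l| + `|m| by rewrite -addrA lerDl addr_ge0.
have lm : llt fm.
  apply: (llt_continuous (@continuous_trap h al be) (rho1 al be)) => x hx.
  exact: trap_cut.
have lp : llt fp.
  apply: (llt_continuous (@continuous_trap h (al - h) (be + h)) (rho1 (al - h) (be + h))) => x hx.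
  exact: trap_cut.
have mtrap l m : measurable_fun setT (trap h l m).
  by apply: continuous_measurable_fun; exact: continuous_trap.
have itrap l m : leb.-integrable setT (EFin \o trap h l m).
  apply: (compact_support_integrable (@continuous_trap h l m) (rho1 l m)) => x hx.
  exact: trap_cut.
have iI : leb.-integrable setT (EFin \o \1_I).
  apply: (integrable_bounded_by _ (itrap (al - h) (be + h))); first exact: measurable_indic.
  by move=> x; rewrite ger0_norm; [exact: Ifp|rewrite indicE].
have gap : \int[leb]_x fp x - \int[leb]_x fm x <= e / 4.
  rewrite -(RintegralB measurableT (itrap _ _) (itrap _ _)).
  have ind (l : R) : leb.-integrable setT (EFin \o \1_`[l - h, l + h]).
    exact: integrable_indic_seg.
  have indE (l : R) : \int[leb]_x \1_`[l - h, l + h] x = 2 * h.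
    have lh : l - h < l + h by lra.
    rewrite Rint_indic//= lebesgue_measure_itv/= lte_fin lh -EFinD /=; ring.
  apply: (@le_trans _ _ (\int[leb]_x (\1_`[al - h, al + h] x + \1_`[be - h, be + h] x))); last first.
    by rewrite (RintegralD measurableT (ind al) (ind be)) !indE /h; lra.
  apply: le_Rintegral => //.
  - exact: (integrableB measurableT (itrap _ _) (itrap _ _)).
  - exact: (integrableD measurableT (ind al) (ind be)).
  move=> x _; have ind0 (A : set R) : 0 <= \1_A x :> R by rewrite indicE.
  have fp1 := trap_le1 h (al - h) (be + h) x; have fm0 := trap_ge0 h al be x.
  have [xa|xa] := boolP (x \in `[al - h, al + h]%classic).
    have -> : \1_`[al - h, al + h] x = 1 :> R by rewrite indicE xa.
    by apply: aux => //; exact: ind0.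
  have [xb|xb] := boolP (x \in `[be - h, be + h]%classic).
    have -> : \1_`[be - h, be + h] x = 1 :> R by rewrite indicE xb.
    by rewrite [leRHS]addrC; apply: aux => //; exact: ind0.
  rewrite !indicE (negPf xa) (negPf xb) addr0.
  have [/andP[x1 x2]|xo] := boolP (al - h < x < be + h); last first.
    by rewrite /fp (trap_out h0 xo) sub0r oppr_le0.
  have -> : trap h al be x = 1; last by rewrite subr_le0.
  rewrite trap_in//; apply/andP; split.
    by rewrite leNgt; apply/negP => xal; move/negP: xa; apply; rewrite inE /= in_itv/= !ltW.
  by rewrite leNgt; apply/negP => xbe; move/negP: xb; apply; rewrite inE /= in_itv/= !ltW.
have e2 : 0 < e / 2 by rewrite divr_gt0.
have [N1 hN1] := lm _ e2; have [N2 hN2] := lp _ e2.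
exists (N1 + N2).+1 => n nN v.
have n0 : (0 < n)%N by exact: leq_trans nN.
have Pn : P n setT = 1%E by exact: probability_setT.
have mS : measurable_fun setT (fun w => @S n w - v).
  by apply: measurable_funB => //; have [] := bS n0.
have btrap l m : bmr (fun w => trap h l m (@S n w - v)).
  split; first exact: (measurableT_comp (mtrap l m) mS).
  by exists 1 => w; rewrite ger0_norm ?trap_ge0// trap_le1.
have bI' : bmr (fun w => (\1_I : R -> R) (@S n w - v)).
  split; first exact: (measurableT_comp (measurable_indic mI) mS).
  by exists 1 => w; rewrite indicE; case: (_ \in _); rewrite ?normr1 ?normr0.
have c0 : 0 <= a * Num.sqrt (2 * pi * n%:R) by rewrite mulr_ge0// ltW.
have sc1 : scaled fm n v <= scaled (\1_I) n v.
  by apply: ler_wpM2l => //; apply: (Rint_le Pn (btrap _ _) bI') => w; exact: fmI.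
have sc2 : scaled (\1_I) n v <= scaled fp n v.
  by apply: ler_wpM2l => //; apply: (Rint_le Pn bI' (btrap _ _)) => w; exact: Ifp.
have i1 : \int[leb]_x fm x <= \int[leb]_x \1_I x.
  by apply: (le_Rintegral measurableT (itrap _ _) iI) => x _; exact: fmI.
have i2 : \int[leb]_x \1_I x <= \int[leb]_x fp x.
  by apply: (le_Rintegral measurableT iI (itrap _ _)) => x _; exact: Ifp.
have := hN1 n (leq_trans (leqW (leq_addr _ _)) nN) v.
have := hN2 n (leq_trans (leqW (leq_addl _ _)) nN) v.
have g0 : 0 <= gauss n v by exact: expR_ge0.
have g1 : gauss n v <= 1 by rewrite gaussE// normal_fun_le1.
exact: (sandwich sc1 sc2 i1 i2 gap g0 g1 (ltW e0)).
Qed.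

Theorem llt_criterion (G : R -> R) : test_function G -> llt G.
Proof.
move=> [[cG kG]|[I [iI bI ->]]]; last exact: llt_interval.
by have [rho [rho1 G0]] := compact_support_cut kG; exact: llt_continuous G0.
Qed.

End local_limit_criterion.

(** * Asymptotics of the characteristic functions *)

Section riemann_sums.
Context {R : realType}.
Local Notation leb := (@lebesgue_measure R).

Lemma expR_neg_lip (x y : R) : 0 <= x -> 0 <= y -> `|expR (- x) - expR (- y)| <= `|x - y|.
Proof.
move=> x0 y0; wlog xy : x y x0 y0 / x <= y.
  by move=> H; have [/H->//|/ltW/H] := leP x y; rewrite distrC [`|y - x|]distrC; exact.
have h : expR (- y) <= expR (- x) by rewrite ler_expR lerN2.
rewrite ger0_norm ?subr_ge0// ler0_norm ?subr_le0// opprB.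
have -> : expR (- y) = expR (- x) * expR (x - y) by rewrite -expRD; congr expR; ring.
rewrite -[X in X - _]mulr1 -mulrBr.
apply: (@le_trans _ _ (1 * (1 - expR (x - y)))).
  apply: ler_wpM2r; first by rewrite subr_ge0 -[leRHS]expR0 ler_expR subr_le0.
  by rewrite -[leRHS]expR0 ler_expR oppr_le0.
by have := expR_ge1Dx (x - y); lra.
Qed.

Lemma expR_neg_le_inv (x : R) : 0 < x -> expR (- x) <= x^-1.
Proof.
move=> x0; rewrite expRN lef_pV2 ?posrE ?expR_gt0//.
by have := expR_ge1Dx x; lra.
Qed.

(** [(3 / 4)^q (q + 3)] is nonincreasing and starts at 3. The weak rate is all that is needed for
    [O(1 / n)]. *)
Lemma three_quarters_pow (q : nat) : (3 / 4 : R) ^+ q <= 3 / q.+1%:R.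
Proof.
have key : (3 / 4 : R) ^+ q * (q%:R + 3) <= 3.
  elim: q => [|q IH]; first by rewrite expr0; lra.
  apply: le_trans IH; rewrite exprSr -mulrA ler_wpM2l ?exprn_ge0//.
  by rewrite -natr1; have := ler0n R q; lra.
rewrite ler_pdivlMr ?ltr0n//; apply: le_trans key.
by rewrite ler_wpM2l ?exprn_ge0// -natr1 lerD2l; lra.
Qed.

(** Each of the [n] cells contributes at most [C / n]. The unnormalised error stays bounded, so
    exponents built from such sums are off by [O(t)] only. *)
Lemma riemann_sum (f : R -> R) (C : R) n : (0 < n)%N ->
  (forall x y, `|f x - f y| <= C * `|x - y|) ->
  `|\sum_(i < n) f (i.+1%:R / n%:R) - n%:R * \int[leb]_(u in `[0, 1]) f u| <= C.
Proof.
move=> n0 hf; have nR : 0 < n%:R :> R by rewrite ltr0n.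
have cf : continuous f by exact: lipschitz_continuous hf.
have C0 : 0 <= C by have := hf 1 0; rewrite subr0 normr1 mulr1; apply: le_trans.
have ii (x y : R) : leb.-integrable `[x, y] (EFin \o f) by exact: continuous_itv_integrable.
have key k : `|\sum_(i < k) f (i.+1%:R / n%:R) - n%:R * \int[leb]_(u in `[0, k%:R / n%:R]) f u|
    <= k%:R * (C / n%:R).
  elim: k => [|k IH].
    by rewrite big_ord0 !mul0r set_itv1 Rintegral_set1 mulr0 subrr normr0.
  set xk : R := k%:R / n%:R in IH *; set y : R := k.+1%:R / n%:R.
  have xk0 : 0 <= xk by rewrite divr_ge0.
  have yx : y = xk + n%:R^-1 by rewrite /y /xk -natr1 mulrDl mul1r.
  have xy : xk < y by rewrite yx ltrDl invr_gt0.
  have step : \int[leb]_(u in `[0, y]) f u - \int[leb]_(u in `[0, xk]) f u =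
      \int[leb]_(u in `[xk, y]) f u.
    rewrite Rintegral_itvB ?bnd_simp//; last exact: ltW.
    rewrite Rintegral_itv_obnd_cbnd//; apply: (integrableS _ _ _ (ii xk y)) => //.
    exact: subset_itv_oc_cc.
  have vol : fine (leb `[xk, y]) = n%:R^-1.
    by rewrite lebesgue_measure_itv/= lte_fin xy -EFinD /= yx; ring.
  have icst (z : R) : leb.-integrable `[xk, y] (EFin \o (fun _ : R => z)).
    by apply: continuous_itv_integrable => t; exact: cvg_cst.
  have loc : `|f y * n%:R^-1 - \int[leb]_(u in `[xk, y]) f u| <= C / n%:R * n%:R^-1.
    rewrite -{1}vol -Rintegral_cst// -(RintegralB _ (icst (f y)) (ii xk y))//.
    have iB : leb.-integrable `[xk, y] (EFin \o (fun u => f y - f u)).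
      by apply: continuous_itv_integrable => t; apply: cvgB; [exact: cvg_cst|exact: cf].
    rewrite (le_trans (le_normr_Rintegral _ iB))// -{2}vol -Rintegral_cst//.
    apply: le_Rintegral => //; first exact: (integrable_norm iB).
    move=> u /=; rewrite in_itv/= => /andP[u1 u2]; rewrite (le_trans (hf _ _))//.
    by rewrite ler_wpM2l// ger0_norm ?subr_ge0// lerBlDl yx lerD2r.
  rewrite big_ord_recr /= -/y.
  rewrite (_ : _ - _ = (\sum_(i < k) f (i.+1%:R / n%:R) - n%:R * \int[leb]_(u in `[0, xk]) f u)
    + n%:R * (f y * n%:R^-1 - \int[leb]_(u in `[xk, y]) f u)); last first.
    by rewrite -step; field; rewrite gt_eqF.
  rewrite (le_trans (ler_normD _ _))// -natr1 mulrDl mul1r lerD//.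
  rewrite normrM (gtr0_norm nR) (le_trans (ler_wpM2l (ltW nR) loc))//.
  by rewrite mulrCA mulfV ?mulr1// gt_eqF.
have := key n; rewrite divff ?gt_eqF// mulrCA divff ?gt_eqF// mulr1.
exact.
Qed.

(** A Cauchy profile of width [rho / sqrt n], with primitive an arctangent; the bound does not
    depend on [n] or [T], and [pi / 2 <= 2]. *)
Lemma Rint_cauchy_density (rho T : R) (n : nat) : 0 < rho -> 0 < T -> (0 < n)%N ->
  leb.-integrable `[0, T] (EFin \o (fun t => (rho ^+ 2 + n%:R * t ^+ 2)^-1)) /\
  Num.sqrt n%:R * \int[leb]_(t in `[0, T]) (rho ^+ 2 + n%:R * t ^+ 2)^-1 <= 2 / rho.
Proof.
move=> rho0 T0 n0; pose q := Num.sqrt n%:R : R.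
have q0 : 0 < q by rewrite sqrtr_gt0 ltr0n.
have qq : n%:R = q ^+ 2 :> R by rewrite sqr_sqrtr.
have den (t : R) : 0 < rho ^+ 2 + n%:R * t ^+ 2.
  by rewrite ltr_wpDr ?exprn_gt0// mulr_ge0 ?sqr_ge0.
have cd : continuous (fun t : R => (rho ^+ 2 + n%:R * t ^+ 2)^-1).
  move=> t; apply: cvgV; first by rewrite gt_eqF.
  apply: cvgD; first exact: cvg_cst.
  by apply: cvgM; [exact: cvg_cst|exact: exprn_continuous].
split; first exact: continuous_itv_integrable.
have dF (t : R) : is_derive t 1 (fun t : R => (rho * q)^-1 * atan (q / rho * t))
    (rho ^+ 2 + n%:R * t ^+ 2)^-1.
  apply: is_derive_eq; rewrite /GRing.scale/= qq; field.
  by rewrite (gt_eqF rho0) (gt_eqF q0) !andbT gt_eqF// ltr_wpDr ?exprn_gt0// sqr_ge0.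
rewrite (Rint_itv_FTC2 (ltW T0) dF cd) mulr0 atan0 mulr0 subr0 -/q.
have : atan (q / rho * T) <= 2 by rewrite (le_trans (ltW (atan_ltpi2 _)))// ltW// pihalf_lt2.
move: (atan _) => z z2; rewrite (_ : q * _ = z / rho); last by field; rewrite !gt_eqF.
by rewrite ler_pM2r ?invr_gt0.
Qed.

End riemann_sums.

(** * Operator products against the normal characteristic function *)

Section characteristic_asymptotics.
Context {R : realType} {d : measure_display} {T : measurableType d}.
Local Notation leb := (@lebesgue_measure R).
Variables (Q : R -> R.-pker T ~> T) (g : R -> T -> R) (m : nat) (r L : R).
Hypothesis hr : 0 <= r < 1.
Hypothesis L0 : 0 <= L.
Hypothesis Qosc : forall u, osc_contraction (Q u) m r.
Hypothesis Qclip : forall u v (F : T -> R[i]) (M : R) x, bounded_measurable F ->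
  (forall x, normc (F x) <= M) ->
  normc (cop (Q u) F x - cop (Q v) F x) <= L * `|u - v| * M.
Hypothesis hg : lipf g.
Hypothesis rho_lt1 : forall u t, 0 <= u <= 1 -> t != 0 ->
  (spectral_radius (tw (Q u) (g u) t) < 1)%E.
Variables (a s : R -> R) (h w : R -> T -> R) (c0 : R).
Hypothesis c00 : 0 < c0.
Hypothesis s_ge : forall u, c0 <= s u.
Hypothesis la : lipf (fun u (_ : T) => a u).
Hypothesis ls : lipf (fun u (_ : T) => s u).
Hypothesis lh : lipf h.
Hypothesis lw : lipf w.
Hypothesis E1 : forall u x, op (Q u) (fun y => (g u y - a u) + h u y) x = h u x.
Hypothesis E2 : forall u x, op (Q u)
  (fun y => (g u y - a u) ^+ 2 / 2 + (g u y - a u) * h u y + w u y) x = w u x + s u / 2.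

Let b := \int[leb]_(u in `[0, 1]) a u.
Let sg := \int[leb]_(u in `[0, 1]) s u.
Let gam n t := eit (t * (b * n%:R)) * (expR (- ((Num.sqrt sg * Num.sqrt n%:R * t) ^+ 2 / 2)))%:C%C.
Let Phi n t := prodtw Q g (fun k => k%:R / n%:R) t 0 n (fun=> 1).

Lemma lipf_cst_lipschitz (f : R -> R) : lipf (fun u (_ : T) => f u) ->
  exists C : R, 0 <= C /\ forall u v, `|f u - f v| <= C * `|u - v|.
Proof. by move=> [C [C0 _ _ hC]]; exists C; split=> // u v; exact: hC u v point. Qed.

Lemma integrated_variance_ge : c0 <= sg.
Proof.
have [C [C0 hC]] := lipf_cst_lipschitz ls.
have cs : continuous s by exact: lipschitz_continuous hC.
have -> : c0 = \int[leb]_(u in `[0, 1]) c0.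
  by rewrite Rintegral_cst//= lebesgue_measure_itv/= lte01 oppr0 adde0 mulr1.
apply: le_Rintegral => //; last exact: continuous_itv_integrable.
by apply: continuous_itv_integrable => t; exact: cvg_cst.
Qed.

Lemma gamE n t : gam n t = eit (t * (b * n%:R)) * (expR (- (t ^+ 2 * (n%:R * sg) / 2)))%:C%C.
Proof.
have sg0 : 0 <= sg by apply: le_trans integrated_variance_ge; exact: ltW.
rewrite /gam !exprMn !sqr_sqrtr//; congr (_ * (expR _)%:C%C); ring.
Qed.

Lemma normc_gam n t : normc (gam n t) = expR (- (t ^+ 2 * (n%:R * sg) / 2)).
Proof. by rewrite gamE Normc.normcM normc_eit mul1r normc_real ger0_norm ?expR_ge0. Qed.

Lemma LamE us t n : Lam a s us t 0 n = eit (t * \sum_(i < n) a (us i.+1)) *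
  (expR (- (t ^+ 2 * (\sum_(i < n) s (us i.+1)) / 2)))%:C%C.
Proof.
rewrite /Lam; elim: n => [|n IH].
  by rewrite !big_ord0 !mulr0 eit0 mul0r oppr0 expR0 mul1r.
rewrite !big_ord_recr /= IH /lam add0n mulrDr eitD.
have -> : - (t ^+ 2 * (\sum_(i < n) s (us i.+1) + s (us n.+1)) / 2) =
  - (t ^+ 2 * (\sum_(i < n) s (us i.+1)) / 2) - (t ^+ 2 * s (us n.+1) / 2) by ring.
by rewrite expRD rmorphM mulrACA.
Qed.

Lemma Lam_gam : exists C : R, 0 <= C /\ forall n t, (0 < n)%N -> 0 <= t <= 1 ->
  normc (Lam a s (fun k => k%:R / n%:R) t 0 n - gam n t) <= C * t.
Proof.
have [Ca [Ca0 hCa]] := lipf_cst_lipschitz la; have [Cs [Cs0 hCs]] := lipf_cst_lipschitz ls.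
exists (Ca + Cs); split; first exact: addr_ge0.
move=> n t n0 /andP[t0 t1]; rewrite LamE gamE.
have Ra := riemann_sum n0 hCa; have Rs := riemann_sum n0 hCs.
set A := \sum_(i < n) _ in Ra *; set B := \sum_(i < n) _ in Rs *.
have B0 : 0 <= B by apply: sumr_ge0 => i _; apply: le_trans (s_ge _); exact: ltW.
have ns : 0 <= n%:R * sg.
  by rewrite mulr_ge0//; apply: le_trans integrated_variance_ge; exact: ltW.
set x := t ^+ 2 * B / 2; set y := t ^+ 2 * (n%:R * sg) / 2.
have x0 : 0 <= x by rewrite divr_ge0// mulr_ge0// sqr_ge0.
have y0 : 0 <= y by rewrite divr_ge0// mulr_ge0// sqr_ge0.
rewrite (_ : _ - _ = (eit (t * A) - eit (t * (b * n%:R))) * (expR (- x))%:C%C +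
  eit (t * (b * n%:R)) * (expR (- x) - expR (- y))%:C%C); last first.
  by rewrite rmorphB /=; ring.
rewrite (le_trans (ler_normcD _ _))// [leRHS]mulrDl lerD// Normc.normcM normc_real.
  rewrite ger0_norm ?expR_ge0//; apply: (@le_trans _ _ (Ca * t * 1)); last by rewrite mulr1.
  apply: ler_pM => //; rewrite ?normc_ge0 ?expR_ge0//; last first.
    by rewrite -[leRHS]expR0 ler_expR oppr_le0.
  rewrite (le_trans (eit_lip _ _))// -mulrBr normrM (ger0_norm t0) mulrC ler_wpM2r//.
  by rewrite [b * _]mulrC.
rewrite normc_eit mul1r (le_trans (expR_neg_lip x0 y0))//.
rewrite (_ : x - y = t * (t / 2 * (B - n%:R * sg))); last by rewrite /x /y; field.
rewrite normrM (ger0_norm t0) mulrC ler_wpM2r// normrM ger0_norm ?divr_ge0//.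
rewrite -[leRHS]mul1r ler_pM// ?divr_ge0//; lra.
Qed.

Lemma Phi_near : exists C : R, 0 <= C /\ forall n t x, (0 < n)%N -> 0 <= t <= 1 ->
  normc (Phi n t x - gam n t) <= C * (t + n%:R * t ^+ 3).
Proof.
have [C1 [C10 H1]] := product_expansion hg c00 s_ge la ls lh lw E1 E2.
have [C2 [C20 H2]] := Lam_gam.
exists (2 * C1 + C2); split; first by rewrite addr_ge0// mulr_ge0.
move=> n t x n0 /andP[t0 t1]; have nR : 0 < n%:R :> R by rewrite ltr0n.
set us := fun k : nat => k%:R / n%:R : R.
have hus i : `|us i.+1 - us i| <= n%:R^-1.
  by rewrite /us -natr1 -mulrBl addrAC subrr add0r mul1r ger0_norm// invr_ge0.
have A1 := H1 us n%:R^-1 t 0 n x _ hus; rewrite (ger0_norm t0) in A1.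
have {}A1 := A1 t1; rewrite [n%:R * t]mulrC mulfK ?gt_eqF// in A1.
have A2 := H2 n t n0 (introT andP (conj t0 t1)).
rewrite /Phi -(subrK (Lam a s us t 0 n) (prodtw _ _ _ _ _ _ _ _)) -addrA.
rewrite (le_trans (ler_normcD _ _))// (le_trans (lerD A1 A2))//.
have t3 : 0 <= n%:R * t ^+ 3 by rewrite mulr_ge0// exprn_ge0.
by have := mulr_ge0 C10 t3; have := mulr_ge0 C20 t3; lra.
Qed.

Lemma gam_le n t : (0 < n)%N -> 0 < t -> normc (gam n t) <= 2 / c0 / (n%:R * t ^+ 2).
Proof.
move=> n0 t0; have nR : 0 < n%:R :> R by rewrite ltr0n.
have sg0 : 0 < sg by apply: lt_le_trans c00 integrated_variance_ge.
have t2 : 0 < t ^+ 2 by rewrite exprn_gt0.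
rewrite normc_gam (le_trans (expR_neg_le_inv _))//.
  by rewrite divr_gt0// !mulr_gt0.
rewrite (_ : (t ^+ 2 * (n%:R * sg) / 2)^-1 = 2 / sg / (n%:R * t ^+ 2)); last first.
  by field; rewrite !gt_eqF.
rewrite ler_pM2r; last by rewrite invr_gt0; exact: mulr_gt0.
by rewrite ler_pM2l// lef_pV2 ?posrE//; exact: integrated_variance_ge.
Qed.

Lemma Phi_mid : exists del C : R, [/\ 0 < del, 0 <= C & forall n t x, (0 < n)%N ->
  0 < t <= del -> normc (Phi n t x - gam n t) <= C / (n%:R * t ^+ 2)].
Proof.
have [del [C [del0 C0 H]]] := decay_near_zero hr L0 Qosc Qclip hg c00 s_ge la ls lh lw E1 E2.
exists del, (C + 2 / c0); split=> //; first by rewrite addr_ge0// divr_ge0// ltW.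
move=> n t x n0 ht; have /andP[t0 _] := ht.
rewrite mulrDl (le_trans (ler_normcB _ _))// lerD ?gam_le//.
have := H n t n0 ht (fun=> 1) 1 (bmC_cst 1) _ x; rewrite mulr1; apply => y.
by rewrite Normc.normc1.
Qed.

Lemma Phi_far (del T0 : R) : 0 < del -> exists (E : R) (N : nat), 0 <= E /\
  forall n t x, (N < n)%N -> del <= t <= T0 -> normc (Phi n t x - gam n t) <= E / n%:R.
Proof.
move=> del0; have [l [N [l0 H]]] := decay_away_from_zero L0 Qclip hg rho_lt1 T0 del0.
have d2 : 0 < del ^+ 2 by rewrite exprn_gt0.
exists (3 * l%:R + 2 / c0 / del ^+ 2), N; split.
  apply: addr_ge0; first exact: mulr_ge0.
  by apply: divr_ge0; [apply: divr_ge0|]; rewrite ?ltW.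
move=> n t x Nn ht; have /andP[dt tT] := ht.
have n0 : (0 < n)%N by exact: leq_ltn_trans Nn.
have nR : 0 < n%:R :> R by rewrite ltr0n.
have t0 : 0 < t by exact: lt_le_trans dt.
rewrite mulrDl (le_trans (ler_normcB _ _))// lerD//; last first.
  rewrite (le_trans (gam_le n0 t0))//.
  rewrite (_ : _ / n%:R = 2 / c0 * (n%:R * del ^+ 2)^-1); last by field; rewrite !gt_eqF.
  rewrite ler_wpM2l ?divr_ge0 ?(ltW c00)// lef_pV2 ?posrE; last 2 first.
  - by apply: mulr_gt0 => //; rewrite exprn_gt0.
  - exact: mulr_gt0.
  by rewrite ler_pM2l// ler_sqr ?nnegrE ?(ltW t0) ?(ltW del0).
have A := H n t (ltnW Nn) ht (fun=> 1) 1 (bmC_cst 1) _ x.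
rewrite mulr1 in A; apply: (le_trans (A _)); first by move=> y; rewrite Normc.normc1.
rewrite (le_trans (three_quarters_pow _))// -mulrA ler_wpM2l// ler_pdivlMr//.
rewrite mulrC ler_pdivrMr ?ltr0n// -natrM ler_nat mulnC.
by rewrite ltnW// ltn_ceil.
Qed.

(** A single majorant [A / (rho^2 + n t^2) + E / n] covers the ranges [sqrt n t <= rho], [t < del]
    and [t >= del]. Its integral, scaled by [sqrt n], is at most [4 C2 / rho + K / sqrt n]. *)
Lemma characteristic_close (T0 e : R) : 0 < T0 -> 0 < e ->
  exists N, forall n, (N <= n)%N -> exists D : R -> R,
    [/\ leb.-integrable `[0, T0] (EFin \o D),
        forall t, 0 <= t <= T0 -> forall x, normc (Phi n t x - gam n t) <= D t &
        Num.sqrt n%:R * \int[leb]_(t in `[0, T0]) D t <= e].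
Proof.
move=> T00 e0; have [C1 [C10 near]] := Phi_near.
have [del [C2 [del0 C20 mid]]] := Phi_mid.
have [E [N1 [E0 far]]] := Phi_far T0 del0.
pose rho := 1 + 8 * C2 / e.
have rho1 : 1 <= rho by rewrite lerDl divr_ge0 ?mulr_ge0// ltW.
have rho0 : 0 < rho by lra.
(* On [sqrt n t <= rho] the expansion error is at most [C1 rho (1 + rho^2) / sqrt n], and
   [rho^2 + n t^2 <= 2 rho^2]. *)
pose A1 := 2 * C1 * rho ^+ 3 * (1 + rho ^+ 2).
have A10 : 0 <= A1.
  apply: mulr_ge0; last by rewrite addr_ge0 ?sqr_ge0.
  by apply: mulr_ge0; [exact: mulr_ge0|rewrite exprn_ge0// ltW].
pose K := A1 * 2 / rho + T0 * E.
have K0 : 0 <= K by apply: addr_ge0; [apply: divr_ge0; [exact: mulr_ge0|exact: ltW]|apply: mulr_ge0 => //; exact: ltW].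
(* [sqrt n >= rho] forces [t <= 1] on the innermost range, and [sqrt n >= 2 K / e] leaves [e / 2]
   for the remainder. *)
pose y := rho + 2 * K / e.
have y0 : 0 <= y.
  by apply: addr_ge0; [exact: ltW|apply: divr_ge0; [exact: mulr_ge0|exact: ltW]].
exists ((Num.truncn (y ^+ 2)).+1 + N1.+1)%N => n nN.
have nN1 : (N1 < n)%N by move: nN; clear; lia.
have n0 : (0 < n)%N by exact: leq_ltn_trans nN1.
have nR : 0 < n%:R :> R by rewrite ltr0n.
pose q := Num.sqrt n%:R : R; have q0 : 0 < q by rewrite sqrtr_gt0.
have qq : n%:R = q ^+ 2 :> R by rewrite sqr_sqrtr.
have yq : y <= q.
  rewrite -(ger0_norm y0) -sqrtr_sqr ler_wsqrtr// (le_trans (ltW (truncnS_gt _)))//.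
  by rewrite ler_nat (leq_trans (leq_addr _ _) nN).
(* The factor 2 is due to [rho^2 + z^2 <= 2 z^2] for [z = sqrt n t >= rho]. *)
pose A := 2 * C2 + A1 / q.
have A0 : 0 <= A by apply: addr_ge0; [exact: mulr_ge0|apply: divr_ge0 => //; exact: ltW].
have [iD ID] := Rint_cauchy_density rho0 T00 n0.
have mT : measurable (`[0, T0]%classic : set (measurableTypeR R)) by exact: measurable_itv.
have i1 : leb.-integrable `[0, T0] (EFin \o (fun t => A * (rho ^+ 2 + n%:R * t ^+ 2)^-1)).
  exact: (integrableZl mT A iD).
have i2 : leb.-integrable `[0, T0] (EFin \o (fun _ : R => E / n%:R)).
  by apply: continuous_itv_integrable => t; exact: cvg_cst.
exists (fun t => A * (rho ^+ 2 + n%:R * t ^+ 2)^-1 + E / n%:R); split.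
- exact: (integrableD mT i1 i2).
- move=> t /andP[t0 tT] x.
  have den : 0 < rho ^+ 2 + n%:R * t ^+ 2.
    by rewrite ltr_wpDr ?exprn_gt0// mulr_ge0 ?sqr_ge0.
  have En : 0 <= E / n%:R by rewrite divr_ge0.
  have Ad : 0 <= A * (rho ^+ 2 + n%:R * t ^+ 2)^-1 by rewrite mulr_ge0// invr_ge0 ltW.
  have [dt|td] := leP del t.
    by rewrite (le_trans (far n t x nN1 (introT andP (conj dt tT))))// lerDr.
  have [qt|tq] := leP (q * t) rho.
    have t1 : t <= 1 by rewrite -(ler_pM2l q0) mulr1 (le_trans qt)// (le_trans _ yq)// lerDl
      divr_ge0 ?mulr_ge0// ltW.
    apply: (le_trans (near n t x n0 (introT andP (conj t0 t1)))).
    apply: (@le_trans _ _ (A * (rho ^+ 2 + n%:R * t ^+ 2)^-1)); last by rewrite lerDl.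
    rewrite (_ : n%:R * t ^+ 2 = (q * t) ^+ 2) in den *; last by rewrite qq exprMn.
    rewrite (_ : t + n%:R * t ^+ 3 = (q * t) * (1 + (q * t) ^+ 2) / q); last first.
      by rewrite qq; field; rewrite gt_eqF.
    have z0 : 0 <= q * t by rewrite mulr_ge0// ltW.
    move: (q * t) z0 qt den => z z0 zr den.
    have z2 : z ^+ 2 <= rho ^+ 2 by rewrite ler_sqr ?nnegrE// ltW.
    apply: (@le_trans _ _ (A1 / q * (2 * rho ^+ 2)^-1)); last first.
      have Aq : 0 <= A1 / q by apply: divr_ge0 => //; exact: ltW.
      have r2 : 0 <= (2 * rho ^+ 2)^-1 by rewrite invr_ge0; apply: mulr_ge0; rewrite ?sqr_ge0.
      apply: ler_pM => //; first by rewrite /A lerDr; exact: mulr_ge0.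
      rewrite lef_pV2 ?posrE//; first by rewrite mulrDl !mul1r lerD2l.
      by rewrite mulr_gt0// exprn_gt0.
    rewrite (_ : A1 / q * (2 * rho ^+ 2)^-1 = C1 * (rho * (1 + rho ^+ 2) / q)); last first.
      by rewrite /A1; field; rewrite !gt_eqF.
    rewrite ler_wpM2l// ler_wpM2r ?invr_ge0 ?(ltW q0)//.
    by apply: ler_pM => //; rewrite ?lerD2l// addr_ge0// sqr_ge0.
  have t00 : 0 < t by rewrite -(pmulr_rgt0 _ q0) (lt_trans rho0).
  apply: (le_trans (mid n t x n0 (introT andP (conj t00 (ltW td))))).
  apply: (@le_trans _ _ (A * (rho ^+ 2 + n%:R * t ^+ 2)^-1)); last by rewrite lerDl.
  rewrite (_ : n%:R * t ^+ 2 = (q * t) ^+ 2) in den *; last by rewrite qq exprMn.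
  move: (q * t) tq den => z zr den; have z0 : 0 < z by exact: lt_trans zr.
  have z2 : rho ^+ 2 <= z ^+ 2 by rewrite ler_sqr ?nnegrE ltW.
  have zz : 0 < z ^+ 2 by rewrite exprn_gt0.
  apply: (@le_trans _ _ (2 * C2 * (rho ^+ 2 + z ^+ 2)^-1)); last first.
    by rewrite ler_wpM2r ?invr_ge0 ?(ltW den)// /A lerDl divr_ge0// ltW.
  rewrite [2 * C2]mulrC -mulrA ler_wpM2l// -[(z ^+ 2)^-1]div1r.
  by rewrite ler_pdivrMr// mulrAC ler_pdivlMr// mul1r; lra.
- rewrite (RintegralD mT i1 i2) (RintegralZl _ mT iD).
  rewrite Rintegral_cst//= lebesgue_measure_itv/= lte_fin T00 -EFinD /= subr0.
  rewrite mulrDr mulrCA -/q; apply: (@le_trans _ _ (A * (2 / rho) + q * (E / n%:R * T0))).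
    by rewrite lerD2r ler_wpM2l.
  have -> : A * (2 / rho) + q * (E / n%:R * T0) = 4 * C2 / rho + K / q.
    by rewrite qq /A /K; field; rewrite !gt_eqF.
  rewrite [leRHS](splitr e) lerD//.
    rewrite ler_pdivrMr//; apply: (@le_trans _ _ (e / 2 * (8 * C2 / e))).
      rewrite (_ : e / 2 * (8 * C2 / e) = 4 * C2)//; field; exact: lt0r_neq0.
    by rewrite ler_pM2l ?divr_gt0// lerDr.
  rewrite ler_pdivrMr//; apply: (@le_trans _ _ (e / 2 * (2 * K / e))).
    rewrite (_ : e / 2 * (2 * K / e) = K)//; field; exact: lt0r_neq0.
  by rewrite ler_pM2l ?divr_gt0// (le_trans _ yq)// lerDr ltW.
Qed.

End characteristic_asymptotics.

(** * The local limit theorem *)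

Section clipping.
Context {R : realType}.

(* The hypotheses only concern parameters in [0, 1]; composing with [clip] extends them to all
   real parameters. *)
Definition clip (u : R) : R := Num.max 0 (Num.min 1 u).

Lemma clip_itv u : 0 <= clip u <= 1.
Proof. by rewrite le_max lexx ge_max ler01 ge_min lexx. Qed.

Lemma clip_id u : 0 <= u <= 1 -> clip u = u.
Proof. by move=> /andP[u0 u1]; rewrite /clip (min_idPr u1); apply/max_idPr. Qed.

Lemma clip_lip u v : `|clip u - clip v| <= `|u - v|.
Proof.
wlog uv : u v / v <= u.
  by move=> H; have [/H//|/ltW/H] := leP v u; rewrite distrC [`|v - u|]distrC.
rewrite (@ger0_norm _ (u - v)) ?subr_ge0//.
have E (z : R) : [\/ z <= 0 /\ clip z = 0, 0 <= z <= 1 /\ clip z = z | 1 <= z /\ clip z = 1].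
  have /orP[z0|z0] := le_total z 0.
    by constructor 1; split=> //; apply/max_idPl; rewrite ge_min z0 orbT.
  have /orP[z1|z1] := le_total z 1.
    by constructor 2; split; rewrite ?z0 ?z1// clip_id ?z0.
  by constructor 3; rewrite /clip (min_idPl z1); split=> //; apply/max_idPr.
by case: (E u) => -[hu ->]; case: (E v) => -[hv ->]; rewrite ger0_norm; lra.
Qed.

Lemma clip_div n k : (0 < n)%N -> (k <= n)%N -> clip (k%:R / n%:R) = k%:R / n%:R.
Proof.
move=> n0 kn; apply: clip_id; rewrite divr_ge0//= ler_pdivrMr ?ltr0n// mul1r.
by rewrite ler_nat.
Qed.

End clipping.

(** Subtracting the value [f x] turns the oscillation bound [D] into a supremum bound, so [r] itself
    is the contraction factor. *)
Lemma osc_contraction_tv (R : realType) (d : measure_display) (T : measurableType d)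
    (k : R.-pker T ~> T) (m : nat) (r : R) :
  (forall x y, (tv_norm (kernel_iter k m x) (kernel_iter k m y) <= r%:E)%E) ->
  osc_contraction k m r.
Proof.
move=> hk f D bf fD x y; rewrite -!Rint_kernel_iter//.
pose f0 z := f z - f x; have bf0 : bmr f0 by apply: bmrB => //; exact: bmr_cst.
have k1 z := kernel_iter_setT k m z.
have := tv_norm_Rint (k1 x) (k1 y) (hk x y) bf0 (fun z => fD z x).
rewrite /f0 !RintB//; try exact: bmr_cst.
by rewrite !Rint_cst// opprB addrA subrK.
Qed.

Lemma cvg_ereal_sup0 (R : realType) (I : Type) (f : nat -> I -> R) :
  (exists i : I, True) ->
  (forall n i, 0 <= f n i) ->
  (forall e : R, 0 < e -> exists N, forall n, (N <= n)%N -> forall i, f n i <= e) ->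
  (fun n => ereal_sup (range (fun i => (f n i)%:E))) @ \oo --> 0%E.
Proof.
move=> [i0 _] f0 hf; pose U n := ereal_sup (range (fun i => (f n i)%:E)).
have U0 n : (0 <= U n)%E.
  by apply: (@le_trans _ _ (f n i0)%:E); [rewrite lee_fin|apply: ereal_sup_ubound; exists i0].
have Ue n (e : R) : (forall i, f n i <= e) -> (U n <= e%:E)%E.
  by move=> h; apply: ge_ereal_sup => _ [i _ <-]; rewrite lee_fin.
have Uf n (e : R) : (forall i, f n i <= e) -> U n \is a fin_num.
  by move=> /Ue h; rewrite ge0_fin_numE// (le_lt_trans h) ?ltry.
apply/fine_cvgP; split.
  by have [N hN] := hf 1 ltr01; exists N => // n /= nN; exact: Uf (hN n nN).
apply/cvgrPdist_le => e e0; have [N hN] := hf e e0; exists N => // n /= nN.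
rewrite sub0r normrN ger0_norm; last exact: fine_ge0 (U0 n).
by rewrite -lee_fin fineK ?(Uf n e (hN n nN))//; exact: Ue (hN n nN).
Qed.

(** * Assembly under the hypotheses of the theorem *)

Section local_limit_theorem.
Context {R : realType} {d : measure_display} {T : measurableType d}.
Local Notation leb := (@lebesgue_measure R).
Variables (Q : R -> R.-pker T ~> T) (g : R -> T -> R) (pi_ : R -> probability T R).
Hypothesis hpi : forall u : R, 0 <= u <= 1 -> invariant_measure (Q u) (pi_ u).
Variables (dX : nat -> measure_display) (OX : forall n, measurableType (dX n)).
Variables (PX : forall n, probability (OX n) R) (X : forall n, nat -> OX n -> T).
Hypothesis hX : forall n, (1 <= n)%N ->
  markov_chain n (PX n) (pi_ 0) (fun k => Q (k%:R / n%:R)) (@X n).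
Variables (dY : R -> measure_display) (OY : forall u, measurableType (dY u)).
Variables (PY : forall u, probability (OY u) R) (Y : forall u, nat -> OY u -> T).
Hypothesis hY : forall u : R, 0 <= u <= 1 -> forall N,
  markov_chain N (PY u) (pi_ u) (fun=> Q u) (@Y u).
Hypothesis g_meas : measurable_fun (`[0%R : R, 1%R] `*` [set: T])
  (fun p : measurableTypeR R * T => g p.1 p.2).
Variables (L : R) (m : nat) (r K Cg : R).
Hypothesis hL : 0 < L.
Hypothesis h_i : forall u v : R, 0 <= u <= 1 -> 0 <= v <= 1 -> forall x,
  (tv_norm (Q u x) (Q v x) <= (L * `|u - v|)%:E)%E.
Hypothesis hr : 0 < r < 1.
Hypothesis h_ii : forall u : R, 0 <= u <= 1 -> forall x y,
  (tv_norm (kernel_iter (Q u) m x) (kernel_iter (Q u) m y) <= r%:E)%E.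
Hypothesis h_iii : forall u : R, 0 <= u <= 1 -> forall x, `|g u x| <= K.
Hypothesis hCg : 0 <= Cg.
Hypothesis h_iv : forall u v : R, 0 <= u <= 1 -> 0 <= v <= 1 -> forall x,
  `|g u x - g v x| <= Cg * `|u - v|.
Hypothesis h_v : forall u : R, 0 <= u <= 1 -> forall t : R, t != 0 ->
  (spectral_radius (twisted (Q u) (g u) (Complex 0 t)%R) < 1)%E.

Let Qc u := Q (clip u).
Let gc u := g (clip u).
Let b := \int[leb]_(u in `[0, 1]) \int[pi_ u]_x g u x.
Let av u := asymptotic_variance (PY u) (g u) (@Y u).
Let a := Num.sqrt (\int[leb]_(u in `[0, 1]) av u).
Let Sn n w := \sum_(1 <= k < n.+1) g (k%:R / n%:R) (@X n k w).

Let bg u : 0 <= u <= 1 -> bmr (g u).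
Proof.
move=> u01; split; last by exists K; exact: h_iii.
apply: (measurable_comp _ _ g_meas (pair1_measurable u)) => //=.
  by apply: measurableX => //; exact: measurable_itv.
by move=> _ [x _ <-]; split=> //=; rewrite in_itv.
Qed.

Let lg : lipf gc.
Proof.
exists (`|K| + Cg); split; first by rewrite addr_ge0.
- by move=> u; apply: bg; exact: clip_itv.
- move=> u x; rewrite (le_trans (h_iii (clip_itv u) x))//.
  by rewrite (le_trans (ler_norm K))// lerDl.
- move=> u v x; rewrite (le_trans (h_iv (clip_itv u) (clip_itv v) x))//.
  by rewrite ler_pM// ?clip_lip// lerDr.
Qed.

Let Qdist u v x : (tv_norm (Qc u x) (Qc v x) <= (L * `|u - v|)%:E)%E.
Proof.
apply: (le_trans (h_i (clip_itv u) (clip_itv v) x)).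
by rewrite lee_fin ler_wpM2l ?clip_lip// ltW.
Qed.

Let Q1 u x : Qc u x setT = 1%E.
Proof. exact: prob_kernel. Qed.

Let Qlip u v (f : T -> R) (M : R) x : bmr f -> (forall x, `|f x| <= M) ->
  `|op (Qc u) f x - op (Qc v) f x| <= L * `|u - v| * M.
Proof. by move=> bf fM; exact: (tv_norm_Rint (Q1 u x) (Q1 v x) (Qdist u v x) bf fM). Qed.

Let Qclip u v (F : T -> R[i]) (M : R) x : bounded_measurable F ->
  (forall x, normc (F x) <= M) ->
  normc (cop (Qc u) F x - cop (Qc v) F x) <= L * `|u - v| * M.
Proof. by move=> bF FM; exact: (tv_norm_cint (Q1 u x) (Q1 v x) (Qdist u v x) bF FM). Qed.

Let Qosc u : osc_contraction (Qc u) m r.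
Proof. by apply: osc_contraction_tv => x y; apply: h_ii; exact: clip_itv. Qed.

Let hr' : 0 <= r < 1.
Proof. by have /andP[r0 ->] := hr; rewrite ltW. Qed.

Let spec u t : 0 <= u <= 1 -> t != 0 -> (spectral_radius (tw (Qc u) (gc u) t) < 1)%E.
Proof.
move=> u01 t0; rewrite /Qc /gc (clip_id u01).
have -> : tw (Q u) (g u) t = twisted (Q u) (g u) (Complex 0 t).
  by apply/funext => F; rewrite twistedE.
exact: h_v.
Qed.

Let mX n : (1 <= n)%N -> markov_chain n (PX n) (pi_ 0) (fun k => Qc (k%:R / n%:R)) (@X n).
Proof.
move=> n1; have [h1 h2 h3] := hX n1; split=> // k kn H A pH mA.
by rewrite /Qc clip_div//; exact: h3.
Qed.

Theorem local_limit (G : R -> R) : test_function G ->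
  (fun n : nat => ereal_sup (range (fun v : R =>
     `| a * Num.sqrt (2 * pi * n%:R) * fine 'E_(PX n)[fun w => G (@Sn n w - v)]
        - (\int[leb]_x G x)
          * expR (- (v - b * n%:R) ^+ 2 / (2 * n%:R * a ^+ 2)) |%:E)))
    @ \oo --> 0%E.
Proof.
move=> hG; have [al [s [h [w [la ls lh lw [E1 E2]]]]]] :=
  corrector_family hr' (ltW hL) Qosc Qlip lg.
have [_ [_ bh _ _]] := lh; have [_ [_ bw _ _]] := lw.
have bgc u : bmr (gc u) by apply: bg; exact: clip_itv.
have sE u : s u = av (clip u).
  have u01 := clip_itv u.
  exact: esym (asymptotic_varianceE (hY u01) (hpi u01) (bgc u) (bh u) (bw u) (E1 u) (E2 u)).
have s0 u : 0 < s u.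
  have u01 := clip_itv u.
  apply: (stationary_variance_gt0 (hY u01) (hpi u01) (bgc u) (bh u) (bw u) (E1 u) (E2 u)).
  by move=> t t0; have := spec u01 t0; rewrite /Qc /gc (clip_id u01).
have [Cs [_ _ _ hCs]] := ls.
have cs : continuous s by apply: (@lipschitz_continuous _ _ Cs) => u v; exact: hCs u v point.
(* Pointwise positivity becomes a uniform lower bound at the minimum of the continuous function [s]
   on [[0, 1]]. *)
have [c c01 hc] := EVT_min (@ler01 R) (continuous_subspaceT cs).
(* [s u] is the asymptotic variance of the chain at [clip u], hence depends on [clip u] only. *)
have s_ge u : s c <= s u.
  by rewrite [s u]sE -(clip_id (clip_itv u)) -sE; apply: hc; rewrite in_itv; exact: clip_itv.
have bE : b = \int[leb]_(u in `[0, 1]) al u.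
  apply: eq_Rintegral => u; rewrite inE /= in_itv/= => u01.
  have := stationary_mean (hpi (clip_itv u)) (bgc u) (bh u) (E1 u).
  by rewrite /gc clip_id.
have aE : a = Num.sqrt (\int[leb]_(u in `[0, 1]) s u).
  congr Num.sqrt; apply: eq_Rintegral => u; rewrite inE /= in_itv/= => u01.
  by rewrite sE clip_id.
have a0 : 0 < a.
  by rewrite aE sqrtr_gt0; apply: lt_le_trans (s0 c) (integrated_variance_ge s_ge ls).
have SnE n : (1 <= n)%N -> @Sn n = psum (@X n) (fun k => gc (k%:R / n%:R)) n.
  move=> n1; apply/funext => o; apply: eq_big_nat => k /andP[_ kn].
  by rewrite /gc clip_div.
have bS n : (0 < n)%N -> bmr (@Sn n).
  by move=> n1; rewrite SnE//; apply: (bmr_psum (mX n1)).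
have close (T0 e : R) : 0 < T0 -> 0 < e -> exists N, forall n, (N <= n)%N -> exists D : R -> R,
    [/\ leb.-integrable `[0, T0] (EFin \o D),
        forall t, 0 <= t <= T0 -> normc (cintegral (PX n) (fun o => eit (t * Sn o)) -
          eit (t * (b * n%:R)) * (expR (- ((a * Num.sqrt n%:R * t) ^+ 2 / 2)))%:C%C) <= D t &
        Num.sqrt n%:R * \int[leb]_(t in `[0, T0]) D t <= e].
  move=> T00 e0.
  have [N hN] := characteristic_close hr' (ltW hL) Qosc Qclip lg spec (s0 c) s_ge la ls lh lw
    E1 E2 T00 e0.
  exists N.+1 => n nN; have [D [iD hD eD]] := hN n (ltnW nN).
  exists D; split=> // t ht; have n1 : (1 <= n)%N by exact: leq_trans nN.
  have P1 : PX n setT = 1%E by exact: probability_setT.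
  rewrite SnE// (char_psumE (mX n1) lg t (leqnn n)) bE aE.
  set z := (X in _ - X).
  have bPhi : bounded_measurable (fun o => prodtw Qc gc (fun k => k%:R / n%:R) t 0 n
      (fun=> 1) (@X n 0%N o)).
    have /bmCP[bR bI] := bm_prodtw Qc lg (fun k : nat => k%:R / n%:R) t 0 n (bmC_cst (1 : R[i])).
    by apply/bmCP; split; [exact: (bmr_coordinate (mX n1) (leq0n n) bR)|
      exact: (bmr_coordinate (mX n1) (leq0n n) bI)].
  (* The majorant is uniform in the starting point, so averaging over the law of [X 0] preserves
     it. *)
  rewrite -(cint_cst P1 z) -cintB//; last exact: bmC_cst.
  apply: (ler_normc_cint P1); first by apply: bmCB => //; exact: bmC_cst.
  by move=> o; exact: hD.
apply: (@cvg_ereal_sup0 R R (fun n v => `| a * Num.sqrt (2 * pi * n%:R) *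
  fine 'E_(PX n)[fun w => G (@Sn n w - v)] - (\int[leb]_x G x)
          * expR (- (v - b * n%:R) ^+ 2 / (2 * n%:R * a ^+ 2)) |)) => //.
move=> e e0; have [N hN] := llt_criterion a0 bS close hG e0; exists N => n nN v.
by have := hN n nN v; rewrite unlock.
Qed.

End local_limit_theorem.

Theorem theorem5 (R : realType) (E : pmetricType R)
    (Q : R -> R.-pker (borel E) ~> (borel E))
    (g : R -> borel E -> R)
    (* the invariant probability measures *)
    (pi_ : R -> probability (borel E) R)
    (hpi : forall u : R, 0 <= u <= 1 -> invariant_measure (Q u) (pi_ u))
    (* the inhomogeneous chains X_{n,0}, ..., X_{n,n} *)
    (dX : nat -> measure_display) (OX : forall n, measurableType (dX n))
    (PX : forall n, probability (OX n) R) (X : forall n, nat -> OX n -> borel E)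
    (hX : forall n, (1 <= n)%N ->
       markov_chain n (PX n) (pi_ 0) (fun k => Q (k%:R / n%:R)) (X n))
    (* the stationary chains Y_{j,u} *)
    (dY : R -> measure_display) (OY : forall u, measurableType (dY u))
    (PY : forall u, probability (OY u) R) (Y : forall u, nat -> OY u -> borel E)
    (hY : forall u : R, 0 <= u <= 1 -> forall N,
       markov_chain N (PY u) (pi_ u) (fun=> Q u) (Y u))
    (g_meas : measurable_fun (`[0%R : R, 1%R] `*` [set: borel E])
                (fun p : measurableTypeR R * borel E => g p.1 p.2))
    (L : R) (hL : 0 < L)
    (h_i : forall u v : R, 0 <= u <= 1 -> 0 <= v <= 1 -> forall x,
       (tv_norm (Q u x) (Q v x) <= (L * `|u - v|)%:E)%E)
    (m : nat) (hm : (1 <= m)%N) (r : R) (hr : 0 < r < 1)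
    (h_ii : forall u : R, 0 <= u <= 1 -> forall x y,
       (tv_norm (kernel_iter (Q u) m x) (kernel_iter (Q u) m y) <= r%:E)%E)
    (K : R) (h_iii : forall u : R, 0 <= u <= 1 -> forall x, `|g u x| <= K)
    (Cg : R) (hCg : 0 <= Cg)
    (h_iv : forall u v : R, 0 <= u <= 1 -> 0 <= v <= 1 -> forall x,
       `|g u x - g v x| <= Cg * `|u - v|)
    (h_v : forall u : R, 0 <= u <= 1 -> forall t : R, t != 0 ->
       (spectral_radius (twisted (Q u) (g u) (Complex 0 t)%R) < 1)%E)
    (G : R -> R) (hG : test_function G) :
  let b := \int[lebesgue_measure]_(u in `[0, 1]) \int[pi_ u]_x g u x in
  let a := Num.sqrt (\int[lebesgue_measure]_(u in `[0, 1])
                       asymptotic_variance (PY u) (g u) (Y u)) in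
  let Sn n w := \sum_(1 <= k < n.+1) g (k%:R / n%:R) (X n k w) in
  (fun n : nat => ereal_sup (range (fun v : R =>
     `| a * Num.sqrt (2 * pi * n%:R) * fine 'E_(PX n)[fun w => G (Sn n w - v)]
        - (\int[lebesgue_measure]_x G x)
          * expR (- (v - b * n%:R) ^+ 2 / (2 * n%:R * a ^+ 2)) |%:E)))
    @ \oo --> 0%E.
Proof.
exact: (@local_limit _ _ _ _ _ _ hpi _ _ _ _ hX _ _ _ _ hY g_meas _ _ _ _ _ hL h_i hr h_ii h_iii hCg h_iv h_v _ hG).
Qed.
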